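(* Let $N\in\mathbb{N}$. The following growth and decay estimates hold as $i,j,k\to+\infty$. (a) For each $a\in\{1,2,3,4\}$, if at least one of the four combinations $\omega_i\pm\omega_j\pm\omega_k$ does not tend to $\infty$, then $\omega_i\mathbb{F}_{ajki}=\mathcal{O}(\omega_i\omega_k)$ and $\omega_i\overline{\mathbb{F}}_{ajki}=\mathcal{O}(\omega_i\omega_k)$; if all four combinations $\omega_i\pm\omega_j\pm\omega_k\to\infty$, then both $\omega_i\mathbb{F}_{ajki}$ and $\omega_i\overline{\mathbb{F}}_{ajki}$ are $$\sum_\pm\mathcal{O}\left(\frac{\omega_i}{(\omega_i\pm\omega_j\pm\omega_k)^{p_a}}\right),\qquad p_1=8,\quad p_2=10,\quad p_3=p_4=2.$$ (b) If at least one of the four combinations $\omega_i\pm\omega_j\pm\omega_k$ does not tend to $\infty$, then $\omega_0\overline{\mathbb{R}}_{0kji}=\mathcal{O}(\omega_j\omega_i^{-1})$ and $\frac{\omega_0\mathbb{R}_{0kji}}{\omega_i}=\mathcal{O}(\omega_j\omega_i^{-1})$; if all four combinations $\omega_i\pm\omega_j\pm\omega_k\to\infty$, then both $\omega_0\overline{\mathbb{R}}_{0kji}$ and $\frac{\omega_0\mathbb{R}_{0kji}}{\omega_i}$ are $$\frac{1}{\omega_i}\sum_\pm\mathcal{O}\left(\frac{1}{(\omega_i\pm\omega_j\pm\omega_k)^N}\right).$$ (c) The following functions $F$ (the weights $F=\Gamma_a/\tan$ associated with the constants $\mathbb{F}_{ajki},\overline{\mathbb{F}}_{ajki}$ for $a=1,2,3,4$,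 and the weight $F=e_0'\cos^2$ associated with the constants $\mathbb{R}_{0kji},\overline{\mathbb{R}}_{0kji}$) have the following first non-vanishing derivative: $F^{(7)}(\pi/2)\ne0$ for $F=\Gamma_1/\tan$; $F^{(9)}(\pi/2)\neq0$ for $F=\Gamma_2/\tan$; $F'(\pi/2)\ne0$ for $F=\Gamma_3/\tan$ and for $F=\Gamma_4/\tan$; and for $F=e_0'\cos^2$ (constants $\mathbb{R}_{0kji},\overline{\mathbb{R}}_{0kji}$) there is none.
   Context: For integers $i\ge 0$ and $x\in[0,\pi/2]$ set $\omega_i:=3+2i$ and $$e_i(x):=2\frac{\sqrt{i!\,(i+2)!}}{\Gamma(i+\frac32)}\cos^3(x)\,P_i^{(\frac12,\frac32)}(\cos(2x)),$$ where $P_i^{(\alpha,\beta)}$ are the Jacobi polynomials (Szegő's normalization); $e_i'$ is the derivative of $e_i$. Let $$\Gamma_1(x):=\frac{\cos^3(x)}{\sin(x)}\int_0^x(e_0'(y))^2\tan^2(y)\,dy,\qquad \Gamma_2(x):=\omega_0^2\frac{\cos^3(x)}{\sin(x)}\int_0^x(e_0(y))^2\tan^2(y)\,dy,$$ $$\Gamma_3(x):=\int_0^x(e_0'(y))^2\sin(y)\cos(y)\,dy,\qquad \Gamma_4(x):=\omega_0^2\int_0^x(e_0(y))^2\sin(y)\cos(y)\,dy.$$ The Fourier constants are (for $a\in\{1,2,3,4\}$) $$\mathbb{F}_{ajki}:=\int_0^{\pi/2}\Gamma_ae_ie_je_k\tan^2dx,\qquad \overline{\mathbb{F}}_{ajki}:=\int_0^{\pi/2}\Gamma_a\,e_k\frac{e_i'}{\omega_i}\frac{e_j'}{\omega_j}\tan^2dx,$$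 $$\mathbb{R}_{klji}:=\int_0^{\pi/2}e_j\frac{e_k'}{\omega_k}\frac{e_l'}{\omega_l}\frac{e_i'}{\omega_i}\frac{\sin^3}{\cos}dx,\qquad \overline{\mathbb{R}}_{klji}:=\int_0^{\pi/2}e_j\frac{e_k'}{\omega_k}\frac{e_l'}{\omega_l}\left(\int_x^{\pi/2}e_i(y)\sin(y)\cos(y)dy\right)\tan^2(x)dx,$$ so that $\mathbb{R}_{0kji}$ and $\overline{\mathbb{R}}_{0kji}$ carry the factors $e_j\frac{e_0'}{\omega_0}\frac{e_k'}{\omega_k}$. Conventions. $\omega_i\pm\omega_j\pm\omega_k$ stands for all four combinations of signs (with $\omega_i$ having sign $+$) and $\sum_\pm$ is the sum over all of them. The estimates are understood along arbitrary sequences of triples $(i,j,k)$ with all indices tending to $+\infty$; ''$\to\infty$'' for a combination means that it tends to $+\infty$ along the sequence. $\sum_\pm\mathcal{O}(f_\pm)$ denotes a quantity bounded in absolute value, for all sufficiently large indices along the sequence, by a constant (possibly depending on $N$) times $\sum_\pm|f_\pm|$. ''First non-vanishing derivative $F^{(n)}(\pi/2)\ne0$'' with $n=2r+1$ means: $F^{(2l)}(0)=F^{(2l+1)}(\pi/2)=0$ for all integers $0\le l<r$, and $F^{(n)}(\pi/2)\neq0$; ''none'' means that $F^{(2l)}(0)=F^{(2l+1)}(\pi/2)=0$ for all $l\ge0$. Values at endpoints are understood by continuous extension. *)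

(* Defs.v *)
From Stdlib Require Import Reals Factorial.
From Coquelicot Require Import Coquelicot.
Open Scope R_scope.

(* Euler's integral; only used for s > 0. *)
Definition EulerGamma (s : R) : R :=
  RInt_gen (fun t => Rpower t (s - 1) * exp (- t))
           (at_right 0) (Rbar_locally p_infty).

(* Generalized binomial coefficient a (a-1) ... (a-k+1) / k!. *)
Fixpoint gbinom (a : R) (k : nat) : R :=
  match k with
  | O => 1
  | S k' => gbinom a k' * (a - INR k') / INR (S k')
  end.

(* Szego, Orthogonal Polynomials, (4.3.2); the normalization is
   P_n^{(alpha,beta)}(1) = binom(n+alpha, n). *)
Definition Jacobi (alpha beta : R) (n : nat) (x : R) : R :=
  sum_f_R0 (fun s => gbinom (INR n + alpha) (n - s) * gbinom (INR n + beta) s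
                     * ((x - 1) / 2) ^ s * ((x + 1) / 2) ^ (n - s)) n.

Definition omega (i : nat) : R := 3 + 2 * INR i.

Definition e (i : nat) (x : R) : R :=
  2 * (sqrt (INR (fact i) * INR (fact (i + 2))) / EulerGamma (INR i + 3 / 2))
  * cos x ^ 3 * Jacobi (1 / 2) (3 / 2) i (cos (2 * x)).

(* The functions and integrands below are only meaningful on the open interval
   (0, PI/2); they extend continuously to its end points, and [RInt] does not
   depend on the values there. *)

Inductive index := I1 | I2 | I3 | I4.

Definition Gam (a : index) (x : R) : R :=
  match a with
  | I1 => cos x ^ 3 / sin x
          * RInt (fun y => Derive (e 0) y ^ 2 * tan y ^ 2) 0 x
  | I2 => omega 0 ^ 2 * (cos x ^ 3 / sin x)
          * RInt (fun y => e 0 y ^ 2 * tan y ^ 2) 0 x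
  | I3 => RInt (fun y => Derive (e 0) y ^ 2 * sin y * cos y) 0 x
  | I4 => omega 0 ^ 2 * RInt (fun y => e 0 y ^ 2 * sin y * cos y) 0 x
  end.

Definition FF (a : index) (j k i : nat) : R :=
  RInt (fun x => Gam a x * e i x * e j x * e k x * tan x ^ 2) 0 (PI / 2).

Definition FFbar (a : index) (j k i : nat) : R :=
  RInt (fun x => Gam a x * e k x * (Derive (e i) x / omega i)
                 * (Derive (e j) x / omega j) * tan x ^ 2) 0 (PI / 2).

Definition RR (k l j i : nat) : R :=
  RInt (fun x => e j x * (Derive (e k) x / omega k) * (Derive (e l) x / omega l)
                 * (Derive (e i) x / omega i) * (sin x ^ 3 / cos x)) 0 (PI / 2).

Definition RRbar (k l j i : nat) : R :=
  RInt (fun x => e j x * (Derive (e k) x / omega k) * (Derive (e l) x / omega l)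
                 * RInt (fun y => e i y * sin y * cos y) x (PI / 2)
                 * tan x ^ 2) 0 (PI / 2).

Definition sgn (s : bool) : R := if s then 1 else - 1.

Definition comb (s t : bool) (i j k : nat) : R :=
  omega i + sgn s * omega j + sgn t * omega k.

Definition sum_pm (f : bool -> bool -> R) : R :=
  f true true + f true false + f false true + f false false.

Definition tends_to_infty (u : nat -> R) : Prop := is_lim_seq u p_infty.

Definition all_combs_infty (i j k : nat -> nat) : Prop :=
  forall s t : bool, tends_to_infty (fun n => comb s t (i n) (j n) (k n)).

Definition some_comb_not_infty (i j k : nat -> nat) : Prop :=
  exists s t : bool, ~ tends_to_infty (fun n => comb s t (i n) (j n) (k n)).

Definition bigO (q f : nat -> R) : Prop :=
  exists C : R, eventually (fun n => Rabs (q n) <= C * Rabs (f n)).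

Definition sum_bigO (q : nat -> R) (f : bool -> bool -> nat -> R) : Prop :=
  exists C : R,
    eventually (fun n => Rabs (q n) <= C * sum_pm (fun s t => Rabs (f s t n))).

Definition decay (a : index) : nat :=
  match a with I1 => 8 | I2 => 10 | I3 => 2 | I4 => 2 end.

(* [endpoint_derivative F n near v]: the n-th derivative of F, continuously
   extended to the end point approached by the one-sided filter [near], has the
   value v there.  Differentiability is required near the end point for every
   order up to n because [Derive_n] is total. *)
Definition endpoint_derivative (F : R -> R) (n : nat)
    (near : (R -> Prop) -> Prop) (v : R) : Prop :=
  (forall m : nat, (m <= n)%nat -> near (fun x => ex_derive_n F m x)) /\
  filterlim (Derive_n F n) near (locally v).

Definition derivatives_vanish_at (F : R -> R) (l : nat) : Prop :=
  endpoint_derivative F (2 * l) (at_right 0) 0 /\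
  endpoint_derivative F (2 * l + 1) (at_left (PI / 2)) 0.

Definition first_nonvanishing_derivative (F : R -> R) (n : nat) : Prop :=
  exists r : nat, n = (2 * r + 1)%nat /\
    (forall l : nat, (l < r)%nat -> derivatives_vanish_at F l) /\
    exists v : R, endpoint_derivative F n (at_left (PI / 2)) v /\ v <> 0.

Definition no_nonvanishing_derivative (F : R -> R) : Prop :=
  forall l : nat, derivatives_vanish_at F l.

(* Main.v *)
Require Import Defs.
From Stdlib Require Import Reals Factorial Lra Lia Psatz.
From Coquelicot Require Import Coquelicot.
Open Scope R_scope.

(** Everything rests on the closed form
      e_i = kappa_i (omega_i sin(omega_i x) cot x - cos(omega_i x)),
    with kappa_i of size 1 / omega_i ([e_closed_form]).  It comes from expanding
    sin(omega_i x) and cos(omega_i x) by de Moivre and matching the result with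
    the coefficients of the Jacobi polynomial; the normalization of e_i then
    reduces, through the recurrence of the Gamma function, to Gamma(3/2), which
    has to be shown positive.

    Since omega_i is odd, cos(omega_i x) tan x and sin(omega_i x) cot x are
    trigonometric polynomials with odd frequencies at most omega_i and with
    coefficients of l1-norm omega_i.  Hence e_i tan and e_i' tan / omega_i are a
    sine and a cosine polynomial with odd frequencies at most omega_i whose
    l1-norms are bounded independently of i, while e_i has l1-norm O(omega_i)
    ([odd_trig_poly_modes]).  Distributing the powers of tan over the modes so
    that at most one mode is left with a growing norm gives the resonant bounds;
    for Rbar the integral of e_i sin cos supplies the factor 1 / omega_i.

    If all combinations tend to infinity then so does
    M = omega_i - omega_j - omega_k, the smallest of them, whose term dominates
    the sum.  Write Gamma_a = sin^2 W, so that the weight of the three modes is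
    F = sin cos W.  Expanding only the modes j and k in their frequencies, the
    constant becomes an l1-bounded combination of integrals of F sin(qx) and,
    with the small factor kappa_i, of sin^2 W cos(qx) or cos^2 W cos(qx), over
    odd q at least M ([three_modes_bound]).

    For odd q each double integration by parts of F sin(qx) gains q^-2 and leaves
    only an even derivative of F at 0, which is zero because F is odd there, and
    an odd derivative of F at pi/2; so the exponent is read off from the first
    odd derivative at pi/2 that does not vanish ([sine_integral_decay]).  To find
    it, split W about pi/2 into a function odd about pi/2, which contributes
    nothing, and a function vanishing there to the exact order 2r
    ([admissible_weight]).  For a = 1, 2 one has W = (cos/sin)^3 H with
    H' = cos^2 sin^4, respectively cos^4 sin^2, up to a constant factor; in
    W = H(pi/2) cot^3 + cot^3 (H - H(pi/2)) the last factor vanishes to order 3,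
    respectively 5, so r = 3, respectively 4.  For a = 3, 4 the function W is a
    polynomial in cos^2 with W(pi/2) <> 0 and r = 0.  The same data yield (c).

    For R and Rbar the weight is itself a trigonometric polynomial, of degree at
    most 5; by orthogonality these constants vanish as soon as M is large, which
    is stronger than any power decay. *)

(** * Smooth functions on an open set *)

(** Stated through [Derive], so that the iterated derivatives are those of
    [Derive_n]; closure under products is a plain induction, with no Leibniz
    formula. *)
Fixpoint differentiable_n (U : R -> Prop) (n : nat) (f : R -> R) : Prop :=
  match n with
  | O => True
  | S m => (forall x, U x -> ex_derive f x) /\ differentiable_n U m (Derive f)
  end.

Definition smooth (U : R -> Prop) (f : R -> R) : Prop :=
  forall n, differentiable_n U n f.

Lemma differentiable_n_ext U n f g :
  open U -> (forall x, U x -> f x = g x) ->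
  differentiable_n U n f -> differentiable_n U n g.
Proof.
  intros HU; revert f g; induction n as [|n IH]; intros f g Hfg; [easy|].
  assert (Hloc : forall x, U x -> locally x (fun t => f t = g t)).
  { intros x Hx; apply filter_imp with (2 := HU x Hx); auto. }
  intros [H1 H2]; split.
  - intros x Hx; apply ex_derive_ext_loc with f; auto.
  - apply IH with (Derive f); auto.
    intros x Hx; apply Derive_ext_loc; auto.
Qed.

Lemma differentiable_n_pred U n f :
  differentiable_n U (S n) f -> differentiable_n U n f.
Proof.
  revert f; induction n as [|n IH]; intros f; [easy|].
  intros [H1 H2]; split; [easy|]; apply IH; exact H2.
Qed.

Lemma smooth_ext U f g :
  open U -> (forall x, U x -> f x = g x) -> smooth U f -> smooth U g.
Proof. intros HU H Hf n; apply differentiable_n_ext with f; auto. Qed.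

Lemma smooth_sub U V f :
  (forall x, V x -> U x) -> smooth U f -> smooth V f.
Proof.
  intros H Hf n; generalize (Hf n); clear Hf; revert f.
  induction n as [|n IH]; intros f; [easy|].
  intros [H1 H2]; split; auto.
Qed.

Lemma smooth_ex_derive U f x : smooth U f -> U x -> ex_derive f x.
Proof. intros Hf; apply (proj1 (Hf 1%nat)). Qed.

Lemma smooth_continuous U f x : smooth U f -> U x -> continuous f x.
Proof.
  intros Hf Hx; apply (ex_derive_continuous f), smooth_ex_derive with U; auto.
Qed.

Lemma smooth_Derive U f : smooth U f -> smooth U (Derive f).
Proof. intros Hf n; apply (proj2 (Hf (S n))). Qed.

Lemma smooth_intro U f :
  (forall x, U x -> ex_derive f x) -> smooth U (Derive f) -> smooth U f.
Proof. intros H1 H2 [|n]; [easy|]; split; auto; apply H2. Qed.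

Lemma smooth_Derive_n U f n : smooth U f -> smooth U (Derive_n f n).
Proof.
  intros Hf; induction n as [|n IH]; [exact Hf|]; apply smooth_Derive, IH.
Qed.

Lemma smooth_ex_derive_n U f n x : smooth U f -> U x -> ex_derive_n f n x.
Proof.
  intros Hf Hx; destruct n as [|n]; [easy|].
  apply smooth_ex_derive with U; auto; apply smooth_Derive_n; auto.
Qed.

Lemma differentiable_n_const U n c : open U -> differentiable_n U n (fun _ => c).
Proof.
  intros HU; revert c; induction n as [|n IH]; intros c; [easy|]; split.
  - intros; apply ex_derive_const.
  - apply differentiable_n_ext with (fun _ => 0); auto.
    intros x _; now rewrite Derive_const.
Qed.

Lemma smooth_const U c : open U -> smooth U (fun _ => c).
Proof. intros HU n; now apply differentiable_n_const. Qed.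

Lemma smooth_id U : open U -> smooth U (fun x => x).
Proof.
  intros HU; apply smooth_intro.
  - intros; apply ex_derive_id.
  - apply smooth_ext with (fun _ => 1); auto.
    + intros x _; now rewrite Derive_id.
    + now apply smooth_const.
Qed.

Lemma differentiable_n_plus U n f g :
  open U -> differentiable_n U n f -> differentiable_n U n g ->
  differentiable_n U n (fun x => f x + g x).
Proof.
  intros HU; revert f g; induction n as [|n IH]; intros f g; [easy|].
  intros [F1 F2] [G1 G2]; split.
  - intros x Hx; apply (ex_derive_plus f g); auto.
  - apply differentiable_n_ext with (fun x => Derive f x + Derive g x); auto.
    intros x Hx; symmetry; apply (Derive_plus f g); auto.
Qed.

Lemma smooth_plus U f g :
  open U -> smooth U f -> smooth U g -> smooth U (fun x => f x + g x).
Proof. intros HU F G n; apply differentiable_n_plus; auto. Qed.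

Lemma differentiable_n_mult U n f g :
  open U -> differentiable_n U n f -> differentiable_n U n g ->
  differentiable_n U n (fun x => f x * g x).
Proof.
  intros HU; revert f g; induction n as [|n IH]; intros f g; [easy|].
  intros F G; generalize (differentiable_n_pred _ _ _ F) (differentiable_n_pred _ _ _ G).
  destruct F as [F1 F2]; destruct G as [G1 G2]; intros F G; split.
  - intros x Hx; apply (ex_derive_mult f g); auto.
  - apply differentiable_n_ext with (fun x => Derive f x * g x + f x * Derive g x); auto.
    + intros x Hx; symmetry; apply (Derive_mult f g); auto.
    + apply differentiable_n_plus; auto.
Qed.

Lemma smooth_mult U f g :
  open U -> smooth U f -> smooth U g -> smooth U (fun x => f x * g x).
Proof. intros HU F G n; apply differentiable_n_mult; auto. Qed.

Lemma smooth_scal U c f : open U -> smooth U f -> smooth U (fun x => c * f x).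
Proof. intros HU F; apply smooth_mult; auto; now apply smooth_const. Qed.

Lemma smooth_minus U f g :
  open U -> smooth U f -> smooth U g -> smooth U (fun x => f x - g x).
Proof.
  intros HU F G; apply smooth_ext with (fun x => f x + (-1) * g x); auto.
  - intros; ring.
  - apply smooth_plus; auto; now apply smooth_scal.
Qed.

Lemma smooth_pow U f n : open U -> smooth U f -> smooth U (fun x => f x ^ n).
Proof.
  intros HU F; induction n as [|n IH]; simpl.
  - now apply smooth_const.
  - now apply (smooth_mult U f (fun x => f x ^ n)).
Qed.

Lemma smooth_inv U f :
  open U -> smooth U f -> (forall x, U x -> f x <> 0) -> smooth U (fun x => / f x).
Proof.
  intros HU F Hf n; induction n as [|n IH]; [easy|]; split.
  - intros x Hx; apply ex_derive_inv; auto; now apply smooth_ex_derive with U.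
  - apply differentiable_n_ext with (fun x => (-1 * Derive f x) * (/ f x * / f x)); auto.
    + intros x Hx; rewrite Derive_inv; auto.
      * field; auto.
      * now apply smooth_ex_derive with U.
    + apply differentiable_n_mult; auto; [|now apply differentiable_n_mult].
      apply differentiable_n_mult; auto; [now apply differentiable_n_const|].
      apply (proj2 (F (S n))).
Qed.

Lemma differentiable_n_sin_cos U n :
  open U -> differentiable_n U n sin /\ differentiable_n U n cos.
Proof.
  intros HU.
  assert (Ds : forall x, is_derive sin x (cos x)) by (intros; auto_derive; [easy|ring]).
  assert (Dc : forall x, is_derive cos x (-1 * sin x)) by (intros; auto_derive; [easy|ring]).
  induction n as [|n [IHs IHc]]; [easy|]; split; split.
  - intros x _; now exists (cos x).
  - apply differentiable_n_ext with cos; auto.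
    intros x _; symmetry; now apply is_derive_unique.
  - intros x _; now exists (-1 * sin x).
  - apply differentiable_n_ext with (fun x => -1 * sin x); auto.
    + intros x _; symmetry; now apply is_derive_unique.
    + apply differentiable_n_mult; auto; now apply differentiable_n_const.
Qed.

Lemma smooth_sin U : open U -> smooth U sin.
Proof. intros HU n; now apply differentiable_n_sin_cos. Qed.

Lemma smooth_cos U : open U -> smooth U cos.
Proof. intros HU n; now apply differentiable_n_sin_cos. Qed.

(** * Parity and order of vanishing *)

Lemma Derive_reflection U a s f :
  open U -> (forall x, U x -> U (2 * a - x)) -> smooth U f ->
  (forall x, U x -> f (2 * a - x) = s * f x) ->
  forall x, U x -> Derive f (2 * a - x) = - s * Derive f x.
Proof.
  intros HU Hsym Hf Hs x Hx.
  assert (E : Derive (fun t => f (2 * a - t)) x = Derive (fun t => s * f t) x).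
  { apply Derive_ext_loc, filter_imp with (2 := HU x Hx); auto. }
  rewrite Derive_scal in E.
  rewrite (Derive_comp f (fun t => 2 * a - t)) in E.
  - assert (E2 : Derive (fun t => 2 * a - t) x = -1).
    { apply is_derive_unique; auto_derive; [easy|ring]. }
    rewrite E2 in E; lra.
  - apply smooth_ex_derive with U; auto.
  - auto_derive; easy.
Qed.

Lemma Derive_n_reflection U a s f n :
  open U -> (forall x, U x -> U (2 * a - x)) -> smooth U f ->
  (forall x, U x -> f (2 * a - x) = s * f x) ->
  forall x, U x -> Derive_n f n (2 * a - x) = (-1) ^ n * s * Derive_n f n x.
Proof.
  intros HU Hsym Hf Hs; induction n as [|n IH]; intros x Hx.
  - simpl; rewrite Hs; auto; ring.
  - change (Derive_n f (S n)) with (Derive (Derive_n f n)).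
    rewrite (Derive_reflection U a ((-1) ^ n * s) (Derive_n f n)); auto.
    + simpl; ring.
    + now apply smooth_Derive_n.
Qed.

(** Reflection about a multiplies the n-th derivative by (-1)^n s. *)
Lemma Derive_n_reflection_center U a s f n :
  open U -> (forall x, U x -> U (2 * a - x)) -> smooth U f ->
  (forall x, U x -> f (2 * a - x) = s * f x) -> U a -> (-1) ^ n * s = -1 ->
  Derive_n f n a = 0.
Proof.
  intros HU Hsym Hf Hs Ha Hn.
  generalize (Derive_n_reflection U a s f n HU Hsym Hf Hs a Ha).
  rewrite Hn; replace (2 * a - a) with a by ring; lra.
Qed.

(** The coefficient c is that of (x - a)^k in the Taylor expansion, whence the
    factor k produced by each derivative: with this normalization coefficients
    multiply in products, whereas values of derivatives would need binomials. *)
Fixpoint leading_term (a : R) (k : nat) (c : R) (f : R -> R) : Prop :=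
  match k with
  | O => f a = c
  | S l => f a = 0 /\ leading_term a l (INR (S l) * c) (Derive f)
  end.

Lemma leading_term_ext U a k c f g :
  open U -> U a -> (forall x, U x -> f x = g x) ->
  leading_term a k c f -> leading_term a k c g.
Proof.
  intros HU Ha; revert c f g; induction k as [|k IH]; intros c f g H.
  - simpl; intros <-; symmetry; auto.
  - intros [H1 H2]; split; [rewrite <- H; auto|].
    apply IH with (Derive f); auto.
    intros x Hx; apply Derive_ext_loc, filter_imp with (2 := HU x Hx); auto.
Qed.

Lemma leading_term_plus U a k c d f g :
  open U -> U a -> smooth U f -> smooth U g ->
  leading_term a k c f -> leading_term a k d g ->
  leading_term a k (c + d) (fun x => f x + g x).
Proof.
  intros HU Ha; revert c d f g; induction k as [|k IH]; intros c d f g Hf Hg.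
  - simpl; intros -> ->; easy.
  - intros [F1 F2] [G1 G2]; split; [rewrite F1, G1; ring|].
    apply leading_term_ext with (1 := HU) (f := fun x => Derive f x + Derive g x); auto.
    + intros x Hx; symmetry; apply (Derive_plus f g); now apply smooth_ex_derive with U.
    + rewrite Rmult_plus_distr_l; apply IH; auto; now apply smooth_Derive.
Qed.

Lemma leading_term_weaken a k d f :
  leading_term a (S k) d f -> leading_term a k 0 f.
Proof.
  revert d f; induction k as [|k IH]; intros d f [H1 H2]; [exact H1|].
  split; auto; rewrite Rmult_0_r; now apply IH with (INR (S (S k)) * d).
Qed.

(** By induction on the total order, as (f g)' = f' g + f g' and k + l is the order
    of the product; when one of the orders is 0 the derivative of that factor has
    unknown order, but it multiplies a factor of order one more than needed. *)
Lemma leading_term_mult U a k l c d f g :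
  open U -> U a -> smooth U f -> smooth U g ->
  leading_term a k c f -> leading_term a l d g ->
  leading_term a (k + l) (c * d) (fun x => f x * g x).
Proof.
  intros HU Ha; remember (k + l)%nat as n eqn:En.
  revert k l En c d f g.
  induction n as [|n IH]; intros k l En c d f g Hf Hg.
  - destruct k; [|lia]; destruct l; [|lia]; simpl; intros -> ->; easy.
  - intros F G; split.
    + destruct k as [|k].
      * destruct l as [|l]; [lia|]; destruct G as [-> _]; ring.
      * destruct F as [-> _]; ring.
    + apply leading_term_ext with (1 := HU) (f := fun x => Derive f x * g x + f x * Derive g x); auto.
      { intros x Hx; symmetry; apply (Derive_mult f g); now apply smooth_ex_derive with U. }
      assert (Hf' := smooth_Derive _ _ Hf); assert (Hg' := smooth_Derive _ _ Hg).
      replace (INR (S n) * (c * d)) with (INR k * c * d + c * (INR l * d)).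
      2:{ rewrite En, plus_INR; ring. }
      apply leading_term_plus with U; auto using smooth_mult.
      * destruct k as [|k].
        -- replace (INR 0 * c * d) with (Derive f a * 0) by (simpl; ring).
           apply (IH 0%nat n); auto; [easy|].
           destruct l as [|l]; [lia|]; assert (n = l) by lia; subst l.
           now apply leading_term_weaken with d.
        -- apply (IH k l); auto; first [lia | apply F].
      * destruct l as [|l].
        -- replace (c * (INR 0 * d)) with (0 * Derive g a) by (simpl; ring).
           apply (IH n 0%nat); auto; [lia| |easy].
           destruct k as [|k]; [lia|]; assert (n = k) by lia; subst k.
           now apply leading_term_weaken with c.
        -- apply (IH k l); auto; [lia|apply G].
Qed.

Lemma Derive_n_shift f m : Derive_n f (S m) = Derive_n (Derive f) m.
Proof. induction m as [|m IH]; [easy|]; simpl in *; now rewrite IH. Qed.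

Lemma leading_term_lower a k c f m :
  leading_term a k c f -> (m < k)%nat -> Derive_n f m a = 0.
Proof.
  revert k c f; induction m as [|m IH]; intros [|k] c f H Hm; try lia.
  - apply H.
  - rewrite Derive_n_shift; apply IH with k (INR (S k) * c); [apply H|lia].
Qed.

Lemma leading_term_Derive_n a k c f :
  leading_term a k c f -> Derive_n f k a = INR (fact k) * c.
Proof.
  revert c f; induction k as [|k IH]; intros c f H.
  - simpl in *; rewrite H; ring.
  - rewrite Derive_n_shift, (IH (INR (S k) * c)); [|apply H].
    rewrite fact_simpl, mult_INR; ring.
Qed.

(** * Moments, and smoothness of removable singularities *)

Definition everywhere : R -> Prop := fun _ => True.

Lemma open_everywhere : open everywhere.
Proof. apply open_true. Qed.

(** For smooth f this is x^-(n+1) times the integral of y^n f(y) over [0, x],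
    in a form that is visibly smooth at 0 ([moment_eq]). *)
Definition moment (n : nat) (f : R -> R) (x : R) : R :=
  RInt (fun t => t ^ n * f (x * t)) 0 1.

Lemma continuous_moment_integrand n f x t :
  smooth everywhere f -> continuous (fun t => t ^ n * f (x * t)) t.
Proof.
  intros Hf; apply (continuous_mult (fun t => t ^ n) (fun t => f (x * t))).
  - apply (smooth_continuous everywhere); [|easy].
    apply smooth_pow, smooth_id; apply open_everywhere.
  - apply (continuous_comp (fun t => x * t) f).
    + apply (continuous_mult (fun _ => x) (fun t => t));
        [apply continuous_const|apply continuous_id].
    + now apply smooth_continuous with everywhere.
Qed.

Lemma is_derive_moment n f x :
  smooth everywhere f ->
  is_derive (moment n f) x (moment (S n) (Derive f) x).
Proof.
  intros Hf; unfold moment.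
  assert (D : forall u t, is_derive (fun u => t ^ n * f (u * t)) u
                            (t ^ S n * Derive f (u * t))).
  { intros u t.
    assert (H := smooth_ex_derive _ f (u * t) Hf I).
    replace (t ^ S n * Derive f (u * t)) with (t ^ n * (t * Derive f (u * t)))
      by (simpl; ring).
    apply is_derive_scal, (is_derive_comp f (fun u => u * t)).
    - now apply Derive_correct.
    - auto_derive; [easy|ring]. }
  replace (RInt (fun t => t ^ S n * Derive f (x * t)) 0 1)
    with (RInt (fun t => Derive (fun u => t ^ n * f (u * t)) x) 0 1).
  2:{ apply RInt_ext; intros t _; apply is_derive_unique, D. }
  apply (is_derive_RInt_param (fun u t => t ^ n * f (u * t))).
  - apply filter_forall; intros u t _; eexists; apply D.
  - intros t _.
    apply (continuity_2d_pt_ext (fun u v => v ^ S n * Derive f (u * v))).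
    { intros u v; symmetry; apply is_derive_unique, D. }
    apply continuity_2d_pt_mult.
    + apply (continuity_1d_2d_pt_comp (fun v => v ^ S n) (fun u v => v)).
      * apply continuity_pt_filterlim, (smooth_continuous everywhere); [|easy].
        apply smooth_pow, smooth_id; apply open_everywhere.
      * apply continuity_2d_pt_id2.
    + apply (continuity_1d_2d_pt_comp (Derive f) (fun u v => u * v)).
      * apply continuity_pt_filterlim, (smooth_continuous everywhere); [|easy].
        now apply smooth_Derive.
      * apply continuity_2d_pt_mult;
          [apply continuity_2d_pt_id1|apply continuity_2d_pt_id2].
  - apply filter_forall; intros u; apply (ex_RInt_continuous (V := R_CompleteNormedModule)).
    intros t _; now apply continuous_moment_integrand.
Qed.

(** Differentiation under the integral sign turns the n-th moment of f into the
    (n+1)-th moment of f', so the moments are closed under derivation. *)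
Lemma smooth_moment n f : smooth everywhere f -> smooth everywhere (moment n f).
Proof.
  intros Hf k; revert n f Hf; induction k as [|k IH]; intros n f Hf; [easy|].
  split.
  - intros x _; eexists; now apply is_derive_moment.
  - apply differentiable_n_ext with (moment (S n) (Derive f)).
    + apply open_everywhere.
    + intros x _; symmetry; now apply is_derive_unique, is_derive_moment.
    + apply IH; now apply smooth_Derive.
Qed.

Lemma moment_eq n f x :
  smooth everywhere f -> x ^ S n * moment n f x = RInt (fun y => y ^ n * f y) 0 x.
Proof.
  intros Hf.
  assert (E : RInt (fun y => y ^ n * f y) 0 x =
              RInt (fun t => x * ((x * t + 0) ^ n * f (x * t + 0))) 0 1).
  { symmetry.
    transitivity (RInt (fun y => y ^ n * f y) (x * 0 + 0) (x * 1 + 0)).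
    - apply (RInt_comp_lin (fun y => y ^ n * f y) x 0 0 1).
      apply (ex_RInt_continuous (V := R_CompleteNormedModule)); intros t _.
      apply (smooth_continuous everywhere); [|easy].
      apply smooth_mult; auto; [apply open_everywhere|].
      apply smooth_pow, smooth_id; apply open_everywhere.
    - f_equal; ring. }
  rewrite E; unfold moment.
  rewrite <- (RInt_scal (V := R_CompleteNormedModule)).
  - apply RInt_ext; intros t _; unfold scal; simpl; unfold mult; simpl.
    rewrite Rplus_0_r, Rpow_mult_distr; ring.
  - apply (ex_RInt_continuous (V := R_CompleteNormedModule)).
    intros t _; now apply continuous_moment_integrand.
Qed.

(** * Decay of oscillatory integrals by parts *)

Lemma trig_quarter_turn q :
  Nat.Odd q -> cos (INR q * (PI / 2)) = 0 /\ Rabs (sin (INR q * (PI / 2))) = 1.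
Proof.
  intros [h ->].
  assert (E : cos (INR (2 * h + 1) * (PI / 2)) = 0).
  { rewrite plus_INR, mult_INR; simpl (INR 2); simpl (INR 1).
    replace (((1 + 1) * INR h + 1) * (PI / 2)) with (INR h * PI + PI / 2) by field.
    rewrite cos_plus, cos_PI2, sin_PI2.
    replace (sin (INR h * PI)) with 0; [ring|].
    symmetry; apply sin_eq_0_1; exists (Z.of_nat h); now rewrite <- INR_IZR_INZ. }
  split; [exact E|].
  assert (P := sin2_cos2 (INR (2 * h + 1) * (PI / 2))).
  rewrite E in P; unfold Rsqr in P.
  unfold Rabs; destruct Rcase_abs; nra.
Qed.

Definition sine_integral (f : R -> R) (q : nat) : R :=
  RInt (fun x => f x * sin (INR q * x)) 0 (PI / 2).

Definition cosine_integral (f : R -> R) (q : nat) : R :=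
  RInt (fun x => f x * cos (INR q * x)) 0 (PI / 2).

Definition covers_quadrant (U : R -> Prop) : Prop :=
  open U /\ forall x, 0 <= x <= PI / 2 -> U x.

Lemma quadrant_interval x :
  Rmin 0 (PI / 2) <= x <= Rmax 0 (PI / 2) -> 0 <= x <= PI / 2.
Proof.
  assert (H := PI_RGT_0); rewrite Rmin_left, Rmax_right; lra.
Qed.

Lemma ex_RInt_quadrant (f : R -> R) :
  (forall x, 0 <= x <= PI / 2 -> continuous f x) -> ex_RInt f 0 (PI / 2).
Proof.
  intros H; apply (ex_RInt_continuous (V := R_CompleteNormedModule)).
  intros x Hx; now apply H, quadrant_interval.
Qed.

Lemma integration_by_parts U f phi phi' :
  covers_quadrant U -> smooth U f ->
  (forall x, is_derive phi x (phi' x)) -> (forall x, continuous phi' x) ->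
  RInt (fun x => f x * phi' x) 0 (PI / 2)
  = f (PI / 2) * phi (PI / 2) - f 0 * phi 0
    - RInt (fun x => Derive f x * phi x) 0 (PI / 2).
Proof.
  intros [HU HQ] Hf Hphi Cphi'.
  assert (C : forall x, 0 <= x <= PI / 2 -> continuous f x)
    by (intros; apply smooth_continuous with U; auto).
  assert (C' : forall x, 0 <= x <= PI / 2 -> continuous (Derive f) x)
    by (intros; apply smooth_continuous with U; auto; now apply smooth_Derive).
  assert (Cphi : forall x, continuous phi x)
    by (intros x; apply (ex_derive_continuous (V := R_NormedModule)); now exists (phi' x)).
  assert (C1 : forall x, 0 <= x <= PI / 2 -> continuous (fun x => Derive f x * phi x) x)
    by (intros x Hx; apply (continuous_mult (Derive f)); auto).
  assert (C2 : forall x, 0 <= x <= PI / 2 -> continuous (fun x => f x * phi' x) x)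
    by (intros x Hx; apply (continuous_mult f); auto).
  assert (E : is_RInt (fun x => Derive f x * phi x + f x * phi' x) 0 (PI / 2)
                (f (PI / 2) * phi (PI / 2) - f 0 * phi 0)).
  { apply (is_RInt_derive (V := R_CompleteNormedModule) (fun x => f x * phi x)).
    - intros x Hx; apply quadrant_interval in Hx.
      apply (is_derive_mult f phi); [|apply Hphi|apply Rmult_comm].
      apply Derive_correct, smooth_ex_derive with U; auto.
    - intros x Hx; apply quadrant_interval in Hx.
      apply (continuous_plus (fun x => Derive f x * phi x)); auto. }
  apply (is_RInt_unique (V := R_CompleteNormedModule)) in E.
  rewrite (RInt_plus (V := R_CompleteNormedModule) (fun x => Derive f x * phi x)) in E;
    auto using ex_RInt_quadrant.
  unfold plus in E; simpl in E; lra.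
Qed.

(** The boundary term at pi/2 is missing because q is odd. *)
Lemma sine_integral_parts U f q :
  covers_quadrant U -> smooth U f -> Nat.Odd q ->
  sine_integral f q = f 0 / INR q + cosine_integral (Derive f) q / INR q.
Proof.
  intros HU Hf Hq.
  assert (q0 : INR q <> 0) by (destruct Hq as [h ->]; apply not_0_INR; lia).
  unfold sine_integral, cosine_integral.
  rewrite (integration_by_parts U f (fun x => - / INR q * cos (INR q * x))); auto.
  - rewrite (proj1 (trig_quarter_turn q Hq)), !Rmult_0_r, cos_0.
    replace (RInt (fun x => Derive f x * (- / INR q * cos (INR q * x))) 0 (PI / 2))
      with (- / INR q * RInt (fun x => Derive f x * cos (INR q * x)) 0 (PI / 2)).
    + field; auto.
    + rewrite <- (RInt_scal (V := R_CompleteNormedModule)).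
      * apply RInt_ext; intros; unfold scal; simpl; unfold mult; simpl; ring.
      * apply ex_RInt_quadrant; intros x Hx.
        apply (continuous_mult (Derive f)).
        -- apply smooth_continuous with U; [now apply smooth_Derive|now apply HU].
        -- apply (ex_derive_continuous (V := R_NormedModule)); auto_derive; auto.
  - intros x; auto_derive; [easy|field; auto].
  - intros x; apply (ex_derive_continuous (V := R_NormedModule)); auto_derive; auto.
Qed.

Lemma cosine_integral_parts U f q :
  covers_quadrant U -> smooth U f -> Nat.Odd q ->
  cosine_integral f q = f (PI / 2) * sin (INR q * (PI / 2)) / INR q
                        - sine_integral (Derive f) q / INR q.
Proof.
  intros HU Hf Hq.
  assert (q0 : INR q <> 0) by (destruct Hq as [h ->]; apply not_0_INR; lia).
  unfold sine_integral, cosine_integral.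
  rewrite (integration_by_parts U f (fun x => / INR q * sin (INR q * x))); auto.
  - rewrite !Rmult_0_r, sin_0.
    replace (RInt (fun x => Derive f x * (/ INR q * sin (INR q * x))) 0 (PI / 2))
      with (/ INR q * RInt (fun x => Derive f x * sin (INR q * x)) 0 (PI / 2)).
    + field; auto.
    + rewrite <- (RInt_scal (V := R_CompleteNormedModule)).
      * apply RInt_ext; intros; unfold scal; simpl; unfold mult; simpl; ring.
      * apply ex_RInt_quadrant; intros x Hx.
        apply (continuous_mult (Derive f)).
        -- apply smooth_continuous with U; [now apply smooth_Derive|now apply HU].
        -- apply (ex_derive_continuous (V := R_NormedModule)); auto_derive; auto.
  - intros x; auto_derive; [easy|field; auto].
  - intros x; apply (ex_derive_continuous (V := R_NormedModule)); auto_derive; auto.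
Qed.

Lemma bounded_on_quadrant (f : R -> R) :
  (forall x, 0 <= x <= PI / 2 -> continuous f x) ->
  exists B, 0 <= B /\ forall x, 0 <= x <= PI / 2 -> Rabs (f x) <= B.
Proof.
  intros Cf; assert (HPI := PI_RGT_0).
  assert (K : exists Mx, forall c, 0 <= c <= PI / 2 ->
            (fun x => Rabs (f x)) c <= (fun x => Rabs (f x)) Mx /\ 0 <= Mx <= PI / 2).
  { destruct (continuity_ab_maj (fun x => Rabs (f x)) 0 (PI / 2)) as [Mx [H1 H2]].
    - lra.
    - intros c Hc; apply continuity_pt_filterlim.
      apply (continuous_comp f Rabs); [auto|apply continuous_Rabs].
    - exists Mx; intros c Hc; split; auto. }
  destruct K as [Mx H]; exists (Rabs (f Mx)); split; [apply Rabs_pos|].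
  intros x Hx; now apply H.
Qed.

Lemma RInt_quadrant_bound f B :
  (forall x, 0 <= x <= PI / 2 -> continuous f x) ->
  (forall x, 0 <= x <= PI / 2 -> Rabs (f x) <= B) ->
  Rabs (RInt f 0 (PI / 2)) <= PI / 2 * B.
Proof.
  intros Cf Hf; assert (HPI := PI_RGT_0).
  replace (PI / 2 * B) with ((PI / 2 - 0) * B) by ring.
  apply (abs_RInt_le_const f); [lra|now apply ex_RInt_quadrant|auto].
Qed.

Lemma trig_integral_bounded U f :
  covers_quadrant U -> smooth U f ->
  exists B, 0 <= B /\ forall q, Rabs (sine_integral f q) <= B /\ Rabs (cosine_integral f q) <= B.
Proof.
  intros HU Hf.
  assert (Cf : forall x, 0 <= x <= PI / 2 -> continuous f x)
    by (intros; apply smooth_continuous with U; auto; now apply HU).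
  destruct (bounded_on_quadrant f Cf) as [B [B0 HB]].
  assert (HPI := PI_RGT_0).
  exists (PI / 2 * B); split; [nra|].
  intros q; split; apply RInt_quadrant_bound.
  1,3: intros x Hx; apply (continuous_mult f); [auto|];
       apply (ex_derive_continuous (V := R_NormedModule)); auto_derive; auto.
  all: intros x Hx; rewrite Rabs_mult; specialize (HB x Hx).
  - assert (Rabs (sin (INR q * x)) <= 1)
      by (apply Rabs_le; generalize (SIN_bound (INR q * x)); lra).
    generalize (Rabs_pos (f x)) (Rabs_pos (sin (INR q * x))); nra.
  - assert (Rabs (cos (INR q * x)) <= 1)
      by (apply Rabs_le; generalize (COS_bound (INR q * x)); lra).
    generalize (Rabs_pos (f x)) (Rabs_pos (cos (INR q * x))); nra.
Qed.

(** Two integrations by parts replace f by f'' at the cost of the boundary terms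
    f(0) / q and f'(pi/2) / q^2 (up to sign).  The first vanishes every time, the
    second for r rounds; in the next round f'(pi/2) may survive, which fixes the
    exponent 2r + 2. *)
Lemma sine_integral_decay U r f :
  covers_quadrant U -> smooth U f ->
  (forall l, (l <= r)%nat -> Derive_n f (2 * l) 0 = 0) ->
  (forall l, (l < r)%nat -> Derive_n f (2 * l + 1) (PI / 2) = 0) ->
  exists B, 0 <= B /\ forall q, Nat.Odd q ->
    Rabs (sine_integral f q) <= B / INR q ^ (2 * r + 2).
Proof.
  intros HU; revert f; induction r as [|r IH]; intros f Hf H0 Ha.
  - assert (Hf' := smooth_Derive _ _ Hf); assert (Hf'' := smooth_Derive _ _ Hf').
    destruct (trig_integral_bounded U _ HU Hf'') as [B [B0 HB]].
    exists (Rabs (Derive f (PI / 2)) + B); split; [generalize (Rabs_pos (Derive f (PI / 2))); lra|].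
    intros q Hq.
    assert (q0 : 0 < INR q) by (destruct Hq as [h ->]; apply lt_0_INR; lia).
    rewrite (sine_integral_parts U), (cosine_integral_parts U); auto.
    replace (f 0) with 0 by (symmetry; apply (H0 0%nat); lia).
    replace (0 / INR q + (Derive f (PI / 2) * sin (INR q * (PI / 2)) / INR q
             - sine_integral (Derive (Derive f)) q / INR q) / INR q)
      with ((Derive f (PI / 2) * sin (INR q * (PI / 2))
             - sine_integral (Derive (Derive f)) q) * / INR q ^ (2 * 0 + 2))
      by (simpl; field; lra).
    rewrite Rabs_mult; rewrite (Rdiv_def (_ + B)).
    rewrite (Rabs_right (/ _)); [|apply Rle_ge, Rlt_le, Rinv_0_lt_compat, pow_lt; lra].
    apply Rmult_le_compat_r; [apply Rlt_le, Rinv_0_lt_compat, pow_lt; lra|].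
    apply Rle_trans with (1 := Rabs_triang _ _); rewrite Rabs_Ropp, Rabs_mult.
    rewrite (proj2 (trig_quarter_turn q Hq)), Rmult_1_r.
    exact (Rplus_le_compat_l _ _ _ (proj1 (HB q))).
  - assert (Hf' := smooth_Derive _ _ Hf); assert (Hf'' := smooth_Derive _ _ Hf').
    destruct (IH _ Hf'') as [B [B0 HB]].
    { intros l Hl; rewrite <- !Derive_n_shift.
      replace (S (S (2 * l))) with (2 * S l)%nat by lia; apply H0; lia. }
    { intros l Hl; rewrite <- !Derive_n_shift.
      replace (S (S (2 * l + 1))) with (2 * S l + 1)%nat by lia; apply Ha; lia. }
    exists B; split; auto; intros q Hq.
    assert (q0 : 0 < INR q) by (destruct Hq as [h ->]; apply lt_0_INR; lia).
    rewrite (sine_integral_parts U), (cosine_integral_parts U); auto.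
    replace (f 0) with 0 by (symmetry; apply (H0 0%nat); lia).
    replace (Derive f (PI / 2)) with 0 by (symmetry; apply (Ha 0%nat); lia).
    replace (2 * S r + 2)%nat with (2 * r + 2 + 2)%nat by lia.
    replace (0 / INR q + (0 * sin (INR q * (PI / 2)) / INR q
             - sine_integral (Derive (Derive f)) q / INR q) / INR q)
      with (- (sine_integral (Derive (Derive f)) q * / INR q ^ 2)) by (simpl; field; lra).
    replace (B / INR q ^ (2 * r + 2 + 2)) with (B / INR q ^ (2 * r + 2) * / INR q ^ 2)
      by (rewrite (pow_add _ (2 * r + 2) 2); field; split; [lra|apply pow_nonzero; lra]).
    rewrite Rabs_Ropp, Rabs_mult.
    rewrite (Rabs_right (/ _)); [|apply Rle_ge, Rlt_le, Rinv_0_lt_compat, pow_lt; lra].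
    apply Rmult_le_compat_r; [apply Rlt_le, Rinv_0_lt_compat, pow_lt; lra|auto].
Qed.

(** One integration by parts reduces this to the sine integral of f', whose even
    derivatives at 0 and odd derivatives at pi/2 are the ones required to vanish. *)
Lemma cosine_integral_decay U r f :
  covers_quadrant U -> smooth U f ->
  (forall l, (l <= r)%nat -> Derive_n f (2 * l + 1) 0 = 0) ->
  (forall l, (l < r)%nat -> Derive_n f (2 * l) (PI / 2) = 0) ->
  exists B, 0 <= B /\ forall q, Nat.Odd q ->
    Rabs (cosine_integral f q) <= B / INR q ^ (2 * r + 1).
Proof.
  intros HU Hf H0 Ha.
  assert (Hf' := smooth_Derive _ _ Hf).
  destruct r as [|r].
  - destruct (trig_integral_bounded U _ HU Hf') as [B [B0 HB]].
    exists (Rabs (f (PI / 2)) + B); split; [generalize (Rabs_pos (f (PI / 2))); lra|].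
    intros q Hq.
    assert (q0 : 0 < INR q) by (destruct Hq as [h ->]; apply lt_0_INR; lia).
    rewrite (cosine_integral_parts U); auto.
    replace (f (PI / 2) * sin (INR q * (PI / 2)) / INR q - sine_integral (Derive f) q / INR q)
      with ((f (PI / 2) * sin (INR q * (PI / 2)) - sine_integral (Derive f) q) * / INR q ^ (2 * 0 + 1))
      by (simpl; field; lra).
    rewrite Rabs_mult; rewrite (Rdiv_def (_ + B)).
    rewrite (Rabs_right (/ _)); [|apply Rle_ge, Rlt_le, Rinv_0_lt_compat, pow_lt; lra].
    apply Rmult_le_compat_r; [apply Rlt_le, Rinv_0_lt_compat, pow_lt; lra|].
    apply Rle_trans with (1 := Rabs_triang _ _); rewrite Rabs_Ropp, Rabs_mult.
    rewrite (proj2 (trig_quarter_turn q Hq)), Rmult_1_r.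
    exact (Rplus_le_compat_l _ _ _ (proj1 (HB q))).
  - destruct (sine_integral_decay U r (Derive f)) as [B [B0 HB]]; auto.
    { intros l Hl; rewrite <- !Derive_n_shift.
      replace (S (2 * l)) with (2 * l + 1)%nat by lia; apply H0; lia. }
    { intros l Hl; rewrite <- !Derive_n_shift.
      replace (S (2 * l + 1)) with (2 * S l)%nat by lia; apply Ha; lia. }
    exists B; split; auto; intros q Hq.
    assert (q0 : 0 < INR q) by (destruct Hq as [h ->]; apply lt_0_INR; lia).
    rewrite (cosine_integral_parts U); auto.
    replace (f (PI / 2)) with 0 by (symmetry; apply (Ha 0%nat); lia).
    replace (2 * S r + 1)%nat with (2 * r + 2 + 1)%nat by lia.
    replace (0 * sin (INR q * (PI / 2)) / INR q - sine_integral (Derive f) q / INR q)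
      with (- (sine_integral (Derive f) q * / INR q ^ 1)) by (simpl; field; lra).
    replace (B / INR q ^ (2 * r + 2 + 1)) with (B / INR q ^ (2 * r + 2) * / INR q ^ 1)
      by (rewrite (pow_add _ (2 * r + 2) 1); field; split; [lra|apply pow_nonzero; lra]).
    rewrite Rabs_Ropp, Rabs_mult.
    rewrite (Rabs_right (/ _)); [|apply Rle_ge, Rlt_le, Rinv_0_lt_compat, pow_lt; lra].
    apply Rmult_le_compat_r; [apply Rlt_le, Rinv_0_lt_compat, pow_lt; lra|auto].
Qed.

(** * The Gamma function at half-integers *)

(** [EulerGamma] is a total function; its functional equation can only be proved
    together with convergence of the integral. *)
Definition is_EulerGamma (s l : R) : Prop :=
  is_RInt_gen (fun t => Rpower t (s - 1) * exp (- t))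
              (at_right 0) (Rbar_locally p_infty) l.

Lemma is_EulerGamma_unique s l : is_EulerGamma s l -> EulerGamma s = l.
Proof. intros H; now apply is_RInt_gen_unique. Qed.

Lemma at_right_0_pos : at_right 0 (fun t => 0 < t).
Proof. exists (mkposreal 1 Rlt_0_1); intros t _ Ht; exact Ht. Qed.

Lemma p_infty_pos : Rbar_locally p_infty (fun t => 0 < t).
Proof. exists 0; auto. Qed.

Lemma positive_intervals (P : R -> Prop) :
  (forall x, 0 < x -> P x) ->
  filter_prod (at_right 0) (Rbar_locally p_infty)
    (fun ab : R * R => forall x, Rmin (fst ab) (snd ab) <= x <= Rmax (fst ab) (snd ab) -> P x).
Proof.
  intros H; apply Filter_prod with (1 := at_right_0_pos) (2 := p_infty_pos).
  intros a b Ha Hb x [Hx _]; apply H; simpl in Hx.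
  apply Rlt_le_trans with (2 := Hx); now apply Rmin_glb_lt.
Qed.

Lemma filterlim_exp_m_infty (F : (R -> Prop) -> Prop) {FF : Filter F} (g : R -> R) :
  filterlim g F (Rbar_locally m_infty) -> filterlim (fun t => exp (g t)) F (locally 0).
Proof.
  intros H; apply filterlim_comp with (1 := H).
  apply (is_lim_exp_m).
Qed.

Lemma EulerGamma_boundary_term s :
  0 < s ->
  filterlim (fun t => Rpower t s * exp (- t)) (at_right 0) (locally 0) /\
  filterlim (fun t => Rpower t s * exp (- t)) (Rbar_locally p_infty) (locally 0).
Proof.
  intros Hs.
  assert (E : forall F : (R -> Prop) -> Prop, Filter F ->
            filterlim (fun t => s * ln t + - t) F (Rbar_locally m_infty) ->
            filterlim (fun t => Rpower t s * exp (- t)) F (locally 0)).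
  { intros F FF H; apply filterlim_ext with (fun t => exp (s * ln t + - t)).
    - intros t; unfold Rpower; now rewrite exp_plus.
    - now apply filterlim_exp_m_infty. }
  split; apply E; try apply _.
  - intros P [M HM].
    assert (L := is_lim_ln_0).
    assert (L1 : Rbar_locally m_infty (fun y => y < M / s)) by (exists (M / s); auto).
    generalize (filter_and _ _ at_right_0_pos (L _ L1)).
    unfold filtermap; apply filter_imp; intros t [H1 H2]; apply HM.
    assert (s * ln t < M); [|lra].
    replace M with (s * (M / s)) by (field; lra); now apply Rmult_lt_compat_l.
  - intros P [M HM].
    set (c := ln (2 * s)).
    exists (Rmax 0 (2 * (s * c - M))); intros t Ht.
    assert (Ht0 : 0 < t) by (apply Rle_lt_trans with (2 := Ht), Rmax_l).
    assert (Ht1 : 2 * (s * c - M) < t) by (apply Rle_lt_trans with (2 := Ht), Rmax_r).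
    apply HM.
    (* ln u <= u - 1 at u = t / (2 s), so that half of the exponential decay survives. *)
    assert (Hl : ln t <= t / (2 * s) - 1 + c).
    { replace t with (t / (2 * s) * (2 * s)) at 1 by (field; lra).
      assert (0 < t / (2 * s)) by (apply Rdiv_lt_0_compat; lra).
      rewrite ln_mult; [|lra|lra]; unfold c.
      apply Rplus_le_compat_r.
      generalize (exp_ineq1_le (ln (t / (2 * s)))); rewrite exp_ln; lra. }
    assert (s * ln t <= t / 2 - s + s * c).
    { replace (t / 2 - s + s * c) with (s * (t / (2 * s) - 1 + c)) by (field; lra).
      apply Rmult_le_compat_l; lra. }
    lra.
Qed.

(** The derivative of t^s exp(-t) integrates to 0, which relates the integrals for s
    and s + 1. *)
Lemma is_EulerGamma_succ s l :
  0 < s -> is_EulerGamma s l -> is_EulerGamma (s + 1) (s * l).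
Proof.
  intros Hs H.
  set (B := fun t => Rpower t s * exp (- t)).
  assert (D : forall t, 0 < t -> is_derive B t
               (s * (Rpower t (s - 1) * exp (- t)) - Rpower t (s + 1 - 1) * exp (- t))).
  { intros t Ht; unfold B.
    replace (s + 1 - 1) with s by ring.
    replace (Rpower t (s - 1)) with (Rpower t s / t).
    - unfold Rpower; auto_derive; [lra|field; lra].
    - unfold Rminus; rewrite Rpower_plus, Rpower_Ropp, Rpower_1; auto. }
  assert (L : forall t, 0 < t -> locally t (fun u => 0 < u)).
  { intros t Ht; now apply (open_gt 0). }
  assert (Cp : forall t u, 0 < t -> continuous (fun t => Rpower t u * exp (- t)) t).
  { intros t u Ht; unfold Rpower.
    apply (ex_derive_continuous (V := R_NormedModule)); auto_derive; easy. }
  destruct (EulerGamma_boundary_term s Hs) as [B0 Binf].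
  assert (G : is_RInt_gen (Derive B) (at_right 0) (Rbar_locally p_infty) (0 - 0)).
  { apply is_RInt_gen_Derive; auto.
    - apply positive_intervals; intros t Ht; eexists; now apply D.
    - apply positive_intervals; intros t Ht.
      apply continuous_ext_loc with (fun t =>
        s * (Rpower t (s - 1) * exp (- t)) - Rpower t (s + 1 - 1) * exp (- t)).
      + apply filter_imp with (2 := L t Ht); intros u Hu; symmetry; now apply is_derive_unique, D.
      + apply (continuous_minus (fun t => s * (Rpower t (s - 1) * exp (- t)))); auto.
        apply (continuous_mult (fun _ => s)); auto; apply continuous_const. }
  assert (G2 : is_RInt_gen
            (fun t => minus (scal s (Rpower t (s - 1) * exp (- t))) (Derive B t))
            (at_right 0) (Rbar_locally p_infty) (minus (scal s l) (0 - 0)))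
    by exact (is_RInt_gen_minus (V := R_NormedModule)
               (fun t => scal s (Rpower t (s - 1) * exp (- t))) (Derive B) (scal s l) (0 - 0)
               (is_RInt_gen_scal (V := R_NormedModule)
                 (fun t => Rpower t (s - 1) * exp (- t)) s l H) G).
  assert (E : minus (scal s l) (0 - 0) = s * l)
    by (change (s * l + - (0 - 0) = s * l); ring).
  rewrite E in G2.
  revert G2; apply is_RInt_gen_ext.
  apply Filter_prod with (1 := at_right_0_pos) (2 := p_infty_pos).
  intros a b Ha Hb x [Hx _]; simpl in Hx.
  assert (0 < x) by (apply Rlt_trans with (2 := Hx); now apply Rmin_glb_lt).
  rewrite (is_derive_unique _ _ _ (D x H0)).
  unfold minus, plus, opp, scal; simpl; unfold mult; simpl; ring.
Qed.

(** At 3/2 the integrand is sqrt t exp(-t), continuous on the whole line, so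
    only the end +oo is improper; there the primitive is increasing and bounded by
    that of (1 + t) exp(-t). *)
Lemma is_EulerGamma_three_halves : exists l, 0 < l /\ is_EulerGamma (3 / 2) l.
Proof.
  set (g := fun t => sqrt t * exp (- t)).
  assert (Cg : forall t, continuous g t).
  { intros t; apply (continuous_mult sqrt (fun t => exp (- t))).
    - apply continuous_sqrt.
    - apply (ex_derive_continuous (V := R_NormedModule)); auto_derive; auto. }
  assert (Ig : forall a b, ex_RInt g a b)
    by (intros; apply (ex_RInt_continuous (V := R_CompleteNormedModule)); auto).
  set (phi := fun x => RInt g 0 x).
  assert (D : forall x, is_derive phi x (g x)).
  { intros x; apply (is_derive_RInt (V := R_CompleteNormedModule) g phi 0 x); auto.
    apply filter_forall; intros y; apply RInt_correct, Ig. }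
  assert (Gpos : forall t, 0 <= t -> 0 <= g t).
  { intros t Ht; apply Rmult_le_pos; [apply sqrt_pos|apply Rlt_le, exp_pos]. }
  assert (Inc : forall x y, 0 <= x <= y -> phi x <= phi y).
  { intros x y Hxy; unfold phi.
    rewrite <- (RInt_Chasles (V := R_CompleteNormedModule) g 0 x y); auto.
    assert (0 <= RInt g x y) by (apply RInt_ge_0; try lra; auto; intros; apply Gpos; lra).
    unfold plus; simpl; lra. }
  assert (Bd : forall x, 0 <= x -> phi x <= 2).
  { intros x Hx.
    assert (Hm : is_RInt (fun t => (1 + t) * exp (- t)) 0 x
               (- (2 + x) * exp (- x) - (- (2 + 0) * exp (- 0)))).
    { apply (is_RInt_derive (V := R_CompleteNormedModule) (fun t => - (2 + t) * exp (- t))).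
      - intros t _; auto_derive; [easy|ring].
      - intros t _; apply (ex_derive_continuous (V := R_NormedModule)); auto_derive; auto. }
    apply Rle_trans with (RInt (fun t => (1 + t) * exp (- t)) 0 x).
    - apply RInt_le; auto; [eexists; apply Hm|].
      intros t Ht; apply Rmult_le_compat_r; [apply Rlt_le, exp_pos|].
      assert (H1 := sqrt_sqrt t ltac:(lra)); assert (H2 := sqrt_pos t); nra.
    - rewrite (is_RInt_unique _ _ _ _ Hm), Ropp_0, exp_0.
      generalize (exp_pos (- x)); nra. }
  destruct (completeness (fun y => exists x, 0 <= x /\ y = phi x)) as [l [Ul Ll]].
  { exists 2; intros y [x [Hx ->]]; auto. }
  { exists (phi 0), 0; split; [lra|easy]. }
  exists l; split.
  - apply Rlt_le_trans with (phi 1).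
    + apply RInt_gt_0; [lra| |auto].
      intros t Ht; apply Rmult_lt_0_compat; [apply sqrt_lt_R0; lra|apply exp_pos].
    + apply Ul; exists 1; split; [lra|easy].
  - unfold is_EulerGamma.
    assert (E : forall x, Derive phi x = g x) by (intros; now apply is_derive_unique).
    assert (G : is_RInt_gen (Derive phi) (at_right 0) (Rbar_locally p_infty) (l - 0)).
    { apply is_RInt_gen_Derive.
      - apply positive_intervals; intros t _; eexists; apply D.
      - apply positive_intervals; intros t _.
        apply continuous_ext with g; auto.
      - replace 0 with (phi 0) at 2 by (unfold phi; now rewrite RInt_point).
        apply (filterlim_filter_le_1 (F := locally 0) (G := at_right 0) phi
          (filter_le_within (F := locally 0) (fun u => 0 < u))).
        apply (ex_derive_continuous (V := R_NormedModule)); eexists; apply D.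
      - apply filterlim_locally; intros eps.
        assert (Hx : exists x, 0 <= x /\ l - eps < phi x).
        { apply Classical_Prop.NNPP; intros Hn.
          assert (l <= l - eps); [|destruct eps; simpl in *; lra].
          apply Ll; intros y [x [Hx ->]].
          apply Rnot_lt_le; intros Hlt; apply Hn; now exists x. }
        destruct Hx as [x0 [Hx0 Hlt]].
        exists x0; intros x Hx; unfold ball; simpl; unfold AbsRing_ball, abs, minus, plus, opp; simpl.
        assert (phi x0 <= phi x) by (apply Inc; lra).
        assert (phi x <= l) by (apply Ul; exists x; split; [lra|easy]).
        apply Rabs_def1; destruct eps; simpl in *; lra. }
    rewrite Rminus_0_r in G; revert G; apply is_RInt_gen_ext.
    apply Filter_prod with (1 := at_right_0_pos) (2 := p_infty_pos).
    intros a b Ha Hb x [Hx _]; simpl in Hx.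
    assert (0 < x) by (apply Rlt_trans with (2 := Hx); now apply Rmin_glb_lt).
    rewrite E; unfold g; replace (3 / 2 - 1) with (/ 2) by field.
    now rewrite Rpower_sqrt.
Qed.

Lemma EulerGamma_three_halves_pos : 0 < EulerGamma (3 / 2).
Proof.
  destruct is_EulerGamma_three_halves as [l [Hl H]].
  now rewrite (is_EulerGamma_unique _ _ H).
Qed.

Lemma EulerGamma_half_integer i :
  exists l, is_EulerGamma (INR i + 3 / 2) l.
Proof.
  induction i as [|i [l IH]].
  - destruct is_EulerGamma_three_halves as [l [_ H]]; exists l.
    simpl; now rewrite Rplus_0_l.
  - exists ((INR i + 3 / 2) * l).
    replace (INR (S i) + 3 / 2) with (INR i + 3 / 2 + 1) by (rewrite S_INR; ring).
    apply is_EulerGamma_succ; auto.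
    generalize (pos_INR i); lra.
Qed.

Lemma EulerGamma_half_integer_succ i :
  EulerGamma (INR (S i) + 3 / 2) = (INR i + 3 / 2) * EulerGamma (INR i + 3 / 2).
Proof.
  destruct (EulerGamma_half_integer i) as [l H].
  rewrite (is_EulerGamma_unique _ _ H); apply is_EulerGamma_unique.
  replace (INR (S i) + 3 / 2) with (INR i + 3 / 2 + 1) by (rewrite S_INR; ring).
  apply is_EulerGamma_succ; auto.
  generalize (pos_INR i); lra.
Qed.

(** * Closed form of the Jacobi polynomials *)

Lemma gbinom_succ_succ a k :
  gbinom (a + 1) (S k) = gbinom a k * (a + 1) / INR (S k).
Proof.
  induction k as [|k IH].
  - simpl; field.
  - change (gbinom (a + 1) (S (S k)))
      with (gbinom (a + 1) (S k) * (a + 1 - INR (S k)) / INR (S (S k))).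
    rewrite IH.
    change (gbinom a (S k)) with (gbinom a k * (a - INR k) / INR (S k)).
    rewrite (S_INR (S k)), (S_INR k); generalize (pos_INR k); intros; field; lra.
Qed.

Lemma gbinom_Pascal a k :
  gbinom (a + 1) (S k) = gbinom a (S k) + gbinom a k.
Proof.
  rewrite gbinom_succ_succ.
  change (gbinom a (S k)) with (gbinom a k * (a - INR k) / INR (S k)).
  rewrite S_INR; generalize (pos_INR k); intros; field; lra.
Qed.

Lemma gbinom_nat_gt n k : (n < k)%nat -> gbinom (INR n) k = 0.
Proof.
  induction k as [|k IH]; intros H; [lia|].
  simpl gbinom; destruct (Nat.eq_dec n k) as [->|Hn].
  - unfold Rdiv; ring.
  - rewrite IH by lia; unfold Rdiv; ring.
Qed.

(** The number of terms K is left free: beyond n / 2 the binomials vanish, and the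
    freedom makes the recurrence in n immediate. *)
Definition cos_expansion (n K : nat) (x : R) : R :=
  sum_f_R0 (fun s => (-1) ^ s * gbinom (INR n) (2 * s)
                     * sin x ^ (2 * s) * cos x ^ (n - 2 * s)) K.

Definition sin_expansion (n K : nat) (x : R) : R :=
  sum_f_R0 (fun s => (-1) ^ s * gbinom (INR n) (2 * s + 1)
                     * sin x ^ (2 * s + 1) * cos x ^ (n - (2 * s + 1))) K.

(** Needed because the exponents are truncated subtractions: where they would
    become negative, the binomial is zero. *)
Lemma gbinom_pow_cos n k c :
  gbinom (INR n) k * c ^ (S n - k) = gbinom (INR n) k * c ^ (n - k) * c.
Proof.
  destruct (Nat.lt_ge_cases n k) as [H|H].
  - rewrite gbinom_nat_gt; auto; ring.
  - replace (S n - k)%nat with (S (n - k)) by lia; simpl; ring.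
Qed.

Lemma sin_expansion_succ n K x :
  sin_expansion (S n) K x = cos x * sin_expansion n K x + sin x * cos_expansion n K x.
Proof.
  assert (T : forall s, (-1) ^ s * gbinom (INR (S n)) (2 * s + 1)
                     * sin x ^ (2 * s + 1) * cos x ^ (S n - (2 * s + 1))
     = cos x * ((-1) ^ s * gbinom (INR n) (2 * s + 1)
                     * sin x ^ (2 * s + 1) * cos x ^ (n - (2 * s + 1)))
     + sin x * ((-1) ^ s * gbinom (INR n) (2 * s)
                     * sin x ^ (2 * s) * cos x ^ (n - 2 * s))).
  { intros s.
    assert (E := gbinom_pow_cos n (2 * s + 1) (cos x)).
    rewrite S_INR.
    replace (gbinom (INR n + 1) (2 * s + 1))
      with (gbinom (INR n) (2 * s + 1) + gbinom (INR n) (2 * s))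
      by (rewrite (Nat.add_1_r (2 * s)), gbinom_Pascal; ring).
    transitivity ((-1) ^ s * sin x ^ (2 * s + 1)
      * (gbinom (INR n) (2 * s + 1) * cos x ^ (S n - (2 * s + 1)))
      + (-1) ^ s * sin x ^ (2 * s + 1) * gbinom (INR n) (2 * s) * cos x ^ (S n - (2 * s + 1)));
      [ring|].
    rewrite E; replace (S n - (2 * s + 1))%nat with (n - 2 * s)%nat by lia.
    rewrite (Nat.add_1_r (2 * s)); simpl; ring. }
  unfold sin_expansion, cos_expansion.
  induction K as [|K IH]; [exact (T 0%nat)|].
  rewrite !tech5, IH, T; ring.
Qed.

Lemma cos_expansion_succ n K x :
  cos_expansion (S n) (S K) x = cos x * cos_expansion n (S K) x - sin x * sin_expansion n K x.
Proof.
  assert (T : forall s, (-1) ^ S s * gbinom (INR (S n)) (2 * S s)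
                     * sin x ^ (2 * S s) * cos x ^ (S n - 2 * S s)
     = cos x * ((-1) ^ S s * gbinom (INR n) (2 * S s)
                     * sin x ^ (2 * S s) * cos x ^ (n - 2 * S s))
     - sin x * ((-1) ^ s * gbinom (INR n) (2 * s + 1)
                     * sin x ^ (2 * s + 1) * cos x ^ (n - (2 * s + 1)))).
  { intros s.
    replace (2 * S s)%nat with (S (2 * s + 1)) by lia.
    assert (E := gbinom_pow_cos n (S (2 * s + 1)) (cos x)).
    rewrite S_INR, gbinom_Pascal.
    transitivity ((-1) ^ S s * sin x ^ S (2 * s + 1)
      * (gbinom (INR n) (S (2 * s + 1)) * cos x ^ (S n - S (2 * s + 1)))
      + (-1) ^ S s * sin x ^ S (2 * s + 1) * gbinom (INR n) (2 * s + 1)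
        * cos x ^ (S n - S (2 * s + 1))); [ring|].
    rewrite E; change (S n - S (2 * s + 1))%nat with (n - (2 * s + 1))%nat.
    rewrite <- !tech_pow_Rmult; ring. }
  unfold sin_expansion, cos_expansion.
  induction K as [|K IH].
  - rewrite !tech5, (T 0%nat); cbn [sum_f_R0]; rewrite Nat.mul_0_r, !Nat.sub_0_r.
    rewrite <- (tech_pow_Rmult (cos x) n); cbn [gbinom].
    generalize (cos x ^ (n - 2 * 1)) (cos x ^ (n - (0 + 1))) (sin x ^ (2 * 1))
      (sin x ^ (0 + 1)); intros; ring.
  - rewrite (tech5 _ (S K)), IH, T.
    rewrite (tech5 (fun s => (-1) ^ s * gbinom (INR n) (2 * s) * _ * _) (S K)).
    rewrite (tech5 (fun s => (-1) ^ s * gbinom (INR n) (2 * s + 1) * _ * _) K); ring.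
Qed.

Lemma de_Moivre n x :
  (forall K, (n <= 2 * K)%nat -> cos (INR n * x) = cos_expansion n K x) /\
  (forall K, (n <= 2 * K + 1)%nat -> sin (INR n * x) = sin_expansion n K x).
Proof.
  induction n as [|n [IHc IHs]].
  - assert (Z : forall k, gbinom (INR 0) (S k) = 0) by (intros; apply gbinom_nat_gt; lia).
    simpl (INR 0 * x); rewrite Rmult_0_l, sin_0, cos_0.
    split; intros K _; unfold cos_expansion, sin_expansion; induction K as [|K IH].
    + simpl; ring.
    + rewrite tech5, <- IH; replace (2 * S K)%nat with (S (2 * K + 1)) by lia.
      rewrite Z; ring.
    + change (2 * 0 + 1)%nat with 1%nat; simpl sum_f_R0; field.
    + rewrite tech5, <- IH, (Nat.add_1_r (2 * S K)), Z; ring.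
  - assert (Ex : INR (S n) * x = INR n * x + x) by (rewrite S_INR; ring).
    rewrite Ex, cos_plus, sin_plus; split; intros K HK.
    + destruct K as [|K]; [lia|].
      rewrite cos_expansion_succ, <- IHc, <- IHs by lia; ring.
    + rewrite sin_expansion_succ, <- IHc, <- IHs by lia; ring.
Qed.

Lemma omega_INR i : omega i = INR (2 * i + 3).
Proof. unfold omega; rewrite plus_INR, mult_INR; simpl; ring. Qed.

(** Both sides are hypergeometric in s: going from s to s + 1 multiplies each of
    them by (i + 3/2 - s)(i - s) / ((s + 1)(s + 3/2)), so it is enough to compare
    them at s = 0. *)
Lemma Jacobi_coefficient i s :
  (s <= i)%nat ->
  (omega i * gbinom (omega i) (2 * s + 1) - gbinom (omega i) (2 * s))
    * gbinom (INR i + 1 / 2) i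
  = 4 * (INR i + 1) * (INR i + 2)
    * (gbinom (INR i + 1 / 2) (i - s) * gbinom (INR i + 3 / 2) s).
Proof.
  assert (L : forall s, omega i * gbinom (omega i) (2 * s + 1) - gbinom (omega i) (2 * s)
     = gbinom (omega i) (2 * s) * (omega i + 1) * (omega i - 1 - 2 * INR s) / (2 * INR s + 1)).
  { clear s; intros s; rewrite Nat.add_1_r.
    change (gbinom (omega i) (S (2 * s)))
      with (gbinom (omega i) (2 * s) * (omega i - INR (2 * s)) / INR (S (2 * s))).
    rewrite S_INR, mult_INR; simpl (INR 2).
    generalize (pos_INR s); intros; field; lra. }
  induction s as [|s IH]; intros Hs.
  - rewrite L, Nat.sub_0_r; simpl (2 * 0)%nat; simpl gbinom at 1; simpl (gbinom _ 0).
    unfold omega; simpl (INR 0); field.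
  - assert (E1 : gbinom (omega i) (2 * S s)
        = gbinom (omega i) (2 * s) * (omega i - 2 * INR s) / (2 * INR s + 1)
          * (omega i - (2 * INR s + 1)) / (2 * INR s + 2)).
    { replace (2 * S s)%nat with (S (S (2 * s))) by lia.
      change (gbinom (omega i) (S (S (2 * s))))
        with (gbinom (omega i) (2 * s) * (omega i - INR (2 * s)) / INR (S (2 * s))
              * (omega i - INR (S (2 * s))) / INR (S (S (2 * s)))).
      rewrite !S_INR, mult_INR; simpl (INR 2).
      generalize (pos_INR s); intros; field; lra. }
    assert (E2 : gbinom (INR i + 1 / 2) (i - s)
        = gbinom (INR i + 1 / 2) (i - S s) * (INR s + 3 / 2) / (INR i - INR s)).
    { replace (i - s)%nat with (S (i - S s)) by lia.
      change (gbinom (INR i + 1 / 2) (S (i - S s)))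
        with (gbinom (INR i + 1 / 2) (i - S s) * (INR i + 1 / 2 - INR (i - S s))
              / INR (S (i - S s))).
      rewrite S_INR, minus_INR, S_INR by lia.
      assert (INR s + 1 <= INR i) by (rewrite <- S_INR; apply le_INR; lia).
      field; lra. }
    assert (E3 : gbinom (INR i + 3 / 2) (S s)
        = gbinom (INR i + 3 / 2) s * (INR i + 3 / 2 - INR s) / (INR s + 1)).
    { rewrite <- S_INR; reflexivity. }
    assert (Hi : INR s + 1 <= INR i) by (rewrite <- S_INR; apply le_INR; lia).
    assert (H0 := pos_INR s).
    rewrite L in IH; rewrite L, E1, E3, S_INR.
    specialize (IH ltac:(lia)); rewrite E2 in IH.
    unfold omega in *.
    set (A := gbinom (3 + 2 * INR i) (2 * s)) in *.
    set (B := gbinom (INR i + 1 / 2) i) in *.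
    set (D := gbinom (INR i + 1 / 2) (i - S s)) in *.
    set (F := gbinom (INR i + 3 / 2) s) in *.
    transitivity ((A * (3 + 2 * INR i + 1) * (3 + 2 * INR i - 1 - 2 * INR s) / (2 * INR s + 1) * B)
      * ((3 + 2 * INR i - 2 * INR s) * (3 + 2 * INR i - 2 * INR s - 3)
         / ((2 * INR s + 2) * (2 * INR s + 3)))).
    { field; lra. }
    rewrite IH; field; lra.
Qed.

(** After expansion, the left-hand side is a sum over s <= i + 2 of multiples of
    sin^(2s+1) cos^(2i+3-2s) whose last two coefficients vanish; the others are
    those of the Jacobi polynomial. *)
Lemma Jacobi_trigonometric i x :
  gbinom (INR i + 1 / 2) i
    * (omega i * sin (omega i * x) * cos x - cos (omega i * x) * sin x)
  = 4 * (INR i + 1) * (INR i + 2)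
    * (sin x * cos x ^ 3 * Jacobi (1 / 2) (3 / 2) i (cos (2 * x))).
Proof.
  rewrite omega_INR at 2 3.
  rewrite (proj2 (de_Moivre (2 * i + 3) x) (i + 2)%nat) by lia.
  rewrite (proj1 (de_Moivre (2 * i + 3) x) (i + 2)%nat) by lia.
  unfold cos_expansion, sin_expansion; rewrite <- !omega_INR.
  set (n := (2 * i + 3)%nat).
  set (a := fun s => (-1) ^ s * (omega i * gbinom (omega i) (2 * s + 1) - gbinom (omega i) (2 * s))
                     * sin x ^ (2 * s + 1) * cos x ^ (n - 2 * s)).
  assert (S1 : forall K,
     omega i * sum_f_R0 (fun s => (-1) ^ s * gbinom (omega i) (2 * s + 1)
                     * sin x ^ (2 * s + 1) * cos x ^ (n - (2 * s + 1))) K * cos x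
     - sum_f_R0 (fun s => (-1) ^ s * gbinom (omega i) (2 * s)
                     * sin x ^ (2 * s) * cos x ^ (n - 2 * s)) K * sin x
     = sum_f_R0 a K).
  { assert (T : forall s,
        omega i * ((-1) ^ s * gbinom (omega i) (2 * s + 1)
                     * sin x ^ (2 * s + 1) * cos x ^ (n - (2 * s + 1))) * cos x
        - (-1) ^ s * gbinom (omega i) (2 * s)
                     * sin x ^ (2 * s) * cos x ^ (n - 2 * s) * sin x = a s).
    { intros s; unfold a.
      assert (E := gbinom_pow_cos n (2 * s + 1) (cos x)).
      unfold n in E at 1 3; rewrite <- omega_INR in E.
      replace (S n - (2 * s + 1))%nat with (n - 2 * s)%nat in E by lia.
      transitivity (omega i * (-1) ^ s * sin x ^ (2 * s + 1)
         * (gbinom (omega i) (2 * s + 1) * cos x ^ (n - (2 * s + 1)) * cos x)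
         - (-1) ^ s * gbinom (omega i) (2 * s) * sin x ^ (2 * s + 1) * cos x ^ (n - 2 * s)).
      - rewrite (Nat.add_1_r (2 * s)), <- !tech_pow_Rmult; ring.
      - rewrite <- E; ring. }
    induction K as [|K IH]; [exact (T 0%nat)|].
    rewrite !tech5, <- IH, <- T; ring. }
  rewrite S1.
  replace (i + 2)%nat with (S (S i)) by lia; rewrite !tech5.
  (* The binomials are binom(n, n) and binom(n, n - 1), and n = omega i. *)
  assert (Z1 : a (S i) = 0).
  { unfold a; rewrite (Nat.add_1_r (2 * S i)).
    change (gbinom (omega i) (S (2 * S i)))
      with (gbinom (omega i) (2 * S i) * (omega i - INR (2 * S i)) / INR (S (2 * S i))).
    rewrite S_INR, mult_INR, !S_INR; unfold omega; simpl (INR 1); simpl (INR 0).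
    generalize (pos_INR i); intros; field; lra. }
  assert (Z2 : a (S (S i)) = 0).
  { unfold a; rewrite omega_INR, !gbinom_nat_gt by lia; ring. }
  rewrite Z1, Z2, !Rplus_0_r; unfold Jacobi.
  rewrite !scal_sum; apply sum_eq; intros s Hs.
  assert (E := Jacobi_coefficient i s Hs).
  replace ((cos (2 * x) - 1) / 2) with (- (sin x ^ 2)) by (rewrite cos_2a_sin; field).
  replace ((cos (2 * x) + 1) / 2) with (cos x ^ 2) by (rewrite cos_2a_cos; field).
  replace (- sin x ^ 2) with (-1 * sin x ^ 2) by ring.
  rewrite Rpow_mult_distr, <- !pow_mult.
  unfold a; transitivity ((-1) ^ s * sin x ^ (2 * s + 1) * cos x ^ (n - 2 * s)
    * ((omega i * gbinom (omega i) (2 * s + 1) - gbinom (omega i) (2 * s))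
       * gbinom (INR i + 1 / 2) i)); [ring|].
  rewrite E; replace (n - 2 * s)%nat with (3 + 2 * (i - s))%nat by (unfold n; lia).
  rewrite (Nat.add_1_r (2 * s)), (pow_add _ 3), <- tech_pow_Rmult; ring.
Qed.

(** * The modes as trigonometric polynomials *)

Definition kappa (i : nat) : R :=
  / (2 * EulerGamma (3 / 2) * sqrt ((INR i + 1) * (INR i + 2))).

Lemma kappa_pos i : 0 < kappa i.
Proof.
  generalize EulerGamma_three_halves_pos (pos_INR i); intros HG Hi.
  apply Rinv_0_lt_compat, Rmult_lt_0_compat; [lra|].
  apply sqrt_lt_R0; nra.
Qed.

Lemma omega_pos i : 3 <= omega i.
Proof. unfold omega; generalize (pos_INR i); lra. Qed.

Lemma kappa_omega_bound : exists C, 0 < C /\ forall i, kappa i * omega i <= C.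
Proof.
  generalize EulerGamma_three_halves_pos; intros HG.
  exists (3 * / (2 * EulerGamma (3 / 2))); split.
  { apply Rmult_lt_0_compat; [lra|apply Rinv_0_lt_compat; lra]. }
  intros i; unfold kappa.
  assert (Hi := pos_INR i).
  set (r := sqrt ((INR i + 1) * (INR i + 2))).
  assert (Hr : INR i + 1 <= r).
  { unfold r; rewrite <- (sqrt_Rsqr (INR i + 1)) at 1 by lra.
    apply sqrt_le_1_alt; unfold Rsqr; nra. }
  rewrite Rinv_mult, Rmult_assoc, (Rmult_comm 3).
  apply Rmult_le_compat_l; [apply Rlt_le, Rinv_0_lt_compat; lra|].
  apply Rmult_le_reg_l with r; [lra|].
  rewrite <- Rmult_assoc, Rinv_r by lra; unfold omega; lra.
Qed.

Lemma EulerGamma_gbinom i :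
  EulerGamma (INR i + 3 / 2)
  = EulerGamma (3 / 2) * INR (fact i) * gbinom (INR i + 1 / 2) i.
Proof.
  induction i as [|i IH].
  - simpl; rewrite Rplus_0_l; ring.
  - rewrite EulerGamma_half_integer_succ, IH, fact_simpl, mult_INR.
    replace (INR (S i) + 1 / 2) with (INR i + 1 / 2 + 1) by (rewrite S_INR; ring).
    rewrite gbinom_succ_succ, S_INR; generalize (pos_INR i); intros; field; lra.
Qed.

Lemma gbinom_half_pos i : 0 < gbinom (INR i + 1 / 2) i.
Proof.
  induction i as [|i IH]; [simpl; lra|].
  replace (INR (S i) + 1 / 2) with (INR i + 1 / 2 + 1) by (rewrite S_INR; ring).
  rewrite gbinom_succ_succ, S_INR; generalize (pos_INR i); intros.
  apply Rdiv_lt_0_compat; nra.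
Qed.

(** The factor Gamma(i + 3/2) in the normalization cancels against the value
    binom(i + 1/2, i) of the Jacobi polynomial at 1, leaving only Gamma(3/2). *)
Lemma e_closed_form i x :
  e i x * sin x
  = kappa i * (omega i * sin (omega i * x) * cos x - cos (omega i * x) * sin x).
Proof.
  assert (HG := EulerGamma_three_halves_pos); assert (Hi := pos_INR i).
  assert (Hg := gbinom_half_pos i); assert (Hf := INR_fact_lt_0 i).
  assert (J := Jacobi_trigonometric i x).
  assert (S : sqrt (INR (fact i) * INR (fact (i + 2)))
            = INR (fact i) * sqrt ((INR i + 1) * (INR i + 2))).
  { replace (i + 2)%nat with (S (S i)) by lia.
    rewrite !fact_simpl, !mult_INR, !S_INR.
    replace (INR (fact i) * ((INR i + 1 + 1) * ((INR i + 1) * INR (fact i))))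
      with (INR (fact i) * INR (fact i) * ((INR i + 1) * (INR i + 2))) by ring.
    rewrite sqrt_mult_alt, sqrt_square by nra; reflexivity. }
  unfold e, kappa; rewrite S, EulerGamma_gbinom.
  set (p := (INR i + 1) * (INR i + 2)) in *.
  assert (Hp : 0 < p) by (unfold p; nra).
  assert (Hr : 0 < sqrt p) by now apply sqrt_lt_R0.
  assert (Hrr : sqrt p * sqrt p = p) by (apply sqrt_sqrt; lra).
  set (X := omega i * sin (omega i * x) * cos x - cos (omega i * x) * sin x) in *.
  set (Y := Jacobi (1 / 2) (3 / 2) i (cos (2 * x))) in *.
  set (b := gbinom (INR i + 1 / 2) i) in *.
  replace X with (4 * (sqrt p * sqrt p) * (sin x * cos x ^ 3 * Y) / b)
    by (rewrite Hrr; apply Rmult_eq_reg_l with b; [|lra]; rewrite J; unfold p; field; lra).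
  field; repeat split; lra.
Qed.

(** The polynomials cos((2h+1)x) tan x and, below, sin((2h+1)x) cot x.  The
    recurrences come from cos(y+x) + cos(y-x) = 2 cos y cos x and
    sin(y+x) - sin(y-x) = 2 cos y sin x with y = (2h+2)x: the factor cos x or sin x
    cancels the denominator. *)
Fixpoint cos_tan (h : nat) (x : R) : R :=
  match h with
  | O => sin (INR 1 * x)
  | S h' => - cos_tan h' x + sin (INR (2 * h' + 3) * x) - sin (INR (2 * h' + 1) * x)
  end.

Fixpoint sin_cot (h : nat) (x : R) : R :=
  match h with
  | O => cos (INR 1 * x)
  | S h' => sin_cot h' x + cos (INR (2 * h' + 3) * x) + cos (INR (2 * h' + 1) * x)
  end.

Lemma cos_tan_spec h x : cos x * cos_tan h x = cos (INR (2 * h + 1) * x) * sin x.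
Proof.
  induction h as [|h IH].
  - simpl; rewrite Rmult_1_l; ring.
  - cbn [cos_tan]; rewrite Rmult_minus_distr_l, Rmult_plus_distr_l.
    rewrite Ropp_mult_distr_r_reverse, IH.
    set (y := INR (2 * h + 2) * x).
    replace (INR (2 * h + 1) * x) with (y - x)
      by (unfold y; rewrite !plus_INR; simpl; ring).
    replace (INR (2 * h + 3) * x) with (y + x)
      by (unfold y; rewrite !plus_INR; simpl; ring).
    replace (INR (2 * S h + 1) * x) with (y + x)
      by (replace (2 * S h + 1)%nat with (2 * h + 3)%nat by lia; unfold y; rewrite !plus_INR; simpl; ring).
    rewrite ?cos_plus, ?cos_minus, ?sin_plus, ?sin_minus; ring.
Qed.

Lemma sin_cot_spec h x : sin x * sin_cot h x = sin (INR (2 * h + 1) * x) * cos x.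
Proof.
  induction h as [|h IH].
  - simpl; rewrite Rmult_1_l; ring.
  - cbn [sin_cot]; rewrite !Rmult_plus_distr_l, IH.
    set (y := INR (2 * h + 2) * x).
    replace (INR (2 * h + 1) * x) with (y - x)
      by (unfold y; rewrite !plus_INR; simpl; ring).
    replace (INR (2 * h + 3) * x) with (y + x)
      by (unfold y; rewrite !plus_INR; simpl; ring).
    replace (INR (2 * S h + 1) * x) with (y + x)
      by (replace (2 * S h + 1)%nat with (2 * h + 3)%nat by lia; unfold y; rewrite !plus_INR; simpl; ring).
    rewrite ?cos_plus, ?cos_minus, ?sin_plus, ?sin_minus; ring.
Qed.

(** Combinations of phi(m x) with m odd, m <= w, and with coefficients of l1-norm at
    most the index B.  It serves for phi = sin and phi = cos. *)
Inductive odd_trig_poly (phi : R -> R) (w : nat) : R -> (R -> R) -> Prop :=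
  | odd_trig_poly_zero f : (forall x, f x = 0) -> odd_trig_poly phi w 0 f
  | odd_trig_poly_add B B' f g c m :
      odd_trig_poly phi w B f -> Nat.Odd m -> (m <= w)%nat ->
      (forall x, g x = f x + c * phi (INR m * x)) -> B + Rabs c <= B' ->
      odd_trig_poly phi w B' g.

Lemma odd_trig_poly_pos phi w B f : odd_trig_poly phi w B f -> 0 <= B.
Proof.
  induction 1; [lra|]; generalize (Rabs_pos c); lra.
Qed.

Lemma odd_trig_poly_le phi w w' B f :
  (w <= w')%nat -> odd_trig_poly phi w B f -> odd_trig_poly phi w' B f.
Proof.
  intros Hw; induction 1.
  - now apply odd_trig_poly_zero.
  - apply odd_trig_poly_add with B f c m; auto; lia.
Qed.

Lemma odd_trig_poly_scal phi w B f a :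
  odd_trig_poly phi w B f -> odd_trig_poly phi w (Rabs a * B) (fun x => a * f x).
Proof.
  induction 1.
  - rewrite Rmult_0_r; apply odd_trig_poly_zero; intros x; rewrite H; ring.
  - apply odd_trig_poly_add with (Rabs a * B) (fun x => a * f x) (a * c) m; auto.
    + intros x; rewrite H2; ring.
    + rewrite Rabs_mult, <- Rmult_plus_distr_l.
      apply Rmult_le_compat_l; auto; apply Rabs_pos.
Qed.

Lemma odd_trig_poly_bound phi w B f :
  (forall x, Rabs (phi x) <= 1) -> odd_trig_poly phi w B f -> forall x, Rabs (f x) <= B.
Proof.
  intros Hphi; induction 1; intros x.
  - rewrite H, Rabs_R0; lra.
  - rewrite H2; apply Rle_trans with (1 := Rabs_triang _ _); rewrite Rabs_mult.
    generalize (IHodd_trig_poly x) (Hphi (INR m * x)) (Rabs_pos c)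
      (Rabs_pos (phi (INR m * x))); nra.
Qed.

Lemma odd_trig_poly_continuous phi w B f :
  (forall x, continuous phi x) -> odd_trig_poly phi w B f -> forall x, continuous f x.
Proof.
  intros Hphi; induction 1; intros x.
  - apply continuous_ext with (fun _ => 0); [auto|apply continuous_const].
  - apply continuous_ext with (fun x => f x + c * phi (INR m * x)); [auto|].
    apply (continuous_plus f); auto.
    apply (continuous_mult (fun _ => c)); [apply continuous_const|].
    apply (continuous_comp (fun x => INR m * x) phi); auto.
    apply (continuous_mult (fun _ => INR m)); [apply continuous_const|apply continuous_id].
Qed.

Lemma abs_sin_le x : Rabs (sin x) <= 1.
Proof. apply Rabs_le; generalize (SIN_bound x); lra. Qed.

Lemma abs_cos_le x : Rabs (cos x) <= 1.
Proof. apply Rabs_le; generalize (COS_bound x); lra. Qed.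

Lemma Odd_omega i : Nat.Odd (2 * i + 3).
Proof. exists (S i); lia. Qed.

Lemma odd_trig_poly_cos_tan h :
  odd_trig_poly sin (2 * h + 1) (INR (2 * h + 1)) (cos_tan h).
Proof.
  induction h as [|h IH].
  - apply odd_trig_poly_add with 0 (fun _ => 0) 1 1%nat; auto.
    + now apply odd_trig_poly_zero.
    + now exists 0%nat.
    + intros x; simpl; ring.
    + rewrite Rabs_R1; simpl; lra.
  - replace (2 * S h + 1)%nat with (2 * h + 3)%nat by lia.
    apply odd_trig_poly_add with (INR (2 * h + 1) + 1)
      (fun x => - cos_tan h x + sin (INR (2 * h + 3) * x)) (-1) (2 * h + 1)%nat;
      [| now exists h | lia | intros x; simpl; ring |].
    + apply odd_trig_poly_add with (INR (2 * h + 1)) (fun x => -1 * cos_tan h x) 1 (2 * h + 3)%nat;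
        [| apply Odd_omega | lia | intros x; ring | rewrite Rabs_R1; lra].
      apply odd_trig_poly_le with (2 * h + 1)%nat; [lia|].
      replace (INR (2 * h + 1)) with (Rabs (-1) * INR (2 * h + 1))
        by (rewrite Rabs_m1; ring).
      now apply odd_trig_poly_scal.
    + rewrite Rabs_m1, !plus_INR; simpl; lra.
Qed.

Lemma odd_trig_poly_sin_cot h :
  odd_trig_poly cos (2 * h + 1) (INR (2 * h + 1)) (sin_cot h).
Proof.
  induction h as [|h IH].
  - apply odd_trig_poly_add with 0 (fun _ => 0) 1 1%nat; auto.
    + now apply odd_trig_poly_zero.
    + now exists 0%nat.
    + intros x; simpl; ring.
    + rewrite Rabs_R1; simpl; lra.
  - replace (2 * S h + 1)%nat with (2 * h + 3)%nat by lia.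
    apply odd_trig_poly_add with (INR (2 * h + 1) + 1)
      (fun x => sin_cot h x + cos (INR (2 * h + 3) * x)) 1 (2 * h + 1)%nat;
      [| now exists h | lia | intros x; simpl; ring |].
    + apply odd_trig_poly_add with (INR (2 * h + 1)) (sin_cot h) 1 (2 * h + 3)%nat;
        [| apply Odd_omega | lia | intros x; ring | rewrite Rabs_R1; lra].
      apply odd_trig_poly_le with (2 * h + 1)%nat; [lia|exact IH].
    + rewrite Rabs_R1, !plus_INR; simpl; lra.
Qed.

(** The function e_i tan, without its removable singularity at pi/2. *)
Definition e_tan (i : nat) (x : R) : R :=
  kappa i * (omega i * sin (omega i * x) - cos_tan (S i) x).

(** The function e_i' tan / omega_i, without its removable singularities. *)
Definition de_tan (i : nat) (x : R) : R :=
  kappa i * (omega i * cos (omega i * x) - sin_cot (S i) x).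

(** The function e_i as a cosine polynomial. *)
Definition e_poly (i : nat) (x : R) : R :=
  kappa i * (omega i * sin_cot (S i) x - cos (omega i * x)).

Lemma omega_S i : omega i = INR (2 * S i + 1).
Proof. rewrite omega_INR; f_equal; lia. Qed.

Lemma e_poly_spec i x : sin x <> 0 -> e i x = e_poly i x.
Proof.
  intros Hs; apply Rmult_eq_reg_r with (sin x); auto.
  rewrite e_closed_form; unfold e_poly.
  assert (E := sin_cot_spec (S i) x); rewrite <- omega_S in E.
  transitivity (kappa i * (omega i * (sin (omega i * x) * cos x) - cos (omega i * x) * sin x));
    [ring|rewrite <- E; ring].
Qed.

Lemma e_tan_spec i x : cos x <> 0 -> e i x * tan x = e_tan i x.
Proof.
  intros Hc; unfold tan, e_tan.
  assert (E := cos_tan_spec (S i) x); rewrite <- omega_S in E.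
  assert (F := e_closed_form i x); rewrite <- E in F.
  apply Rmult_eq_reg_r with (cos x); auto.
  transitivity (e i x * sin x); [field; auto|rewrite F; ring].
Qed.

Lemma de_tan_spec i x :
  cos x <> 0 -> sin x <> 0 -> Derive (e i) x * tan x = omega i * de_tan i x.
Proof.
  intros Hc Hs.
  assert (L : locally x (fun t => sin t <> 0)).
  { apply (open_comp sin (fun y => y <> 0)); [|apply open_neq|exact Hs].
    intros t _; apply continuous_sin. }
  assert (D : is_derive (e i) x
     (kappa i * (omega i * (omega i * cos (omega i * x)) * (cos x / sin x)
       + omega i * sin (omega i * x) * (- / sin x ^ 2) + omega i * sin (omega i * x)))).
  { apply is_derive_ext_loc with
      (fun t => kappa i * (omega i * sin (omega i * t) * (cos t / sin t) - cos (omega i * t))).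
    - apply filter_imp with (2 := L); intros t Ht.
      apply Rmult_eq_reg_r with (sin t); auto.
      rewrite e_closed_form; field; auto.
    - assert (P := sin2_cos2 x); unfold Rsqr in P.
      auto_derive; [auto|].
      assert (C : cos x * cos x = 1 - sin x * sin x) by lra.
      field_simplify_eq; auto.
      replace (cos x ^ 2) with (1 - sin x * sin x) by (rewrite <- C; ring).
      ring. }
  rewrite (is_derive_unique _ _ _ D); unfold tan, de_tan.
  assert (E := sin_cot_spec (S i) x); rewrite <- omega_S in E.
  apply Rmult_eq_reg_r with (sin x); auto.
  assert (P := sin2_cos2 x); unfold Rsqr in P.
  transitivity (kappa i * omega i * (omega i * cos (omega i * x) * sin x
     - sin (omega i * x) * (1 - sin x * sin x) / cos x)); [field; auto|].
  replace (1 - sin x * sin x) with (cos x * cos x) by lra.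
  transitivity (kappa i * omega i * (omega i * cos (omega i * x) * sin x
     - sin (omega i * x) * cos x)); [field; auto|].
  rewrite <- E; ring.
Qed.

(** The l1-norms are at most 2 omega_i kappa_i for the first two functions and
    about omega_i^2 kappa_i for the third. *)
Lemma odd_trig_poly_modes :
  exists C, 0 < C /\ forall i,
    odd_trig_poly sin (2 * i + 3) C (e_tan i) /\
    odd_trig_poly cos (2 * i + 3) C (de_tan i) /\
    odd_trig_poly cos (2 * i + 3) (C * omega i) (e_poly i).
Proof.
  destruct kappa_omega_bound as [C [C0 HC]].
  exists (2 * C); split; [lra|]; intros i.
  assert (Hk := kappa_pos i); assert (Ho := omega_pos i); specialize (HC i).
  assert (En : (2 * S i + 1 = 2 * i + 3)%nat) by lia.
  assert (Ak : forall s, s = 1 \/ s = -1 -> Rabs (s * kappa i) = kappa i).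
  { intros s [-> | ->]; rewrite Rabs_mult, (Rabs_right (kappa i)) by lra;
      rewrite ?Rabs_m1, ?Rabs_R1; ring. }
  assert (Ct := odd_trig_poly_cos_tan (S i)); assert (Sc := odd_trig_poly_sin_cot (S i)).
  rewrite <- omega_S, En in Ct, Sc.
  assert (Ko : Rabs (kappa i * omega i) = kappa i * omega i) by (apply Rabs_right; nra).
  repeat split.
  - apply odd_trig_poly_add with (kappa i * omega i) (fun x => (-1 * kappa i) * cos_tan (S i) x)
      (kappa i * omega i) (2 * i + 3)%nat; [|apply Odd_omega|lia| |lra].
    + rewrite <- (Ak (-1)) at 1 by auto; now apply odd_trig_poly_scal.
    + intros x; unfold e_tan; rewrite <- omega_INR; ring.
  - apply odd_trig_poly_add with (kappa i * omega i) (fun x => (-1 * kappa i) * sin_cot (S i) x)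
      (kappa i * omega i) (2 * i + 3)%nat; [|apply Odd_omega|lia| |lra].
    + rewrite <- (Ak (-1)) at 1 by auto; now apply odd_trig_poly_scal.
    + intros x; unfold de_tan; rewrite <- omega_INR; ring.
  - apply odd_trig_poly_add with (kappa i * omega i * omega i)
      (fun x => (kappa i * omega i) * sin_cot (S i) x)
      (-1 * kappa i) (2 * i + 3)%nat; [|apply Odd_omega|lia| |rewrite Ak by auto; nra].
    + rewrite <- Ko at 1; now apply odd_trig_poly_scal.
    + intros x; unfold e_poly; rewrite <- omega_INR; ring.
Qed.

(** * Integrals against three modes *)

Definition continuous_on_quadrant (f : R -> R) : Prop :=
  forall x, 0 <= x <= PI / 2 -> continuous f x.

Lemma continuous_on_quadrant_mult f g :
  continuous_on_quadrant f -> continuous_on_quadrant g ->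
  continuous_on_quadrant (fun x => f x * g x).
Proof. intros Hf Hg x Hx; apply (continuous_mult f g); auto. Qed.

Lemma continuous_on_quadrant_everywhere (f : R -> R) :
  (forall x, continuous f x) -> continuous_on_quadrant f.
Proof. intros Hf x _; auto. Qed.

Lemma continuous_sin_scaled u : forall x, continuous (fun x => sin (u * x)) x.
Proof.
  intros x; apply (ex_derive_continuous (V := R_NormedModule)); auto_derive; auto.
Qed.

Lemma continuous_cos_scaled u : forall x, continuous (fun x => cos (u * x)) x.
Proof.
  intros x; apply (ex_derive_continuous (V := R_NormedModule)); auto_derive; auto.
Qed.

Lemma RInt_quadrant_scal c (f : R -> R) :
  continuous_on_quadrant f ->
  RInt (fun x => c * f x) 0 (PI / 2) = c * RInt f 0 (PI / 2).
Proof.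
  intros Hf; apply (RInt_scal (V := R_CompleteNormedModule) f).
  now apply ex_RInt_quadrant.
Qed.

Lemma RInt_quadrant_plus (f g : R -> R) :
  continuous_on_quadrant f -> continuous_on_quadrant g ->
  RInt (fun x => f x + g x) 0 (PI / 2) = RInt f 0 (PI / 2) + RInt g 0 (PI / 2).
Proof.
  intros Hf Hg; apply (RInt_plus (V := R_CompleteNormedModule) f g);
    now apply ex_RInt_quadrant.
Qed.

Lemma RInt_quadrant_ext (f g : R -> R) :
  (forall x, 0 < x < PI / 2 -> f x = g x) ->
  RInt f 0 (PI / 2) = RInt g 0 (PI / 2).
Proof.
  intros H; apply RInt_ext; intros x.
  assert (HP := PI_RGT_0); rewrite Rmin_left, Rmax_right by lra; auto.
Qed.

(** Product-to-sum formulas write a product of three sines or cosines as a signed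
    average of four of them; only the largest of the four integrals matters. *)
Lemma RInt_average_of_four (h g1 g2 g3 g4 : R -> R) s1 s2 s3 s4 A :
  continuous_on_quadrant g1 -> continuous_on_quadrant g2 ->
  continuous_on_quadrant g3 -> continuous_on_quadrant g4 ->
  (forall x, h x = / 4 * (s1 * g1 x + s2 * g2 x + (s3 * g3 x + s4 * g4 x))) ->
  Rabs s1 <= 1 -> Rabs s2 <= 1 -> Rabs s3 <= 1 -> Rabs s4 <= 1 ->
  Rabs (RInt g1 0 (PI / 2)) <= A -> Rabs (RInt g2 0 (PI / 2)) <= A ->
  Rabs (RInt g3 0 (PI / 2)) <= A -> Rabs (RInt g4 0 (PI / 2)) <= A ->
  Rabs (RInt h 0 (PI / 2)) <= A.
Proof.
  intros C1 C2 C3 C4 Hh S1 S2 S3 S4 A1 A2 A3 A4.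
  assert (Cs : forall s g, continuous_on_quadrant g -> continuous_on_quadrant (fun x => s * g x)).
  { intros s g Hg; apply (continuous_on_quadrant_mult (fun _ => s)); auto.
    intros x _; apply continuous_const. }
  assert (Cp : forall f g, continuous_on_quadrant f -> continuous_on_quadrant g ->
            continuous_on_quadrant (fun x => f x + g x)).
  { intros f g Hf Hg x Hx; apply (continuous_plus f g); auto. }
  rewrite (RInt_quadrant_ext _ _ (fun x _ => Hh x)).
  rewrite RInt_quadrant_scal by auto.
  rewrite !RInt_quadrant_plus by auto.
  rewrite !RInt_quadrant_scal by auto.
  assert (B : forall s I, Rabs s <= 1 -> Rabs I <= A -> Rabs (s * I) <= A).
  { intros s I Hs HI; rewrite Rabs_mult; generalize (Rabs_pos s) (Rabs_pos I); nra. }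
  assert (B1 := B _ _ S1 A1); assert (B2 := B _ _ S2 A2).
  assert (B3 := B _ _ S3 A3); assert (B4 := B _ _ S4 A4).
  apply Rabs_le_between in B1, B2, B3, B4.
  apply Rabs_le; lra.
Qed.

Definition sine_integral_small (f : R -> R) (q0 : nat) (A : R) : Prop :=
  forall q, Nat.Odd q -> (q0 <= q)%nat -> Rabs (sine_integral f q) <= A.

Definition cosine_integral_small (f : R -> R) (q0 : nat) (A : R) : Prop :=
  forall q, Nat.Odd q -> (q0 <= q)%nat -> Rabs (cosine_integral f q) <= A.

Lemma Odd_combination n m l :
  Nat.Odd n -> Nat.Odd m -> Nat.Odd l -> (m + l <= n)%nat ->
  Nat.Odd (n + m + l) /\ Nat.Odd (n + m - l) /\ Nat.Odd (n - m + l) /\ Nat.Odd (n - m - l).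
Proof.
  intros [a ->] [b ->] [c ->] H; repeat split.
  - exists (a + b + c + 1)%nat; lia.
  - exists (a + b - c)%nat; lia.
  - exists (a - b + c)%nat; lia.
  - exists (a - b - c - 1)%nat; lia.
Qed.

Ltac four_frequencies n m l :=
  intros x;
  repeat first [rewrite plus_INR | rewrite minus_INR by lia];
  replace ((INR n + INR m + INR l) * x) with (INR n * x + INR m * x + INR l * x) by ring;
  replace ((INR n + INR m - INR l) * x) with (INR n * x + INR m * x - INR l * x) by ring;
  replace ((INR n - INR m + INR l) * x) with (INR n * x - INR m * x + INR l * x) by ring;
  replace ((INR n - INR m - INR l) * x) with (INR n * x - INR m * x - INR l * x) by ring;
  generalize (INR n * x) (INR m * x) (INR l * x); intros a b c;
  repeat first [rewrite sin_plus | rewrite sin_minus | rewrite cos_plus | rewrite cos_minus];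
  field.

Ltac side_conditions :=
  first [ apply continuous_on_quadrant_mult; [assumption|];
          intros ? _; apply (ex_derive_continuous (V := R_NormedModule)); auto_derive; auto
        | rewrite ?Rabs_m1, ?Rabs_R1; lra ].

(** In this and the three following bounds, all four frequencies n + m + l,
    n + m - l, n - m + l, n - m - l are odd and at least q0, so every integral that
    appears belongs to the range controlled by the hypothesis. *)
Lemma triple_sin_sin_sin f q0 A n m l :
  continuous_on_quadrant f -> sine_integral_small f q0 A ->
  Nat.Odd n -> Nat.Odd m -> Nat.Odd l -> (m + l + q0 <= n)%nat ->
  Rabs (RInt (fun x => f x * sin (INR n * x) * sin (INR m * x) * sin (INR l * x))
          0 (PI / 2)) <= A.
Proof.
  intros Cf HA Hn Hm Hl Hnml.
  destruct (Odd_combination n m l) as [O1 [O2 [O3 O4]]]; auto; [lia|].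
  apply (RInt_average_of_four _
    (fun x => f x * sin (INR (n + m + l) * x)) (fun x => f x * sin (INR (n + m - l) * x))
    (fun x => f x * sin (INR (n - m + l) * x)) (fun x => f x * sin (INR (n - m - l) * x))
    (-1) 1 1 (-1)); try side_conditions; try (apply HA; auto; lia).
  four_frequencies n m l.
Qed.

Lemma triple_cos_cos_sin f q0 A n m l :
  continuous_on_quadrant f -> sine_integral_small f q0 A ->
  Nat.Odd n -> Nat.Odd m -> Nat.Odd l -> (m + l + q0 <= n)%nat ->
  Rabs (RInt (fun x => f x * cos (INR n * x) * cos (INR m * x) * sin (INR l * x))
          0 (PI / 2)) <= A.
Proof.
  intros Cf HA Hn Hm Hl Hnml.
  destruct (Odd_combination n m l) as [O1 [O2 [O3 O4]]]; auto; [lia|].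
  apply (RInt_average_of_four _
    (fun x => f x * sin (INR (n + m + l) * x)) (fun x => f x * sin (INR (n + m - l) * x))
    (fun x => f x * sin (INR (n - m + l) * x)) (fun x => f x * sin (INR (n - m - l) * x))
    1 (-1) 1 (-1)); try side_conditions; try (apply HA; auto; lia).
  four_frequencies n m l.
Qed.

Lemma triple_cos_sin_sin f q0 A n m l :
  continuous_on_quadrant f -> cosine_integral_small f q0 A ->
  Nat.Odd n -> Nat.Odd m -> Nat.Odd l -> (m + l + q0 <= n)%nat ->
  Rabs (RInt (fun x => f x * cos (INR n * x) * sin (INR m * x) * sin (INR l * x))
          0 (PI / 2)) <= A.
Proof.
  intros Cf HA Hn Hm Hl Hnml.
  destruct (Odd_combination n m l) as [O1 [O2 [O3 O4]]]; auto; [lia|].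
  apply (RInt_average_of_four _
    (fun x => f x * cos (INR (n + m + l) * x)) (fun x => f x * cos (INR (n + m - l) * x))
    (fun x => f x * cos (INR (n - m + l) * x)) (fun x => f x * cos (INR (n - m - l) * x))
    (-1) 1 1 (-1)); try side_conditions; try (apply HA; auto; lia).
  four_frequencies n m l.
Qed.

Lemma triple_sin_cos_sin f q0 A n m l :
  continuous_on_quadrant f -> cosine_integral_small f q0 A ->
  Nat.Odd n -> Nat.Odd m -> Nat.Odd l -> (m + l + q0 <= n)%nat ->
  Rabs (RInt (fun x => f x * sin (INR n * x) * cos (INR m * x) * sin (INR l * x))
          0 (PI / 2)) <= A.
Proof.
  intros Cf HA Hn Hm Hl Hnml.
  destruct (Odd_combination n m l) as [O1 [O2 [O3 O4]]]; auto; [lia|].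
  apply (RInt_average_of_four _
    (fun x => f x * cos (INR (n + m + l) * x)) (fun x => f x * cos (INR (n + m - l) * x))
    (fun x => f x * cos (INR (n - m + l) * x)) (fun x => f x * cos (INR (n - m - l) * x))
    (-1) 1 (-1) 1); try side_conditions; try (apply HA; auto; lia).
  four_frequencies n m l.
Qed.

Lemma RInt_odd_trig_poly phi w B p h A :
  (forall x, continuous phi x) -> continuous_on_quadrant h -> 0 <= A ->
  (forall m, Nat.Odd m -> (m <= w)%nat ->
     Rabs (RInt (fun x => h x * phi (INR m * x)) 0 (PI / 2)) <= A) ->
  odd_trig_poly phi w B p ->
  Rabs (RInt (fun x => h x * p x) 0 (PI / 2)) <= B * A.
Proof.
  intros Cphi Ch HA Hm Hp; induction Hp as [f Hf|B B' f g c m Hp IH Om Hmw Hg HB].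
  - rewrite (RInt_quadrant_ext _ (fun _ => 0)).
    + rewrite RInt_const; unfold scal; simpl; unfold mult; simpl.
      rewrite Rmult_0_r, Rabs_R0; lra.
    + intros x _; rewrite Hf; ring.
  - assert (Cp : continuous_on_quadrant (fun x => phi (INR m * x))).
    { intros x _; apply (continuous_comp (fun x => INR m * x) phi); auto.
      apply (continuous_mult (fun _ => INR m)); [apply continuous_const|apply continuous_id]. }
    assert (Cf : continuous_on_quadrant f).
    { intros x _; now apply odd_trig_poly_continuous with phi w B. }
    rewrite (RInt_quadrant_ext _ (fun x => h x * f x + c * (h x * phi (INR m * x)))).
    2:{ intros x _; rewrite Hg; ring. }
    rewrite RInt_quadrant_plus, RInt_quadrant_scal; auto using continuous_on_quadrant_mult.
    2:{ apply (continuous_on_quadrant_mult (fun _ => c)).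
        - intros x _; apply continuous_const.
        - now apply continuous_on_quadrant_mult. }
    apply Rle_trans with (1 := Rabs_triang _ _); rewrite Rabs_mult.
    specialize (Hm m Om Hmw); generalize (Rabs_pos c); nra.
Qed.

(** The integral is bilinear in the two polynomials, so it is bounded by the product
    of their l1-norms times the supremum over pure frequencies. *)
Lemma RInt_two_odd_trig_polys phi psi w w' B B' p p' h A :
  (forall x, continuous phi x) -> (forall x, continuous psi x) ->
  continuous_on_quadrant h -> 0 <= A ->
  (forall m l, Nat.Odd m -> (m <= w)%nat -> Nat.Odd l -> (l <= w')%nat ->
     Rabs (RInt (fun x => h x * phi (INR m * x) * psi (INR l * x)) 0 (PI / 2)) <= A) ->
  odd_trig_poly phi w B p -> odd_trig_poly psi w' B' p' ->
  Rabs (RInt (fun x => h x * p x * p' x) 0 (PI / 2)) <= B * B' * A.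
Proof.
  intros Cphi Cpsi Ch HA Hml Hp Hp'.
  assert (B0 := odd_trig_poly_pos _ _ _ _ Hp).
  assert (Cp : continuous_on_quadrant p).
  { intros x _; now apply odd_trig_poly_continuous with phi w B. }
  replace (B * B' * A) with (B' * (B * A)) by ring.
  apply (RInt_odd_trig_poly psi w' B' p' (fun x => h x * p x)); auto;
    [now apply continuous_on_quadrant_mult|nra|].
  intros l Ol Hl.
  assert (Cl : continuous_on_quadrant (fun x => psi (INR l * x))).
  { intros x _; apply (continuous_comp (fun x => INR l * x) psi); auto.
    apply (continuous_mult (fun _ => INR l)); [apply continuous_const|apply continuous_id]. }
  rewrite (RInt_quadrant_ext _ (fun x => (h x * psi (INR l * x)) * p x)) by (intros; ring).
  apply (RInt_odd_trig_poly phi w B p (fun x => h x * psi (INR l * x))); auto;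
    [now apply continuous_on_quadrant_mult|].
  intros m Om Hm.
  rewrite (RInt_quadrant_ext _ (fun x => h x * phi (INR m * x) * psi (INR l * x)))
    by (intros; ring).
  now apply Hml.
Qed.

Ltac equation_in_R := match goal with |- @eq _ ?a ?b => change (@eq R a b) end.

Lemma RInt_cos_even h :
  (h <> 0)%nat -> RInt (fun x => cos (INR (2 * h) * x)) 0 (PI / 2) = 0.
Proof.
  intros Hh.
  assert (H0 : INR (2 * h) <> 0) by (apply not_0_INR; lia).
  assert (E : is_RInt (fun x => cos (INR (2 * h) * x)) 0 (PI / 2)
     (/ INR (2 * h) * sin (INR (2 * h) * (PI / 2)) - / INR (2 * h) * sin (INR (2 * h) * 0))).
  { apply (is_RInt_derive (V := R_CompleteNormedModule)
             (fun x => / INR (2 * h) * sin (INR (2 * h) * x))).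
    - intros x _; revert H0; generalize (INR (2 * h)); intros w Hw.
      auto_derive; [easy|field; auto].
    - intros x _; apply continuous_cos_scaled. }
  rewrite (is_RInt_unique _ _ _ _ E), Rmult_0_r, sin_0.
  replace (INR (2 * h) * (PI / 2)) with (INR h * PI) by (rewrite mult_INR; simpl; field).
  replace (sin (INR h * PI)) with 0; [equation_in_R; ring|].
  symmetry; apply sin_eq_0_1; exists (Z.of_nat h); now rewrite <- INR_IZR_INZ.
Qed.

(** The sum and the difference of two distinct odd frequencies are nonzero even
    numbers, and cosines of such frequencies have mean zero on the quadrant. *)
Lemma orthogonality q m :
  Nat.Odd q -> Nat.Odd m -> (m < q)%nat ->
  RInt (fun x => sin (INR q * x) * sin (INR m * x)) 0 (PI / 2) = 0 /\
  RInt (fun x => cos (INR q * x) * cos (INR m * x)) 0 (PI / 2) = 0.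
Proof.
  intros [a ->] [b ->] H.
  assert (C : forall h, continuous_on_quadrant (fun x => cos (INR (2 * h) * x))).
  { intros h; apply continuous_on_quadrant_everywhere, continuous_cos_scaled. }
  assert (Cs : forall s h, continuous_on_quadrant (fun x => s * cos (INR (2 * h) * x))).
  { intros s h; apply (continuous_on_quadrant_mult (fun _ => s)); auto.
    intros x _; apply continuous_const. }
  assert (Z : forall s, RInt (fun x => / 2 * cos (INR (2 * (a - b)) * x)
                                       + s * cos (INR (2 * (a + b + 1)) * x)) 0 (PI / 2) = 0).
  { intros s; rewrite RInt_quadrant_plus, !RInt_quadrant_scal; auto.
    rewrite !RInt_cos_even by lia; equation_in_R; ring. }
  assert (E1 : INR (2 * (a - b)) = INR (2 * a + 1) - INR (2 * b + 1))
    by (rewrite <- minus_INR by lia; f_equal; lia).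
  assert (E2 : INR (2 * (a + b + 1)) = INR (2 * a + 1) + INR (2 * b + 1))
    by (rewrite <- plus_INR; f_equal; lia).
  split; [apply eq_trans with (2 := Z (- / 2))|apply eq_trans with (2 := Z (/ 2))];
    apply RInt_quadrant_ext; intros x _; rewrite E1, E2,
      Rmult_minus_distr_r, Rmult_plus_distr_r, cos_minus, cos_plus; field.
Qed.

Lemma sine_integral_zero w B p :
  odd_trig_poly sin w B p -> sine_integral_small p (S w) 0.
Proof.
  intros Hp q Oq Hq; unfold sine_integral.
  rewrite (RInt_quadrant_ext _ (fun x => sin (INR q * x) * p x)) by (intros; ring).
  apply Rle_trans with (B * 0); [|lra].
  apply (RInt_odd_trig_poly sin w B p (fun x => sin (INR q * x))); auto.
  - apply continuous_sin.
  - intros x _; apply continuous_sin_scaled.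
  - lra.
  - intros m Om Hm; rewrite (proj1 (orthogonality q m Oq Om ltac:(lia))), Rabs_R0; lra.
Qed.

Lemma cosine_integral_zero w B p :
  odd_trig_poly cos w B p -> cosine_integral_small p (S w) 0.
Proof.
  intros Hp q Oq Hq; unfold cosine_integral.
  rewrite (RInt_quadrant_ext _ (fun x => cos (INR q * x) * p x)) by (intros; ring).
  apply Rle_trans with (B * 0); [|lra].
  apply (RInt_odd_trig_poly cos w B p (fun x => cos (INR q * x))); auto.
  - apply continuous_cos.
  - intros x _; apply continuous_cos_scaled.
  - lra.
  - intros m Om Hm; rewrite (proj2 (orthogonality q m Oq Om ltac:(lia))), Rabs_R0; lra.
Qed.

Lemma RInt_difference_bound (h g1 g2 : R -> R) c1 c2 A1 A2 :
  continuous_on_quadrant g1 -> continuous_on_quadrant g2 ->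
  (forall x, h x = c1 * g1 x + - c2 * g2 x) -> 0 <= c1 -> 0 <= c2 ->
  Rabs (RInt g1 0 (PI / 2)) <= A1 -> Rabs (RInt g2 0 (PI / 2)) <= A2 ->
  Rabs (RInt h 0 (PI / 2)) <= c1 * A1 + c2 * A2.
Proof.
  intros C1 C2 Hh P1 P2 H1 H2.
  assert (Cs : forall s g, continuous_on_quadrant g -> continuous_on_quadrant (fun x => s * g x)).
  { intros s g Hg; apply (continuous_on_quadrant_mult (fun _ => s)); auto.
    intros x _; apply continuous_const. }
  rewrite (RInt_quadrant_ext _ _ (fun x _ => Hh x)).
  rewrite RInt_quadrant_plus, !RInt_quadrant_scal by auto.
  apply Rle_trans with (1 := Rabs_triang _ _).
  rewrite !Rabs_mult, Rabs_Ropp, (Rabs_right c1), (Rabs_right c2) by lra.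
  apply Rplus_le_compat; now apply Rmult_le_compat_l.
Qed.

(** The mode i must keep its frequency omega_i exactly, so it is not expanded into
    the lower frequencies of [cos_tan] or [sin_cot].  Instead the denominator of
    tan or cot is absorbed by the weight: sin cos cos_tan = sin^2 cos(omega_i x) and
    sin cos sin_cot = cos^2 sin(omega_i x).  These terms carry the factor kappa_i
    without omega_i, which compensates for their decay being slower by one power. *)
Lemma three_modes_bound :
  exists C, 0 < C /\ forall W q0 A1 A2 A3 i j k,
    continuous_on_quadrant W -> 0 <= A1 -> 0 <= A2 -> 0 <= A3 ->
    sine_integral_small (fun x => sin x * cos x * W x) q0 A1 ->
    cosine_integral_small (fun x => sin x ^ 2 * W x) q0 A2 ->
    cosine_integral_small (fun x => cos x ^ 2 * W x) q0 A3 ->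
    ((2 * j + 3) + (2 * k + 3) + q0 <= 2 * i + 3)%nat ->
    Rabs (RInt (fun x => sin x * cos x * W x * e_tan i x * e_tan j x * e_tan k x) 0 (PI / 2))
      <= C * (A1 + kappa i * A2) /\
    Rabs (RInt (fun x => sin x * cos x * W x * de_tan i x * de_tan j x * e_tan k x) 0 (PI / 2))
      <= C * (A1 + kappa i * A3).
Proof.
  destruct odd_trig_poly_modes as [C [C0 HC]].
  destruct kappa_omega_bound as [K [K0 HK]].
  exists (C * C * (K + 1)); split; [apply Rmult_lt_0_compat; nra|].
  intros W q0 A1 A2 A3 i j k CW P1 P2 P3 S1 S2 S3 Hijk.
  destruct (HC i) as [Ti [Vi _]]; destruct (HC j) as [Tj [Vj _]]; destruct (HC k) as [Tk [Vk _]].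
  assert (Hk := kappa_pos i); assert (Ho := omega_pos i); specialize (HK i).
  assert (Cs : continuous_on_quadrant sin) by (intros x _; apply continuous_sin).
  assert (Cc : continuous_on_quadrant cos) by (intros x _; apply continuous_cos).
  assert (Cw1 : continuous_on_quadrant (fun x => sin x * cos x * W x))
    by (apply (continuous_on_quadrant_mult (fun x => sin x * cos x)); auto;
        now apply continuous_on_quadrant_mult).
  assert (Csq : forall f, continuous_on_quadrant f -> continuous_on_quadrant (fun x => f x ^ 2 * W x)).
  { intros f Cf; apply (continuous_on_quadrant_mult (fun x => f x ^ 2)); auto.
    simpl; apply (continuous_on_quadrant_mult f (fun x => f x * 1)); auto.
    apply (continuous_on_quadrant_mult f (fun x => 1)); auto; intros x _; apply continuous_const. }
  assert (Cn : forall f, continuous_on_quadrant f ->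
             continuous_on_quadrant (fun x => f x * sin (INR (2 * i + 3) * x)) /\
             continuous_on_quadrant (fun x => f x * cos (INR (2 * i + 3) * x))).
  { intros f Cf; split; apply continuous_on_quadrant_mult; auto; intros x _;
      [apply continuous_sin_scaled|apply continuous_cos_scaled]. }
  assert (CT : forall n, continuous_on_quadrant (e_tan n)).
  { intros n x _; apply (odd_trig_poly_continuous sin (2 * n + 3) C); [apply continuous_sin|apply HC]. }
  assert (CV : forall n, continuous_on_quadrant (de_tan n)).
  { intros n x _; apply (odd_trig_poly_continuous cos (2 * n + 3) C); [apply continuous_cos|apply HC]. }
  assert (Fin : forall A, 0 <= A -> kappa i * omega i * (C * C * A1) + kappa i * (C * C * A)
            <= C * C * (K + 1) * (A1 + kappa i * A)).
  { intros A HA.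
    assert (0 <= C * C) by nra.
    replace (kappa i * omega i * (C * C * A1) + kappa i * (C * C * A))
      with (C * C * (kappa i * omega i * A1 + kappa i * A)) by ring.
    rewrite (Rmult_assoc (C * C) (K + 1)); apply Rmult_le_compat_l; auto.
    assert (kappa i * omega i * A1 <= K * A1) by now apply Rmult_le_compat_r.
    assert (0 <= kappa i * A) by (apply Rmult_le_pos; lra).
    nra. }
  split.
  - apply Rle_trans with (2 := Fin A2 P2).
    apply (RInt_difference_bound _
      (fun x => sin x * cos x * W x * sin (INR (2 * i + 3) * x) * e_tan j x * e_tan k x)
      (fun x => sin x ^ 2 * W x * cos (INR (2 * i + 3) * x) * e_tan j x * e_tan k x)); try nra.
    + apply continuous_on_quadrant_mult; auto; apply continuous_on_quadrant_mult; auto.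
      now apply Cn.
    + apply continuous_on_quadrant_mult; auto; apply continuous_on_quadrant_mult; auto.
      apply Cn; auto.
    + intros x; unfold e_tan at 1.
      assert (E := cos_tan_spec (S i) x).
      replace (2 * S i + 1)%nat with (2 * i + 3)%nat in E by lia.
      rewrite omega_INR.
      transitivity (kappa i * INR (2 * i + 3)
          * (sin x * cos x * W x * sin (INR (2 * i + 3) * x) * e_tan j x * e_tan k x)
        - kappa i * (sin x * (cos x * cos_tan (S i) x) * W x * e_tan j x * e_tan k x)); [ring|].
      rewrite E; ring.
    + apply (RInt_two_odd_trig_polys sin sin (2 * j + 3) (2 * k + 3) C C _ _
        (fun x => sin x * cos x * W x * sin (INR (2 * i + 3) * x))); auto using continuous_sin.
      * now apply Cn.
      * intros m l Om Hm Ol Hl.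
        apply (triple_sin_sin_sin (fun x => sin x * cos x * W x) q0); auto using Odd_omega; lia.
    + apply (RInt_two_odd_trig_polys sin sin (2 * j + 3) (2 * k + 3) C C _ _
        (fun x => sin x ^ 2 * W x * cos (INR (2 * i + 3) * x))); auto using continuous_sin.
      * apply (Cn (fun x => sin x ^ 2 * W x)); auto.
      * intros m l Om Hm Ol Hl.
        apply (triple_cos_sin_sin (fun x => sin x ^ 2 * W x) q0); auto using Odd_omega; lia.
  - apply Rle_trans with (2 := Fin A3 P3).
    apply (RInt_difference_bound _
      (fun x => sin x * cos x * W x * cos (INR (2 * i + 3) * x) * de_tan j x * e_tan k x)
      (fun x => cos x ^ 2 * W x * sin (INR (2 * i + 3) * x) * de_tan j x * e_tan k x)); try nra.
    + apply continuous_on_quadrant_mult; auto; apply continuous_on_quadrant_mult; auto.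
      now apply Cn.
    + apply continuous_on_quadrant_mult; auto; apply continuous_on_quadrant_mult; auto.
      apply Cn; auto.
    + intros x; unfold de_tan at 1.
      assert (E := sin_cot_spec (S i) x).
      replace (2 * S i + 1)%nat with (2 * i + 3)%nat in E by lia.
      rewrite omega_INR.
      transitivity (kappa i * INR (2 * i + 3)
          * (sin x * cos x * W x * cos (INR (2 * i + 3) * x) * de_tan j x * e_tan k x)
        - kappa i * (cos x * (sin x * sin_cot (S i) x) * W x * de_tan j x * e_tan k x)); [ring|].
      rewrite E; ring.
    + apply (RInt_two_odd_trig_polys cos sin (2 * j + 3) (2 * k + 3) C C _ _
        (fun x => sin x * cos x * W x * cos (INR (2 * i + 3) * x)));
        auto using continuous_sin, continuous_cos.
      * now apply Cn.
      * intros m l Om Hm Ol Hl.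
        apply (triple_cos_cos_sin (fun x => sin x * cos x * W x) q0); auto using Odd_omega; lia.
    + apply (RInt_two_odd_trig_polys cos sin (2 * j + 3) (2 * k + 3) C C _ _
        (fun x => cos x ^ 2 * W x * sin (INR (2 * i + 3) * x)));
        auto using continuous_sin, continuous_cos.
      * apply (Cn (fun x => cos x ^ 2 * W x)); auto.
      * intros m l Om Hm Ol Hl.
        apply (triple_sin_cos_sin (fun x => cos x ^ 2 * W x) q0); auto using Odd_omega; lia.
Qed.

(** * Admissible weights *)

(** On this interval sin x / x does not vanish; it contains the closed quadrant. *)
Definition two_sided (x : R) : Prop := - PI < x < PI.
(** On this interval cot is smooth, and it is symmetric about pi/2. *)
Definition one_sided (x : R) : Prop := 0 < x < PI.

Lemma open_two_sided : open two_sided.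
Proof. apply open_and; [apply open_gt|apply open_lt]. Qed.

Lemma open_one_sided : open one_sided.
Proof. apply open_and; [apply open_gt|apply open_lt]. Qed.

Lemma covers_quadrant_two_sided : covers_quadrant two_sided.
Proof.
  split; [apply open_two_sided|]; intros x Hx; unfold two_sided.
  generalize PI_RGT_0; lra.
Qed.

Lemma one_sided_two_sided x : one_sided x -> two_sided x.
Proof. unfold one_sided, two_sided; lra. Qed.

Lemma one_sided_PI2 : one_sided (PI / 2).
Proof. generalize PI_RGT_0; unfold one_sided; lra. Qed.

Lemma two_sided_opp x : two_sided x -> two_sided (2 * 0 - x).
Proof. unfold two_sided; lra. Qed.

Lemma one_sided_reflect x : one_sided x -> one_sided (2 * (PI / 2) - x).
Proof. unfold one_sided; lra. Qed.

(** This is sin x / x, defined so as to be smooth at 0. *)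
Definition sinc (x : R) : R := moment 0 cos x.

Lemma smooth_everywhere_on U f : smooth everywhere f -> smooth U f.
Proof. apply smooth_sub; easy. Qed.

Lemma smooth_sinc : smooth everywhere sinc.
Proof. apply smooth_moment, smooth_cos, open_everywhere. Qed.

Lemma sinc_eq x : x * sinc x = sin x.
Proof.
  assert (H := moment_eq 0 cos x (smooth_cos _ open_everywhere)).
  rewrite pow_1 in H; unfold sinc; rewrite H.
  assert (E : is_RInt (fun y => y ^ 0 * cos y) 0 x (sin x - sin 0)).
  { apply (is_RInt_derive (V := R_CompleteNormedModule) sin).
    - intros t _; auto_derive; [easy|simpl; ring].
    - intros t _; apply continuous_ext with cos; [intros; simpl; ring|apply continuous_cos]. }
  rewrite (is_RInt_unique _ _ _ _ E), sin_0; ring.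
Qed.

Lemma moment_even n f x :
  (forall y, f (- y) = f y) -> moment n f (- x) = moment n f x.
Proof.
  intros Hf; apply RInt_ext; intros t _.
  now rewrite Ropp_mult_distr_l_reverse, Hf.
Qed.

Lemma sinc_neq_0 x : two_sided x -> sinc x <> 0.
Proof.
  intros Hx H; assert (E := sinc_eq x); rewrite H, Rmult_0_r in E.
  destruct (Rtotal_order x 0) as [Hn|[H0|Hp]].
  - assert (0 < sin (- x)) by (apply sin_gt_0; unfold two_sided in Hx; lra).
    rewrite sin_neg in *; lra.
  - subst x; unfold sinc, moment in H.
    rewrite (RInt_ext _ (fun _ => 1)) in H.
    + rewrite RInt_const in H; unfold scal in H; simpl in H; unfold mult in H; simpl in H; lra.
    + intros t _; simpl; rewrite Rmult_0_l, cos_0; ring.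
  - assert (0 < sin x) by (apply sin_gt_0; unfold two_sided in Hx; lra); lra.
Qed.

(** In the splitting W = P + Q the summand P has no even derivative at pi/2,
    whatever its size, so the order 2r of Q decides which even derivative of W is
    the first nonzero one there, and likewise for the odd ones of sin cos W. *)
Definition admissible_weight (r : nat) (W : R -> R) : Prop :=
  smooth two_sided W /\
  (forall x, W (- x) = W x) /\
  exists P Q c,
    smooth one_sided P /\ smooth one_sided Q /\
    (forall x, one_sided x -> P (2 * (PI / 2) - x) = -1 * P x) /\
    leading_term (PI / 2) (2 * r) c Q /\ c <> 0 /\
    (forall x, one_sided x -> W x = P x + Q x).

Lemma sin_reflect x : sin (2 * (PI / 2) - x) = sin x.
Proof. replace (2 * (PI / 2) - x) with (PI - x) by field; apply sin_PI_x. Qed.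

Lemma cos_reflect x : cos (2 * (PI / 2) - x) = - cos x.
Proof.
  replace (2 * (PI / 2) - x) with (PI - x) by field.
  rewrite cos_minus, cos_PI, sin_PI; ring.
Qed.

Lemma leading_term_cos_pow n : leading_term (PI / 2) n ((-1) ^ n) (fun x => cos x ^ n).
Proof.
  induction n as [|n IH]; [easy|].
  apply (leading_term_mult everywhere (PI / 2) 1 n (-1) ((-1) ^ n) cos (fun x => cos x ^ n));
    auto using open_everywhere, smooth_cos, smooth_pow; try easy.
  split; [apply cos_PI2|].
  assert (E : is_derive cos (PI / 2) (- sin (PI / 2))) by (auto_derive; [easy|ring]).
  simpl; rewrite (is_derive_unique _ _ _ E), sin_PI2; ring.
Qed.

Lemma leading_term_scal a k c d f :
  leading_term a k c f -> leading_term a k (d * c) (fun x => d * f x).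
Proof.
  revert c f; induction k as [|k IH]; intros c f.
  - simpl; now intros ->.
  - intros [H1 H2]; split; [rewrite H1; ring|].
    rewrite <- Rmult_assoc, (Rmult_comm (INR (S k)) d), Rmult_assoc.
    apply leading_term_ext with (U := everywhere) (f := fun x => d * Derive f x);
      [apply open_everywhere|easy| |auto].
    intros x _; symmetry; apply Derive_scal.
Qed.

Lemma admissible_weight_scal r W c :
  c <> 0 -> admissible_weight r W -> admissible_weight r (fun x => c * W x).
Proof.
  intros Hc [SW [EW [P [Q [d [SP [SQ [RP [LQ [Hd HW]]]]]]]]]]; repeat split.
  - apply smooth_scal; auto; apply open_two_sided.
  - intros x; now rewrite EW.
  - exists (fun x => c * P x), (fun x => c * Q x), (c * d); repeat split.
    + apply smooth_scal; auto; apply open_one_sided.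
    + apply smooth_scal; auto; apply open_one_sided.
    + intros x Hx; rewrite RP; auto; ring.
    + now apply leading_term_scal.
    + now apply Rmult_integral_contrapositive.
    + intros x Hx; rewrite HW; auto; ring.
Qed.

Lemma admissible_weight_regular W :
  smooth everywhere W -> (forall x, W (- x) = W x) -> W (PI / 2) <> 0 ->
  admissible_weight 0 W.
Proof.
  intros SW EW H; repeat split; auto using smooth_everywhere_on.
  exists (fun _ => 0), W, (W (PI / 2)); repeat split; auto using smooth_everywhere_on.
  - apply smooth_const, open_one_sided.
  - intros; ring.
  - intros; ring.
Qed.

(** Write sin^3 W = cos^3 H.  Near 0 the integrand of H is y^2 times a smooth
    function, so H is x^3 times a second moment and W is smooth.  Near pi/2, W is
    cot^3 H, where H(pi/2) cot^3 is odd about pi/2 and H - H(pi/2) vanishes to order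
    2p + 1 since H' does to order 2p; together with cot^3 this gives 2p + 4. *)
Lemma admissible_weight_integral p m :
  smooth everywhere m -> (forall x, m (- x) = m x) -> m (PI / 2) = 1 ->
  exists W, admissible_weight (p + 2) W /\
    forall x, two_sided x ->
      sin x ^ 3 * W x
      = cos x ^ 3 * RInt (fun y => sin y ^ 2 * (cos y ^ (2 * p) * m y)) 0 x.
Proof.
  intros Sm Em Hm.
  assert (OE := open_everywhere); assert (O1 := open_one_sided); assert (O2 := open_two_sided).
  set (k := fun y => cos y ^ (2 * p) * m y).
  assert (Sk : smooth everywhere k)
    by (apply smooth_mult; auto; apply smooth_pow; auto; now apply smooth_cos).
  assert (Ek : forall x, k (- x) = k x) by (intros; unfold k; now rewrite cos_neg, Em).
  assert (Esinc : forall x, sinc (- x) = sinc x)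
    by (intros x; apply moment_even; apply cos_neg).
  set (f := fun y => sinc y ^ 2 * k y).
  assert (Sf : smooth everywhere f)
    by (apply smooth_mult; auto; apply smooth_pow; auto; apply smooth_sinc).
  set (h := fun y => sin y ^ 2 * k y).
  set (H := fun x => RInt h 0 x).
  assert (Hh : forall y, y ^ 2 * f y = h y).
  { intros y; unfold f, h; rewrite <- sinc_eq; ring. }
  assert (HM : forall x, x ^ 3 * moment 2 f x = H x).
  { intros x; rewrite moment_eq; auto; apply RInt_ext; intros y _; apply Hh. }
  assert (Sh : smooth everywhere h).
  { apply smooth_mult; auto; apply smooth_pow; auto; now apply smooth_sin. }
  assert (DH : forall x, is_derive H x (h x)).
  { intros x; apply (is_derive_RInt (V := R_CompleteNormedModule) h H 0 x).
    - apply filter_forall; intros y; apply RInt_correct.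
      apply (ex_RInt_continuous (V := R_CompleteNormedModule)); intros z _.
      now apply smooth_continuous with everywhere.
    - now apply smooth_continuous with everywhere. }
  assert (DH' : forall x, Derive H x = h x) by (intros; now apply is_derive_unique).
  assert (SH : smooth everywhere H).
  { apply smooth_intro; [intros x _; eexists; apply DH|].
    apply smooth_ext with h; auto. }
  set (W := fun x => cos x ^ 3 * (moment 2 f x * (/ sinc x) ^ 3)).
  assert (HW : forall x, two_sided x -> sin x ^ 3 * W x = cos x ^ 3 * H x).
  { intros x Hx; rewrite <- HM, <- sinc_eq; unfold W; field; now apply sinc_neq_0. }
  exists W; split; [|exact HW].
  repeat split.
  - apply smooth_mult; auto.
    + apply smooth_pow; auto; now apply smooth_cos.
    + apply smooth_mult; auto.
      * now apply smooth_everywhere_on, smooth_moment.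
      * apply smooth_pow; auto; apply smooth_inv; auto.
        -- apply smooth_everywhere_on, smooth_sinc.
        -- apply sinc_neq_0.
  - intros x; unfold W; rewrite cos_neg, moment_even, Esinc; auto.
    intros y; unfold f; now rewrite Esinc, Ek.
  - assert (Hs : forall x, one_sided x -> sin x <> 0).
    { intros x Hx; apply Rgt_not_eq, sin_gt_0; apply Hx. }
    set (cot3 := fun x => cos x ^ 3 * (/ sin x) ^ 3).
    assert (Sis : smooth one_sided (fun x => (/ sin x) ^ 3)).
    { apply smooth_pow; auto; apply smooth_inv; auto; now apply smooth_sin. }
    assert (Scos3 : smooth one_sided (fun x => cos x ^ 3))
      by (apply smooth_pow; auto; now apply smooth_cos).
    assert (Scot : smooth one_sided cot3) by now apply smooth_mult.
    assert (SHm : smooth one_sided (fun x => H x - H (PI / 2))).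
    { apply smooth_minus; auto; [now apply smooth_everywhere_on|now apply smooth_const]. }
    exists (fun x => H (PI / 2) * cot3 x), (fun x => cot3 x * (H x - H (PI / 2))),
      (((-1) ^ 3 * 1) * ((-1) ^ (2 * p) / INR (S (2 * p)))).
    repeat split.
    + now apply smooth_scal.
    + now apply smooth_mult.
    + intros x _; unfold cot3; rewrite cos_reflect, sin_reflect; ring.
    + replace (2 * (p + 2))%nat with (3 + 0 + S (2 * p))%nat by lia.
      apply leading_term_mult with one_sided; auto using one_sided_PI2.
      * apply leading_term_mult with one_sided; auto using one_sided_PI2.
        -- apply leading_term_cos_pow.
        -- simpl; rewrite sin_PI2; field.
      * split; [ring|].
        assert (Hp : INR (S (2 * p)) <> 0) by (apply not_0_INR; lia).
        replace (INR (S (2 * p)) * ((-1) ^ (2 * p) / INR (S (2 * p))))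
          with ((-1) ^ (2 * p) * 1) by (field; auto).
        apply leading_term_ext with (U := everywhere)
          (f := fun x => cos x ^ (2 * p) * (sin x ^ 2 * m x)); auto; try easy.
        -- intros x _; transitivity (h x); [unfold h, k; ring|].
           symmetry; apply is_derive_unique.
           replace (h x) with (minus (h x) 0) by (unfold minus, plus, opp; simpl; ring).
           apply (is_derive_minus H (fun _ => H (PI / 2))); [apply DH|].
           apply (is_derive_const (K := R_AbsRing) (V := R_NormedModule)).
        -- replace (2 * p)%nat with (2 * p + 0)%nat at 1 by lia.
           apply leading_term_mult with everywhere; auto; try easy.
           ++ apply smooth_pow; auto; now apply smooth_cos.
           ++ apply smooth_mult; auto; apply smooth_pow; auto; now apply smooth_sin.
           ++ apply leading_term_cos_pow.
           ++ simpl; rewrite sin_PI2, Hm; ring.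
    + rewrite pow_1_even; unfold Rdiv.
      assert (INR (S (2 * p)) <> 0) by (apply not_0_INR; lia).
      apply Rmult_integral_contrapositive; split; [simpl; lra|].
      rewrite Rmult_1_l; now apply Rinv_neq_0_compat.
    + intros x Hx; assert (Hsx := Hs x Hx).
      apply Rmult_eq_reg_l with (sin x ^ 3); [|now apply pow_nonzero].
      rewrite HW by now apply one_sided_two_sided.
      unfold cot3; field; auto.
Qed.

(** In derivatives whose order has the wrong parity, P drops out and only Q is
    seen. *)
Lemma Derive_n_parity_leading U a s P Q f k c n :
  open U -> U a -> (forall x, U x -> U (2 * a - x)) ->
  smooth U P -> smooth U Q -> (forall x, U x -> P (2 * a - x) = s * P x) ->
  leading_term a k c Q -> (forall x, U x -> f x = P x + Q x) ->
  (-1) ^ n * s = -1 ->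
  ((n < k)%nat -> Derive_n f n a = 0) /\ (n = k -> Derive_n f n a = INR (fact k) * c).
Proof.
  intros HU Ha Hsym SP SQ HP HQ Hf Hn.
  assert (E : Derive_n f n a = Derive_n Q n a).
  { rewrite (Derive_n_ext_loc f (fun x => P x + Q x)).
    2:{ apply filter_imp with (2 := HU a Ha); auto. }
    rewrite Derive_n_plus.
    - rewrite (Derive_n_reflection_center U a s P n); auto; ring.
    - apply filter_imp with (2 := HU a Ha); intros y Hy l _.
      now apply smooth_ex_derive_n with U.
    - apply filter_imp with (2 := HU a Ha); intros y Hy l _.
      now apply smooth_ex_derive_n with U. }
  rewrite E; split.
  - now apply leading_term_lower with (1 := HQ).
  - intros ->; now apply leading_term_Derive_n.
Qed.

Lemma pow_m1_odd l : (-1) ^ (2 * l + 1) = -1.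
Proof. rewrite Nat.add_1_r; apply pow_1_odd. Qed.

Lemma smooth_weighted (U : R -> Prop) m W :
  open U -> smooth everywhere m -> smooth U W -> smooth U (fun x => m x * W x).
Proof. intros HU Hm HW; apply smooth_mult; auto using smooth_everywhere_on. Qed.

Lemma smooth_sin_cos : smooth everywhere (fun x => sin x * cos x).
Proof.
  apply smooth_mult; auto using open_everywhere, smooth_sin, smooth_cos.
Qed.

Lemma smooth_sin2 : smooth everywhere (fun x => sin x ^ 2).
Proof. apply smooth_pow; auto using open_everywhere, smooth_sin. Qed.

Lemma smooth_cos2 : smooth everywhere (fun x => cos x ^ 2).
Proof. apply smooth_pow; auto using open_everywhere, smooth_cos. Qed.

(** The factor sin cos is odd about both 0 and pi/2, with a simple zero at pi/2: it
    turns the order 2r into 2r + 1 and exchanges even and odd derivatives. *)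
Lemma sin_cos_weight_derivatives r W :
  admissible_weight r W ->
  let f := fun x => sin x * cos x * W x in
  (forall l, Derive_n f (2 * l) 0 = 0) /\
  (forall l, (l < r)%nat -> Derive_n f (2 * l + 1) (PI / 2) = 0) /\
  Derive_n f (2 * r + 1) (PI / 2) <> 0.
Proof.
  intros [SW [EW [P [Q [c [SP [SQ [RP [LQ [Hc HW]]]]]]]]]] f.
  assert (Ssc := smooth_sin_cos).
  assert (O1 := open_one_sided); assert (O2 := open_two_sided).
  assert (K : forall n, (-1) ^ n * 1 = -1 ->
    ((n < 1 + 2 * r)%nat -> Derive_n f n (PI / 2) = 0) /\
    (n = (1 + 2 * r)%nat -> Derive_n f n (PI / 2) = INR (fact (1 + 2 * r)) * ((-1) ^ 1 * 1 * c))).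
  { intros n; apply (Derive_n_parity_leading one_sided (PI / 2) 1
      (fun x => sin x * cos x * P x) (fun x => cos x ^ 1 * sin x * Q x));
      auto using one_sided_PI2, one_sided_reflect, smooth_weighted.
    - apply smooth_ext with (fun x => sin x * cos x * Q x); auto using smooth_weighted.
      intros; ring.
    - intros x Hx; rewrite sin_reflect, cos_reflect, RP; auto; ring.
    - apply leading_term_mult with one_sided; auto using one_sided_PI2.
      + apply smooth_everywhere_on.
        apply smooth_ext with (fun x => sin x * cos x); auto using open_everywhere.
        intros; ring.
      + apply (leading_term_mult one_sided (PI / 2) 1 0 _ _ (fun x => cos x ^ 1) sin);
          auto using one_sided_PI2, smooth_sin.
        * apply smooth_pow; auto using smooth_cos.
        * apply leading_term_cos_pow.
        * apply sin_PI2.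
    - intros x Hx; unfold f; rewrite HW; auto; ring. }
  repeat split.
  - intros l; apply (Derive_n_reflection_center two_sided 0 (-1)); auto.
    + apply two_sided_opp.
    + now apply smooth_weighted.
    + intros x _; replace (2 * 0 - x) with (- x) by ring.
      unfold f; rewrite sin_neg, cos_neg, EW; ring.
    + unfold two_sided; generalize PI_RGT_0; lra.
    + rewrite pow_1_even; ring.
  - intros l Hl; apply K; [rewrite pow_m1_odd; ring|lia].
  - rewrite (proj2 (K _ ltac:(rewrite pow_m1_odd; ring))) by lia.
    apply Rmult_integral_contrapositive; split; [apply INR_fact_neq_0|].
    simpl; lra.
Qed.

Lemma even_weight_derivatives r W m :
  admissible_weight r W ->
  smooth everywhere m -> (forall x, m (- x) = m x) ->
  (forall x, m (2 * (PI / 2) - x) = m x) ->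
  let f := fun x => m x * W x in
  (forall l, Derive_n f (2 * l + 1) 0 = 0) /\
  (forall l, (l < r)%nat -> Derive_n f (2 * l) (PI / 2) = 0).
Proof.
  intros [SW [EW [P [Q [c [SP [SQ [RP [LQ [Hc HW]]]]]]]]]] Sm Em Rm f.
  assert (O1 := open_one_sided); assert (O2 := open_two_sided).
  split.
  - intros l; apply (Derive_n_reflection_center two_sided 0 1); auto.
    + apply two_sided_opp.
    + now apply smooth_weighted.
    + intros x _; replace (2 * 0 - x) with (- x) by ring.
      unfold f; rewrite Em, EW; ring.
    + unfold two_sided; generalize PI_RGT_0; lra.
    + rewrite pow_m1_odd; ring.
  - intros l Hl.
    apply (Derive_n_parity_leading one_sided (PI / 2) (-1)
      (fun x => m x * P x) (fun x => m x * Q x) f (0 + 2 * r) (m (PI / 2) * c));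
      auto using one_sided_PI2, one_sided_reflect, smooth_weighted; try lia.
    + intros x Hx; rewrite Rm, RP; auto; ring.
    + apply leading_term_mult with one_sided; auto using one_sided_PI2, smooth_everywhere_on.
      easy.
    + intros x Hx; unfold f; rewrite HW; auto; ring.
    + rewrite pow_1_even; ring.
Qed.

Lemma weight_integral_decay r W :
  admissible_weight r W ->
  exists B, 0 <= B /\ forall q, Nat.Odd q ->
    Rabs (sine_integral (fun x => sin x * cos x * W x) q) <= B / INR q ^ (2 * r + 2) /\
    Rabs (cosine_integral (fun x => sin x ^ 2 * W x) q) <= B / INR q ^ (2 * r + 1) /\
    Rabs (cosine_integral (fun x => cos x ^ 2 * W x) q) <= B / INR q ^ (2 * r + 1).
Proof.
  intros HW; assert (SW := proj1 HW).
  assert (HU := covers_quadrant_two_sided); assert (O2 := open_two_sided).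
  destruct (sin_cos_weight_derivatives r W HW) as [H1 [H2 _]].
  destruct (even_weight_derivatives r W (fun x => sin x ^ 2) HW smooth_sin2) as [H3 H4].
  { intros x; rewrite sin_neg; ring. }
  { intros x; rewrite sin_reflect; ring. }
  destruct (even_weight_derivatives r W (fun x => cos x ^ 2) HW smooth_cos2) as [H5 H6].
  { intros x; rewrite cos_neg; ring. }
  { intros x; rewrite cos_reflect; ring. }
  destruct (sine_integral_decay two_sided r (fun x => sin x * cos x * W x)) as [B1 [P1 D1]];
    auto using smooth_weighted, smooth_sin_cos.
  destruct (cosine_integral_decay two_sided r (fun x => sin x ^ 2 * W x)) as [B2 [P2 D2]];
    auto using smooth_weighted, smooth_sin2.
  destruct (cosine_integral_decay two_sided r (fun x => cos x ^ 2 * W x)) as [B3 [P3 D3]];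
    auto using smooth_weighted, smooth_cos2.
  exists (B1 + B2 + B3); split; [lra|]; intros q Hq.
  assert (q0 : 0 < INR q) by (destruct Hq as [h ->]; apply lt_0_INR; lia).
  assert (M : forall n B, B <= B1 + B2 + B3 -> B / INR q ^ n <= (B1 + B2 + B3) / INR q ^ n).
  { intros n B HB; apply Rmult_le_compat_r; auto.
    apply Rlt_le, Rinv_0_lt_compat, pow_lt; auto. }
  repeat split.
  - apply Rle_trans with (1 := D1 q Hq), M; lra.
  - apply Rle_trans with (1 := D2 q Hq), M; lra.
  - apply Rle_trans with (1 := D3 q Hq), M; lra.
Qed.

(** * The weights of the Fourier constants *)

(** The Jacobi polynomial of degree 0 is 1, so e_0 is this multiple of cos^3. *)
Definition e0_amplitude : R := e 0 0.

Lemma e0_formula x : e 0 x = e0_amplitude * cos x ^ 3.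
Proof. unfold e0_amplitude, e, Jacobi; simpl; rewrite cos_0; ring. Qed.

Lemma e0_amplitude_neq_0 : e0_amplitude <> 0.
Proof.
  intros H.
  assert (E := e_closed_form 0 (PI / 4)); rewrite e0_formula, H in E.
  assert (Hk := kappa_pos 0).
  replace (omega 0 * (PI / 4)) with (PI / 2 + PI / 4) in E by (unfold omega; simpl; field).
  rewrite sin_plus, cos_plus, sin_PI2, cos_PI2 in E.
  assert (S : 0 < sin (PI / 4)) by (apply sin_gt_0; generalize PI_RGT_0; lra).
  assert (C : 0 < cos (PI / 4)) by (apply cos_gt_0; generalize PI_RGT_0; lra).
  assert (Ho : omega 0 = 3) by (unfold omega; simpl; ring).
  rewrite Ho in E.
  assert (0 < kappa 0 * (3 * (cos (PI / 4) * cos (PI / 4)) + sin (PI / 4) * sin (PI / 4))).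
  { apply Rmult_lt_0_compat; nra. }
  nra.
Qed.

Lemma is_derive_e0 x : is_derive (e 0) x (-3 * e0_amplitude * (cos x ^ 2 * sin x)).
Proof.
  apply is_derive_ext with (fun x => e0_amplitude * cos x ^ 3).
  - intros; now rewrite e0_formula.
  - auto_derive; [easy|simpl; ring].
Qed.

Lemma Derive_e0 x : Derive (e 0) x = -3 * e0_amplitude * (cos x ^ 2 * sin x).
Proof. apply is_derive_unique, is_derive_e0. Qed.

Lemma omega_0 : omega 0 = 3.
Proof. unfold omega; simpl; ring. Qed.

Lemma quadrant_trig_pos x : 0 < x < PI / 2 -> 0 < sin x /\ 0 < cos x.
Proof.
  intros Hx; split; [apply sin_gt_0|apply cos_gt_0]; generalize PI_RGT_0; lra.
Qed.

Definition vanishing_rank (a : index) : nat :=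
  match a with I1 => 3 | I2 => 4 | I3 => 0 | I4 => 0 end.

Lemma decay_vanishing_rank a : decay a = (2 * vanishing_rank a + 2)%nat.
Proof. destruct a; reflexivity. Qed.

Lemma RInt_scal_everywhere (f g : R -> R) c x :
  0 < x < PI / 2 -> (forall y, continuous g y) ->
  (forall y, 0 < cos y -> f y = c * g y) ->
  RInt f 0 x = c * RInt g 0 x.
Proof.
  intros Hx Cg H.
  rewrite (RInt_ext f (fun y => c * g y)).
  - apply (RInt_scal (V := R_CompleteNormedModule) g).
    apply (ex_RInt_continuous (V := R_CompleteNormedModule)); auto.
  - intros y; rewrite Rmin_left, Rmax_right by lra; intros Hy.
    apply H, cos_gt_0; lra.
Qed.

Lemma RInt_primitive (F f : R -> R) x :
  (forall y, is_derive F y (f y)) -> (forall y, continuous f y) ->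
  RInt f 0 x = F x - F 0.
Proof.
  intros HF Cf; apply (is_RInt_unique (V := R_CompleteNormedModule)).
  apply (is_RInt_derive (V := R_CompleteNormedModule)); auto.
Qed.

(** The four integrands are 9 e_0(0)^2 times cos^2 sin^4, cos^4 sin^2, cos^5 sin^3 and
    cos^7 sin.  The last two have primitives that are polynomials in cos^2, and
    the integral from 0 is divisible by 1 - cos^2. *)
Lemma Gam_weight a :
  exists W, admissible_weight (vanishing_rank a) W /\
    forall x, 0 < x < PI / 2 -> Gam a x = sin x ^ 2 * W x.
Proof.
  set (c := 9 * e0_amplitude ^ 2).
  assert (Hc : c <> 0).
  { apply Rmult_integral_contrapositive; split; [lra|].
    apply pow_nonzero, e0_amplitude_neq_0. }
  assert (OE := open_everywhere).
  assert (TS : forall x, 0 < x < PI / 2 -> two_sided x).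
  { intros x Hx; unfold two_sided; generalize PI_RGT_0; lra. }
  assert (S1 : smooth everywhere (fun _ => 1)) by now apply smooth_const.
  assert (Sc : forall n, smooth everywhere (fun x => cos x ^ n))
    by (intros; apply smooth_pow; auto using smooth_cos).
  assert (Cw : forall p m, smooth everywhere m ->
     forall y, continuous (fun y => sin y ^ 2 * (cos y ^ (2 * p) * m y)) y).
  { intros p m Sm y; apply (smooth_continuous everywhere); [|easy].
    apply smooth_mult; auto using smooth_sin2; apply smooth_mult; auto. }
  destruct a; simpl vanishing_rank.
  - destruct (admissible_weight_integral 1 (fun x => sin x ^ 2)) as [W [AW HW]].
    { apply smooth_sin2. }
    { intros x; rewrite sin_neg; ring. }
    { rewrite sin_PI2; ring. }
    exists (fun x => c * W x); split; [now apply admissible_weight_scal|].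
    intros x Hx; destruct (quadrant_trig_pos x Hx) as [Hs _].
    unfold Gam; rewrite (RInt_scal_everywhere _
      (fun y => sin y ^ 2 * (cos y ^ (2 * 1) * sin y ^ 2)) c); auto using smooth_sin2.
    + apply Rmult_eq_reg_l with (sin x); [|lra].
      replace (sin x * (sin x ^ 2 * (c * W x))) with (c * (sin x ^ 3 * W x)) by ring.
      rewrite HW by auto; field; lra.
    + intros y Hy; rewrite Derive_e0; unfold tan, c; simpl; field; lra.
  - destruct (admissible_weight_integral 2 (fun _ => 1)) as [W [AW HW]]; auto.
    exists (fun x => c * W x); split; [now apply admissible_weight_scal|].
    intros x Hx; destruct (quadrant_trig_pos x Hx) as [Hs _].
    unfold Gam; rewrite (RInt_scal_everywhere _
      (fun y => sin y ^ 2 * (cos y ^ (2 * 2) * 1)) (e0_amplitude ^ 2)); auto.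
    + apply Rmult_eq_reg_l with (sin x); [|lra].
      replace (sin x * (sin x ^ 2 * (c * W x))) with (c * (sin x ^ 3 * W x)) by ring.
      rewrite HW by auto; rewrite omega_0; unfold c; field; lra.
    + intros y Hy; rewrite e0_formula; unfold tan; simpl; field; lra.
  (* (1 - u^3) / 6 - (1 - u^4) / 8 divided by 1 - u, at u = cos^2. *)
  - set (W := fun x => / 24 + / 24 * cos x ^ 2 + / 24 * cos x ^ 4 - / 8 * cos x ^ 6).
    assert (SW : smooth everywhere W).
    { repeat first [apply smooth_minus; auto | apply smooth_plus; auto];
        try apply smooth_scal; auto using smooth_const. }
    exists (fun x => c * W x); split.
    + apply admissible_weight_scal, admissible_weight_regular; auto.
      * intros x; unfold W; now rewrite cos_neg.
      * unfold W; rewrite cos_PI2; simpl; lra.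
    + intros x Hx; unfold Gam.
      rewrite (RInt_scal_everywhere _ (fun y => cos y ^ 5 * sin y ^ 3) c); auto.
      * rewrite (RInt_primitive (fun y => / 8 * cos y ^ 8 - / 6 * cos y ^ 6)).
        -- rewrite cos_0; unfold W.
           replace (sin x ^ 2) with (1 - cos x ^ 2); [field|].
           generalize (sin2_cos2 x); unfold Rsqr; intros E; rewrite <- E; ring.
        -- intros y; auto_derive; [easy|].
           replace (cos y ^ 5 * sin y ^ 3) with (cos y ^ 5 * sin y * (1 - cos y ^ 2)).
           ++ simpl; field.
           ++ generalize (sin2_cos2 y); unfold Rsqr; intros E; rewrite <- E; ring.
        -- intros y; apply (ex_derive_continuous (V := R_NormedModule)); auto_derive; auto.
      * intros y; apply (ex_derive_continuous (V := R_NormedModule)); auto_derive; auto.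
      * intros y Hy; rewrite Derive_e0; unfold c; ring.
  (* (1 - u^4) / 8 divided by 1 - u, at u = cos^2. *)
  - set (W := fun x => / 8 + / 8 * cos x ^ 2 + / 8 * cos x ^ 4 + / 8 * cos x ^ 6).
    assert (SW : smooth everywhere W).
    { repeat (apply smooth_plus; auto); try apply smooth_scal; auto using smooth_const. }
    exists (fun x => c * W x); split.
    + apply admissible_weight_scal, admissible_weight_regular; auto.
      * intros x; unfold W; now rewrite cos_neg.
      * unfold W; rewrite cos_PI2; simpl; lra.
    + intros x Hx; unfold Gam.
      rewrite (RInt_scal_everywhere _ (fun y => cos y ^ 7 * sin y) (e0_amplitude ^ 2)); auto.
      * rewrite (RInt_primitive (fun y => - / 8 * cos y ^ 8)).
        -- rewrite cos_0, omega_0; unfold W, c.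
           replace (sin x ^ 2) with (1 - cos x ^ 2); [field|].
           generalize (sin2_cos2 x); unfold Rsqr; intros E; rewrite <- E; ring.
        -- intros y; auto_derive; [easy|simpl; field].
        -- intros y; apply (ex_derive_continuous (V := R_NormedModule)); auto_derive; auto.
      * intros y; apply (ex_derive_continuous (V := R_NormedModule)); auto_derive; auto.
      * intros y Hy; rewrite e0_formula; ring.
Qed.

Lemma e_tan_quadrant i x : 0 < x < PI / 2 -> e i x * tan x = e_tan i x.
Proof.
  intros Hx; apply e_tan_spec; generalize (quadrant_trig_pos x Hx); lra.
Qed.

Lemma de_tan_quadrant i x : 0 < x < PI / 2 -> Derive (e i) x / omega i * tan x = de_tan i x.
Proof.
  intros Hx; destruct (quadrant_trig_pos x Hx).
  assert (Ho := omega_pos i).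
  transitivity ((Derive (e i) x * tan x) / omega i); [field; lra|].
  rewrite de_tan_spec by lra; field; lra.
Qed.

Lemma e_poly_quadrant i x : 0 < x < PI / 2 -> e i x = e_poly i x.
Proof.
  intros Hx; apply e_poly_spec; generalize (quadrant_trig_pos x Hx); lra.
Qed.

Lemma modes_bounded :
  exists C, 0 < C /\ forall i x,
    Rabs (e_tan i x) <= C /\ Rabs (de_tan i x) <= C /\ Rabs (e_poly i x) <= C * omega i.
Proof.
  destruct odd_trig_poly_modes as [C [C0 HC]].
  exists C; split; auto; intros i x; destruct (HC i) as [H1 [H2 H3]]; repeat split.
  - now apply (odd_trig_poly_bound sin (2 * i + 3) C); [apply abs_sin_le|].
  - now apply (odd_trig_poly_bound cos (2 * i + 3) C); [apply abs_cos_le|].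
  - now apply (odd_trig_poly_bound cos (2 * i + 3) (C * omega i)); [apply abs_cos_le|].
Qed.

Lemma modes_continuous i :
  continuous_on_quadrant (e_tan i) /\ continuous_on_quadrant (de_tan i) /\
  continuous_on_quadrant (e_poly i).
Proof.
  destruct odd_trig_poly_modes as [C [C0 HC]]; destruct (HC i) as [H1 [H2 H3]].
  repeat split; intros x _.
  - now apply (odd_trig_poly_continuous sin (2 * i + 3) C); [apply continuous_sin|].
  - now apply (odd_trig_poly_continuous cos (2 * i + 3) C); [apply continuous_cos|].
  - now apply (odd_trig_poly_continuous cos (2 * i + 3) (C * omega i)); [apply continuous_cos|].
Qed.

Lemma Rabs_mult_le x y a b : Rabs x <= a -> Rabs y <= b -> Rabs (x * y) <= a * b.
Proof.
  intros; rewrite Rabs_mult; apply Rmult_le_compat; auto using Rabs_pos.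
Qed.

Lemma RInt_quadrant_product4 f g h k A B C D :
  continuous_on_quadrant f -> continuous_on_quadrant g ->
  continuous_on_quadrant h -> continuous_on_quadrant k ->
  (forall x, 0 <= x <= PI / 2 -> Rabs (f x) <= A) ->
  (forall x, Rabs (g x) <= B) -> (forall x, Rabs (h x) <= C) -> (forall x, Rabs (k x) <= D) ->
  Rabs (RInt (fun x => f x * g x * h x * k x) 0 (PI / 2)) <= PI / 2 * (A * B * C * D).
Proof.
  intros Cf Cg Ch Ck Bf Bg Bh Bk; apply RInt_quadrant_bound.
  - apply (continuous_on_quadrant_mult (fun x => f x * g x * h x)); auto.
    apply (continuous_on_quadrant_mult (fun x => f x * g x)); auto.
    now apply continuous_on_quadrant_mult.
  - intros x Hx; repeat apply Rabs_mult_le; auto.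
Qed.

Lemma weight_continuous r W : admissible_weight r W -> continuous_on_quadrant W.
Proof.
  intros [SW _] x Hx; apply smooth_continuous with two_sided; auto.
  now apply covers_quadrant_two_sided.
Qed.

(** Each factor tan goes to one of the modes i and j, making it bounded, and the
    remaining mode k costs omega_k. *)
Lemma FF_bound a :
  exists C, forall i j k,
    Rabs (FF a j k i) <= C * omega k /\ Rabs (FFbar a j k i) <= C * omega k.
Proof.
  destruct (Gam_weight a) as [W [AW HW]].
  assert (CW := weight_continuous _ _ AW).
  set (g := fun x => sin x ^ 2 * W x).
  assert (Cg : continuous_on_quadrant g).
  { apply (continuous_on_quadrant_mult (fun x => sin x ^ 2)); auto.
    intros x _; apply (smooth_continuous everywhere); [apply smooth_sin2|easy]. }
  destruct (bounded_on_quadrant g Cg) as [B [B0 HB]].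
  destruct modes_bounded as [C [C0 HC]].
  exists (PI / 2 * (B * C * C * C)); intros i j k.
  destruct (modes_continuous i) as [Ti [Vi _]].
  destruct (modes_continuous j) as [Tj [Vj _]].
  destruct (modes_continuous k) as [_ [_ Ek]].
  replace (PI / 2 * (B * C * C * C) * omega k) with (PI / 2 * (B * C * C * (C * omega k))) by ring.
  unfold FF, FFbar; split.
  - rewrite (RInt_quadrant_ext _ (fun x => g x * e_tan i x * e_tan j x * e_poly k x)).
    + apply RInt_quadrant_product4; auto; intros x; apply HC.
    + intros x Hx; rewrite <- !e_tan_quadrant, <- e_poly_quadrant, HW by auto.
      unfold g; ring.
  - rewrite (RInt_quadrant_ext _ (fun x => g x * de_tan i x * de_tan j x * e_poly k x)).
    + apply RInt_quadrant_product4; auto; intros x; apply HC.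
    + intros x Hx; rewrite <- !de_tan_quadrant, <- e_poly_quadrant, HW by auto.
      unfold g; ring.
Qed.

(** The terms with kappa_i decay like M^-(2r+1) only, but kappa_i = O(1 / omega_i)
    and omega_i >= M. *)
Lemma FF_decay a :
  exists C, 0 <= C /\ forall i j k, 0 < comb false false i j k ->
    Rabs (FF a j k i) <= C / comb false false i j k ^ decay a /\
    Rabs (FFbar a j k i) <= C / comb false false i j k ^ decay a.
Proof.
  destruct (Gam_weight a) as [W [AW HW]].
  assert (CW := weight_continuous _ _ AW).
  destruct (weight_integral_decay _ _ AW) as [B [B0 HB]].
  destruct three_modes_bound as [C [C0 HC]].
  destruct kappa_omega_bound as [K [K0 HK]].
  exists (C * (B * (1 + K))); split; [apply Rmult_le_pos; nra|]; intros i j k.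
  set (M := comb false false i j k); intros HM.
  assert (EM : M = omega i - omega j - omega k) by (unfold M, comb, sgn; ring).
  assert (Hlt : (2 * j + 3 + (2 * k + 3) < 2 * i + 3)%nat).
  { apply INR_lt; rewrite plus_INR, <- !omega_INR; lra. }
  set (q0 := (2 * i + 3 - (2 * j + 3) - (2 * k + 3))%nat).
  assert (Hq0 : INR q0 = M).
  { unfold q0; rewrite !minus_INR by lia; now rewrite <- !omega_INR, EM. }
  assert (HMi : M <= omega i) by (generalize (omega_pos j) (omega_pos k); lra).
  assert (Hk := kappa_pos i); specialize (HK i).
  set (r := vanishing_rank a) in *.
  assert (small : forall n q, (q0 <= q)%nat -> B / INR q ^ n <= B / M ^ n).
  { intros n q Hq; apply Rmult_le_compat_l; auto.
    apply Rinv_le_contravar; [now apply pow_lt|].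
    apply pow_incr; split; [lra|]; rewrite <- Hq0; now apply le_INR. }
  assert (HA : forall n, 0 <= B / M ^ n).
  { intros n; apply Rmult_le_pos; auto; apply Rlt_le, Rinv_0_lt_compat, pow_lt; auto. }
  assert (Fin : C * (B / M ^ (2 * r + 2) + kappa i * (B / M ^ (2 * r + 1)))
                <= C * (B * (1 + K)) / M ^ decay a).
  { rewrite decay_vanishing_rank; fold r.
    replace (C * (B * (1 + K)) / M ^ (2 * r + 2))
      with (C * (B / M ^ (2 * r + 2) + K * (B / M ^ (2 * r + 2)))) by (unfold Rdiv; ring).
    apply Rmult_le_compat_l; [lra|]; apply Rplus_le_compat_l.
    replace (B / M ^ (2 * r + 1)) with (M * (B / M ^ (2 * r + 2))).
    - rewrite <- Rmult_assoc; apply Rmult_le_compat_r; auto.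
      apply Rle_trans with (2 := HK); apply Rmult_le_compat_l; lra.
    - replace (2 * r + 2)%nat with (S (2 * r + 1)) by lia.
      rewrite <- tech_pow_Rmult; field; split; [apply pow_nonzero|]; lra. }
  destruct (HC W q0 (B / M ^ (2 * r + 2)) (B / M ^ (2 * r + 1)) (B / M ^ (2 * r + 1)) i j k)
    as [R1 R2]; auto; try (unfold q0; lia).
  1, 2, 3: intros q Oq Hq; apply Rle_trans with (2 := small _ q Hq);
    destruct (HB q Oq) as [D1 [D2 D3]]; assumption.
  unfold FF, FFbar; split.
  - apply Rle_trans with (2 := Fin), Rle_trans with (2 := R1), Req_le; f_equal.
    apply RInt_quadrant_ext; intros x Hx; rewrite <- !e_tan_quadrant, HW by auto.
    unfold tan; field; generalize (quadrant_trig_pos x Hx); lra.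
  - apply Rle_trans with (2 := Fin), Rle_trans with (2 := R2), Req_le; f_equal.
    apply RInt_quadrant_ext; intros x Hx; rewrite <- !de_tan_quadrant, <- e_tan_quadrant, HW by auto.
    unfold tan; field; generalize (quadrant_trig_pos x Hx) (omega_pos i) (omega_pos j); lra.
Qed.

(** * The constants R and Rbar *)

Lemma cos_pow2_sin x : cos x ^ 2 * sin x = / 4 * sin (INR 1 * x) + / 4 * sin (INR 3 * x).
Proof.
  replace (INR 1 * x) with x by (simpl; ring).
  replace (INR 3 * x) with (2 * x + x) by (simpl; ring).
  rewrite sin_plus, sin_2a, cos_2a_cos; field.
Qed.

Lemma cos_pow4_sin x :
  cos x ^ 4 * sin x = / 8 * sin (INR 1 * x) + 3 / 16 * sin (INR 3 * x) + / 16 * sin (INR 5 * x).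
Proof.
  replace (INR 1 * x) with x by (simpl; ring).
  replace (INR 3 * x) with (2 * x + x) by (simpl; ring).
  replace (INR 5 * x) with (2 * (2 * x) + x) by (simpl; ring).
  rewrite !sin_plus, (cos_2a_cos (2 * x)), (sin_2a (2 * x)), !cos_2a_cos, !sin_2a; field.
Qed.

Lemma cos_pow3 x : cos x ^ 3 = 3 / 4 * cos (INR 1 * x) + / 4 * cos (INR 3 * x).
Proof.
  replace (INR 1 * x) with x by (simpl; ring).
  replace (INR 3 * x) with (2 * x + x) by (simpl; ring).
  rewrite cos_plus, cos_2a_cos, sin_2a.
  replace (2 * sin x * cos x * sin x) with (2 * (sin x * sin x) * cos x) by ring.
  replace (sin x * sin x) with (1 - cos x * cos x)
    by (generalize (sin2_cos2 x); unfold Rsqr; lra).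
  field.
Qed.

Lemma cos_pow5 x :
  cos x ^ 5 = 5 / 8 * cos (INR 1 * x) + 5 / 16 * cos (INR 3 * x) + / 16 * cos (INR 5 * x).
Proof.
  replace (INR 1 * x) with x by (simpl; ring).
  replace (INR 3 * x) with (2 * x + x) by (simpl; ring).
  replace (INR 5 * x) with (2 * (2 * x) + x) by (simpl; ring).
  rewrite !cos_plus, (cos_2a_cos (2 * x)), (sin_2a (2 * x)), !cos_2a_cos, !sin_2a.
  set (s := sin x); set (c := cos x).
  assert (E : s * s = 1 - c * c) by (generalize (sin2_cos2 x); unfold Rsqr, s, c; lra).
  replace (2 * s * c * s) with (2 * (s * s) * c) by ring.
  replace (2 * (2 * s * c) * (2 * c * c - 1) * s) with (4 * (s * s) * c * (2 * c * c - 1)) by ring.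
  rewrite E; field.
Qed.

Lemma odd_trig_poly_three phi w a b c m n l :
  Nat.Odd m -> Nat.Odd n -> Nat.Odd l -> (m <= w)%nat -> (n <= w)%nat -> (l <= w)%nat ->
  odd_trig_poly phi w (Rabs a + Rabs b + Rabs c)
    (fun x => a * phi (INR m * x) + b * phi (INR n * x) + c * phi (INR l * x)).
Proof.
  intros Om On Ol Hm Hn Hl.
  apply odd_trig_poly_add with (Rabs a + Rabs b)
    (fun x => a * phi (INR m * x) + b * phi (INR n * x)) c l; auto; [|lra].
  apply odd_trig_poly_add with (Rabs a) (fun x => a * phi (INR m * x)) b n; auto; [|lra].
  apply odd_trig_poly_add with 0 (fun _ => 0) a m; auto; [|intros; ring|lra].
  now apply odd_trig_poly_zero.
Qed.

Lemma Odd_1 : Nat.Odd 1. Proof. now exists 0%nat. Qed.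
Lemma Odd_3 : Nat.Odd 3. Proof. now exists 1%nat. Qed.
Lemma Odd_5 : Nat.Odd 5. Proof. now exists 2%nat. Qed.

Lemma sine_integral_small_three (f : R -> R) w a b c :
  (5 <= w)%nat ->
  (forall x, f x = a * sin (INR 1 * x) + b * sin (INR 3 * x) + c * sin (INR 5 * x)) ->
  sine_integral_small f (S w) 0.
Proof.
  intros Hw Hf q Oq Hq; unfold sine_integral.
  rewrite (RInt_quadrant_ext _ (fun x =>
    (a * sin (INR 1 * x) + b * sin (INR 3 * x) + c * sin (INR 5 * x)) * sin (INR q * x)))
    by (intros x _; now rewrite Hf).
  apply (sine_integral_zero w _ _ (odd_trig_poly_three sin w a b c 1 3 5 Odd_1 Odd_3 Odd_5
    ltac:(lia) ltac:(lia) Hw) q Oq Hq).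
Qed.

Lemma cosine_integral_small_three (f : R -> R) w a b c :
  (5 <= w)%nat ->
  (forall x, f x = a * cos (INR 1 * x) + b * cos (INR 3 * x) + c * cos (INR 5 * x)) ->
  cosine_integral_small f (S w) 0.
Proof.
  intros Hw Hf q Oq Hq; unfold cosine_integral.
  rewrite (RInt_quadrant_ext _ (fun x =>
    (a * cos (INR 1 * x) + b * cos (INR 3 * x) + c * cos (INR 5 * x)) * cos (INR q * x)))
    by (intros x _; now rewrite Hf).
  apply (cosine_integral_zero w _ _ (odd_trig_poly_three cos w a b c 1 3 5 Odd_1 Odd_3 Odd_5
    ltac:(lia) ltac:(lia) Hw) q Oq Hq).
Qed.

(** Chosen so that sin cos times it is e_0' cos^2 / omega_0. *)
Definition R_weight (x : R) : R := - e0_amplitude * cos x ^ 3.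

Lemma continuous_R_weight x : continuous R_weight x.
Proof.
  apply (ex_derive_continuous (V := R_NormedModule)); unfold R_weight; auto_derive; auto.
Qed.

Lemma RR_eq i j k :
  RR 0 k j i
  = RInt (fun x => sin x * cos x * R_weight x * de_tan i x * de_tan k x * e_tan j x) 0 (PI / 2).
Proof.
  apply RInt_quadrant_ext; intros x Hx.
  rewrite Derive_e0, omega_0, <- !de_tan_quadrant, <- e_tan_quadrant by auto.
  unfold R_weight, tan; field.
  generalize (quadrant_trig_pos x Hx) (omega_pos i) (omega_pos k); lra.
Qed.

(** The weights sin cos, sin^2 and cos^2 times [R_weight] have degree at most 5, so
    they are orthogonal to all odd frequencies from 6 on. *)
Lemma RR_zero i j k :
  ((2 * k + 3) + (2 * j + 3) + 6 <= 2 * i + 3)%nat -> RR 0 k j i = 0.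
Proof.
  intros H; destruct three_modes_bound as [C [C0 HC]].
  destruct (HC R_weight 6%nat 0 0 0 i k j) as [_ HR]; try lra; try lia.
  - intros x _; apply continuous_R_weight.
  - apply (sine_integral_small_three _ 5 (- e0_amplitude / 8) (- e0_amplitude * 3 / 16)
      (- e0_amplitude / 16));
      [lia|].
    intros x; unfold R_weight.
    transitivity (- e0_amplitude * (cos x ^ 4 * sin x)); [ring|rewrite cos_pow4_sin; field].
  - apply (cosine_integral_small_three _ 5 (- e0_amplitude / 8) (e0_amplitude / 16) (e0_amplitude / 16));
      [lia|].
    intros x; unfold R_weight.
    transitivity (- e0_amplitude * (cos x ^ 3 - cos x ^ 5)).
    + replace (sin x ^ 2) with (1 - cos x ^ 2); [ring|].
      generalize (sin2_cos2 x); unfold Rsqr; intros E; rewrite <- E; ring.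
    + rewrite cos_pow3, cos_pow5; field.
  - apply (cosine_integral_small_three _ 5 (- e0_amplitude * 5 / 8) (- e0_amplitude * 5 / 16)
      (- e0_amplitude / 16));
      [lia|].
    intros x; unfold R_weight.
    transitivity (- e0_amplitude * cos x ^ 5); [ring|rewrite cos_pow5; field].
  - rewrite RR_eq; rewrite Rmult_0_r, Rplus_0_l, Rmult_0_r in HR.
    apply Rabs_eq_0, Rle_antisym; [exact HR|apply Rabs_pos].
Qed.

Lemma RR_bound : exists C, forall i j k, Rabs (RR 0 k j i) <= C.
Proof.
  set (g := fun x => sin x * cos x * R_weight x).
  assert (Cg : continuous_on_quadrant g).
  { intros x _; apply (ex_derive_continuous (V := R_NormedModule)); unfold g, R_weight; auto_derive; auto. }
  destruct (bounded_on_quadrant g Cg) as [B [B0 HB]].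
  destruct modes_bounded as [C [C0 HC]].
  exists (PI / 2 * (B * C * C * C)); intros i j k; rewrite RR_eq.
  apply (RInt_quadrant_product4 g); auto; try apply modes_continuous; intros x; apply HC.
Qed.

(** The integral of e_i sin cos over [x, pi/2].  The integrand is a combination of
    sines of frequencies omega_i and omega_i +- 2, so only these high
    frequencies occur; they are odd, hence the primitive vanishes at pi/2. *)
Definition e_primitive (i : nat) (x : R) : R :=
  kappa i * (/ 2 * cos (INR (2 * i + 3) * x)
             + (omega i - 1) / (4 * (omega i + 2)) * cos (INR (2 * i + 5) * x)
             + (omega i + 1) / (4 * (omega i - 2)) * cos (INR (2 * i + 1) * x)).

Lemma is_derive_e_primitive i x :
  is_derive (e_primitive i) x (- (e i x * sin x * cos x)).
Proof.
  rewrite e_closed_form; unfold e_primitive.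
  assert (Ho := omega_pos i).
  assert (E3 : INR (2 * i + 3) = omega i) by now rewrite omega_INR.
  assert (E5 : INR (2 * i + 5) = omega i + 2).
  { rewrite omega_INR, !plus_INR; simpl; ring. }
  assert (E1 : INR (2 * i + 1) = omega i - 2).
  { rewrite omega_INR, !plus_INR; simpl; ring. }
  rewrite E1, E3, E5; revert Ho; generalize (omega i) (kappa i); intros w c Ho.
  auto_derive; [easy|].
  replace ((w + 2) * x) with (w * x + 2 * x) by ring.
  replace ((w - 2) * x) with (w * x - 2 * x) by ring.
  rewrite sin_plus, sin_minus, cos_2a_cos, sin_2a; field; lra.
Qed.

Lemma RInt_e_primitive i x :
  RInt (fun y => e i y * sin y * cos y) x (PI / 2) = e_primitive i x.
Proof.
  assert (HI : is_RInt (fun y => e i y * sin y * cos y) x (PI / 2)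
                 (- e_primitive i (PI / 2) - - e_primitive i x)).
  { apply (is_RInt_derive (V := R_CompleteNormedModule) (fun y => - e_primitive i y)).
    - intros y _; assert (D := is_derive_opp _ _ _ (is_derive_e_primitive i y)).
      replace (e i y * sin y * cos y) with (opp (- (e i y * sin y * cos y)))
        by (unfold opp; simpl; ring).
      exact D.
    - intros y _.
      apply continuous_ext with (fun y => kappa i * (omega i * sin (omega i * y) * cos y
                                          - cos (omega i * y) * sin y) * cos y).
      + intros t; now rewrite <- e_closed_form.
      + apply (ex_derive_continuous (V := R_NormedModule)); auto_derive; auto. }
  assert (Z : e_primitive i (PI / 2) = 0).
  { assert (Q : forall m, Nat.Odd m -> cos (INR m * (PI / 2)) = 0)
      by (intros m Hm; apply (trig_quarter_turn m Hm)).
    unfold e_primitive; rewrite !Q; [ring|exists i|exists (i + 2)%nat|exists (i + 1)%nat]; lia. }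
  rewrite (is_RInt_unique _ _ _ _ HI), Z; equation_in_R; ring.
Qed.

Lemma e_primitive_bound : exists C, 0 < C /\ forall i x, Rabs (e_primitive i x) <= C / omega i.
Proof.
  destruct kappa_omega_bound as [K [K0 HK]].
  exists (2 * K); split; [lra|]; intros i x.
  assert (Ho := omega_pos i); assert (Hk := kappa_pos i); specialize (HK i).
  apply Rle_trans with (kappa i * 2).
  - unfold e_primitive; rewrite Rabs_mult, (Rabs_right (kappa i)) by lra.
    apply Rmult_le_compat_l; [lra|].
    assert (A : 0 <= (omega i - 1) / (4 * (omega i + 2)) <= / 4).
    { split; [apply Rmult_le_pos; [lra|apply Rlt_le, Rinv_0_lt_compat; lra]|].
      apply Rmult_le_reg_r with (4 * (omega i + 2)); [lra|].
      unfold Rdiv; rewrite Rmult_assoc, Rinv_l; lra. }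
    assert (B : 0 <= (omega i + 1) / (4 * (omega i - 2)) <= 1).
    { split; [apply Rmult_le_pos; [lra|apply Rlt_le, Rinv_0_lt_compat; lra]|].
      apply Rmult_le_reg_r with (4 * (omega i - 2)); [lra|].
      unfold Rdiv; rewrite Rmult_assoc, Rinv_l; lra. }
    assert (T : forall a b u, 0 <= a <= b -> Rabs (a * cos u) <= b).
    { intros a b u H; rewrite Rabs_mult, (Rabs_right a) by lra.
      generalize (abs_cos_le u) (Rabs_pos (cos u)); nra. }
    apply Rle_trans with (1 := Rabs_triang _ _).
    assert (T1 := T _ _ (INR (2 * i + 1) * x) B).
    assert (T2 := T _ _ (INR (2 * i + 5) * x) A).
    assert (T3 := T (/ 2) (/ 2) (INR (2 * i + 3) * x) ltac:(lra)).
    assert (T4 := Rabs_triang (/ 2 * cos (INR (2 * i + 3) * x))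
       ((omega i - 1) / (4 * (omega i + 2)) * cos (INR (2 * i + 5) * x))).
    lra.
  - apply Rmult_le_reg_r with (omega i); [lra|].
    unfold Rdiv; rewrite Rmult_assoc, (Rmult_assoc (2 * K)), Rinv_l by lra; lra.
Qed.

Lemma RRbar_eq i j k :
  RRbar 0 k j i
  = RInt (fun x => - e0_amplitude * (cos x ^ 2 * sin x) * de_tan k x * e_tan j x * e_primitive i x)
      0 (PI / 2).
Proof.
  apply RInt_quadrant_ext; intros x Hx.
  rewrite RInt_e_primitive, Derive_e0, omega_0, <- de_tan_quadrant, <- e_tan_quadrant by auto.
  unfold tan; field.
  generalize (quadrant_trig_pos x Hx) (omega_pos k); lra.
Qed.

Lemma continuous_RRbar_weight : continuous_on_quadrant (fun x => - e0_amplitude * (cos x ^ 2 * sin x)).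
Proof.
  intros x _; apply (ex_derive_continuous (V := R_NormedModule)); auto_derive; auto.
Qed.

Lemma RRbar_bound : exists C, 0 <= C /\ forall i j k, Rabs (RRbar 0 k j i) <= C / omega i.
Proof.
  destruct (bounded_on_quadrant _ continuous_RRbar_weight) as [B [B0 HB]].
  destruct modes_bounded as [C [C0 HC]].
  destruct e_primitive_bound as [D [D0 HD]].
  exists (PI / 2 * (B * C * C * D)); split.
  { assert (HP := PI_RGT_0); apply Rmult_le_pos; [lra|].
    repeat (apply Rmult_le_pos; [|lra]); lra. }
  intros i j k; rewrite RRbar_eq.
  replace (PI / 2 * (B * C * C * D) / omega i) with (PI / 2 * (B * C * C * (D / omega i)))
    by (unfold Rdiv; ring).
  apply (RInt_quadrant_product4 (fun x => - e0_amplitude * (cos x ^ 2 * sin x)));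
    auto using continuous_RRbar_weight; try apply modes_continuous; try (intros x; apply HC).
  intros x _; apply (ex_derive_continuous (V := R_NormedModule)); eexists.
  apply is_derive_e_primitive.
Qed.

(** The frequencies of [e_primitive] are at least omega_i - 2 and the weight
    cos^2 sin has degree 3, so orthogonality applies to each of its three terms. *)
Lemma RRbar_zero i j k :
  ((2 * k + 3) + (2 * j + 3) + 8 <= 2 * i + 3)%nat -> RRbar 0 k j i = 0.
Proof.
  intros H; destruct odd_trig_poly_modes as [C [C0 HC]].
  destruct (HC j) as [Tj _]; destruct (HC k) as [_ [Vk _]].
  set (f := fun x => - e0_amplitude * (cos x ^ 2 * sin x)).
  assert (Cf : continuous_on_quadrant f) by apply continuous_RRbar_weight.
  assert (Cn : forall n, continuous_on_quadrant (fun x => f x * cos (INR n * x))).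
  { intros n; apply continuous_on_quadrant_mult; auto.
    intros x _; apply continuous_cos_scaled. }
  assert (Cg : forall n, continuous_on_quadrant
            (fun x => f x * cos (INR n * x) * de_tan k x * e_tan j x)).
  { intros n; apply (continuous_on_quadrant_mult (fun x => f x * cos (INR n * x) * de_tan k x));
      [|apply modes_continuous].
    apply continuous_on_quadrant_mult; [auto|apply modes_continuous]. }
  assert (Z : forall n, Nat.Odd n -> ((2 * k + 3) + (2 * j + 3) + 6 <= n)%nat ->
     @eq R (RInt (fun x => f x * cos (INR n * x) * de_tan k x * e_tan j x) 0 (PI / 2)) 0).
  { intros n On Hn; apply Rabs_eq_0, Rle_antisym; [|apply Rabs_pos].
    apply Rle_trans with (C * C * 0); [|lra].
    apply (RInt_two_odd_trig_polys cos sin (2 * k + 3) (2 * j + 3) C C _ _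
       (fun x => f x * cos (INR n * x))); auto using continuous_sin, continuous_cos; [lra|].
    intros m l Om Hm Ol Hl.
    apply (triple_cos_cos_sin f 6); auto; [|lia].
    apply (sine_integral_small_three _ 5 (- e0_amplitude / 4) (- e0_amplitude / 4) 0); [lia|].
    intros x; unfold f; rewrite cos_pow2_sin; field. }
  rewrite RRbar_eq.
  rewrite (RInt_quadrant_ext _ (fun x =>
    kappa i * / 2 * (f x * cos (INR (2 * i + 3) * x) * de_tan k x * e_tan j x)
    + (kappa i * ((omega i - 1) / (4 * (omega i + 2)))
         * (f x * cos (INR (2 * i + 5) * x) * de_tan k x * e_tan j x)
       + kappa i * ((omega i + 1) / (4 * (omega i - 2)))
         * (f x * cos (INR (2 * i + 1) * x) * de_tan k x * e_tan j x)))).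
  2:{ intros x _; unfold f, e_primitive; ring. }
  assert (Cs : forall s n, continuous_on_quadrant
            (fun x => s * (f x * cos (INR n * x) * de_tan k x * e_tan j x))).
  { intros s n; apply (continuous_on_quadrant_mult (fun _ => s)); auto.
    intros x _; apply continuous_const. }
  rewrite RInt_quadrant_plus; auto.
  2:{ intros x Hx; apply (continuous_plus
        (fun x => kappa i * ((omega i - 1) / (4 * (omega i + 2)))
         * (f x * cos (INR (2 * i + 5) * x) * de_tan k x * e_tan j x))); now apply Cs. }
  rewrite RInt_quadrant_plus, !RInt_quadrant_scal; auto.
  rewrite !Z; [equation_in_R; ring| | | | | |]; try lia.
  - now exists i.
  - exists (i + 2)%nat; lia.
  - exists (i + 1)%nat; lia.
Qed.

(** * Derivatives of the weights at the end points *)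

(** The given function F is only known inside the quadrant, and its derivatives
    there are those of a smooth function f defined beyond the end point. *)
Lemma endpoint_derivative_of_smooth U (near : (R -> Prop) -> Prop) F f t n :
  Filter near -> filter_le near (locally t) -> near (fun x => 0 < x < PI / 2) ->
  open U -> U t -> (forall x, 0 < x < PI / 2 -> U x) -> smooth U f ->
  (forall x, 0 < x < PI / 2 -> F x = f x) ->
  endpoint_derivative F n near (Derive_n f n t).
Proof.
  intros FF Hle Hnear HU Ht HUq Sf HF.
  assert (Hloc : forall x, 0 < x < PI / 2 -> locally x (fun y => f y = F y)).
  { intros x Hx.
    assert (O : open (fun y => 0 < y < PI / 2)) by (apply open_and; [apply open_gt|apply open_lt]).
    apply filter_imp with (2 := O x Hx); intros y Hy; symmetry; auto. }
  split.
  - intros m _; apply filter_imp with (2 := Hnear); intros x Hx.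
    apply ex_derive_n_ext_loc with f; auto.
    apply smooth_ex_derive_n with U; auto.
  - apply filterlim_ext_loc with (Derive_n f n).
    + apply filter_imp with (2 := Hnear); intros x Hx; apply Derive_n_ext_loc; auto.
    + apply (filterlim_filter_le_1 _ Hle).
      apply (smooth_continuous U); auto; now apply smooth_Derive_n.
Qed.

Lemma at_right_0_quadrant : at_right 0 (fun x => 0 < x < PI / 2).
Proof.
  assert (H : 0 < PI / 2) by (generalize PI_RGT_0; lra).
  exists (mkposreal _ H); intros y Hy Hy0.
  unfold ball in Hy; simpl in Hy; unfold AbsRing_ball, abs, minus, plus, opp in Hy; simpl in Hy.
  apply Rabs_def2 in Hy; lra.
Qed.

Lemma at_left_PI2_quadrant : at_left (PI / 2) (fun x => 0 < x < PI / 2).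
Proof.
  assert (H : 0 < PI / 2) by (generalize PI_RGT_0; lra).
  exists (mkposreal _ H); intros y Hy Hy0.
  unfold ball in Hy; simpl in Hy; unfold AbsRing_ball, abs, minus, plus, opp in Hy; simpl in Hy.
  apply Rabs_def2 in Hy; lra.
Qed.

Lemma endpoint_derivatives F f n :
  smooth two_sided f -> (forall x, 0 < x < PI / 2 -> F x = f x) ->
  (forall v, Derive_n f n 0 = v -> endpoint_derivative F n (at_right 0) v) /\
  (forall v, Derive_n f n (PI / 2) = v -> endpoint_derivative F n (at_left (PI / 2)) v).
Proof.
  intros Sf HF; destruct covers_quadrant_two_sided as [OU HU].
  assert (HP := PI_RGT_0).
  split; intros v <-; apply endpoint_derivative_of_smooth with two_sided; auto; try apply _.
  - apply filter_le_within.
  - apply at_right_0_quadrant.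
  - apply HU; lra.
  - intros x Hx; apply HU; lra.
  - apply filter_le_within.
  - apply at_left_PI2_quadrant.
  - apply HU; lra.
  - intros x Hx; apply HU; lra.
Qed.

Lemma first_nonvanishing_Gam a :
  first_nonvanishing_derivative (fun x => Gam a x / tan x) (2 * vanishing_rank a + 1).
Proof.
  destruct (Gam_weight a) as [W [AW HW]].
  set (f := fun x => sin x * cos x * W x).
  assert (Sf : smooth two_sided f).
  { apply smooth_weighted; [apply open_two_sided|apply smooth_sin_cos|apply AW]. }
  assert (HF : forall x, 0 < x < PI / 2 -> Gam a x / tan x = f x).
  { intros x Hx; rewrite HW by auto; unfold f, tan; field.
    generalize (quadrant_trig_pos x Hx); lra. }
  destruct (sin_cos_weight_derivatives _ _ AW) as [H1 [H2 H3]]; fold f in H1, H2, H3.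
  exists (vanishing_rank a); split; [reflexivity|split].
  - intros l Hl; split.
    + now apply (endpoint_derivatives _ f).
    + now apply (endpoint_derivatives _ f); [| |apply H2].
  - exists (Derive_n f (2 * vanishing_rank a + 1) (PI / 2)); split; auto.
    now apply (endpoint_derivatives _ f).
Qed.

Lemma no_nonvanishing_de0 :
  no_nonvanishing_derivative (fun x => Derive (e 0) x * cos x ^ 2).
Proof.
  set (f := fun x => -3 * e0_amplitude * (cos x ^ 4 * sin x)).
  assert (OE := open_everywhere).
  assert (Sf : smooth everywhere f).
  { apply smooth_scal; auto; apply smooth_mult; auto using smooth_sin.
    apply smooth_pow; auto using smooth_cos. }
  assert (HF : forall x, 0 < x < PI / 2 -> Derive (e 0) x * cos x ^ 2 = f x).
  { intros x _; rewrite Derive_e0; unfold f; ring. }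
  assert (Sf' := smooth_everywhere_on two_sided f Sf).
  intros l; split.
  - apply (endpoint_derivatives _ f); auto.
    apply (Derive_n_reflection_center everywhere 0 (-1)); auto; try easy.
    + intros x _; replace (2 * 0 - x) with (- x) by ring.
      unfold f; rewrite sin_neg, cos_neg; ring.
    + rewrite pow_1_even; ring.
  - apply (endpoint_derivatives _ f); auto.
    apply (Derive_n_reflection_center everywhere (PI / 2) 1); auto; try easy.
    + intros x _; unfold f; rewrite sin_reflect, cos_reflect; ring.
    + rewrite pow_m1_odd; ring.
Qed.

Lemma bigO_intro (q f : nat -> R) C :
  (forall n, Rabs (q n) <= C * Rabs (f n)) -> bigO q f.
Proof. intros H; exists C; exists 0%nat; auto. Qed.

(** * The estimates along sequences *)

(** The smallest combination omega_i - omega_j - omega_k contributes the largest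
    term of the sum, so a bound by that term is enough. *)
Lemma sum_bigO_intro q (f : bool -> bool -> nat -> R) C :
  0 <= C -> eventually (fun n => Rabs (q n) <= C * Rabs (f false false n)) -> sum_bigO q f.
Proof.
  intros HC H; exists C; revert H; apply filter_imp; intros n Hn.
  apply Rle_trans with (1 := Hn), Rmult_le_compat_l; auto.
  unfold sum_pm.
  generalize (Rabs_pos (f true true n)) (Rabs_pos (f true false n)) (Rabs_pos (f false true n)); lra.
Qed.

Lemma comb_eventually_large i j k A :
  all_combs_infty i j k ->
  eventually (fun n => A < comb false false (i n) (j n) (k n)).
Proof.
  intros H; specialize (H false false).
  apply (H (fun y => A < y)); exists A; auto.
Qed.

Lemma comb_false_false i j k : comb false false i j k = omega i - omega j - omega k.
Proof. unfold comb, sgn; ring. Qed.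

Lemma comb_large_nat i j k (m : nat) :
  INR m < comb false false i j k -> ((2 * k + 3) + (2 * j + 3) + m <= 2 * i + 3)%nat.
Proof.
  rewrite comb_false_false; intros H; apply Nat.lt_le_incl, INR_lt.
  rewrite (plus_INR (2 * k + 3 + (2 * j + 3))), (plus_INR (2 * k + 3)), <- !omega_INR; lra.
Qed.

Theorem proposition4p2 :
  forall N : nat,
  (forall i j k : nat -> nat,
     tends_to_infty (fun n => INR (i n)) ->
     tends_to_infty (fun n => INR (j n)) ->
     tends_to_infty (fun n => INR (k n)) ->
     (* (a) *)
     (forall a : index,
        (some_comb_not_infty i j k ->
           bigO (fun n => omega (i n) * FF a (j n) (k n) (i n))
                (fun n => omega (i n) * omega (k n)) /\
           bigO (fun n => omega (i n) * FFbar a (j n) (k n) (i n))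
                (fun n => omega (i n) * omega (k n))) /\
        (all_combs_infty i j k ->
           sum_bigO (fun n => omega (i n) * FF a (j n) (k n) (i n))
                    (fun s t n => omega (i n)
                                  / comb s t (i n) (j n) (k n) ^ decay a) /\
           sum_bigO (fun n => omega (i n) * FFbar a (j n) (k n) (i n))
                    (fun s t n => omega (i n)
                                  / comb s t (i n) (j n) (k n) ^ decay a))) /\
     (* (b) *)
     (some_comb_not_infty i j k ->
        bigO (fun n => omega 0 * RRbar 0 (k n) (j n) (i n))
             (fun n => omega (j n) * / omega (i n)) /\
        bigO (fun n => omega 0 * RR 0 (k n) (j n) (i n) / omega (i n))
             (fun n => omega (j n) * / omega (i n))) /\
     (all_combs_infty i j k ->
        sum_bigO (fun n => omega 0 * RRbar 0 (k n) (j n) (i n))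
                 (fun s t n => 1 / omega (i n)
                               * (1 / comb s t (i n) (j n) (k n) ^ N)) /\
        sum_bigO (fun n => omega 0 * RR 0 (k n) (j n) (i n) / omega (i n))
                 (fun s t n => 1 / omega (i n)
                               * (1 / comb s t (i n) (j n) (k n) ^ N)))) /\
  (* (c) *)
  (first_nonvanishing_derivative (fun x => Gam I1 x / tan x) 7 /\
   first_nonvanishing_derivative (fun x => Gam I2 x / tan x) 9 /\
   first_nonvanishing_derivative (fun x => Gam I3 x / tan x) 1 /\
   first_nonvanishing_derivative (fun x => Gam I4 x / tan x) 1 /\
   no_nonvanishing_derivative (fun x => Derive (e 0) x * cos x ^ 2)).
Proof.
  intros N; split.
  2:{ exact (conj (first_nonvanishing_Gam I1) (conj (first_nonvanishing_Gam I2)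
        (conj (first_nonvanishing_Gam I3) (conj (first_nonvanishing_Gam I4)
          no_nonvanishing_de0)))). }
  intros i j k _ _ _.
  assert (Po : forall n, 0 < omega n) by (intros n; generalize (omega_pos n); lra).
  split; [intros a; split|split].
  - intros _; destruct (FF_bound a) as [C HC].
    split; apply bigO_intro with C; intros n;
      destruct (HC (i n) (j n) (k n)) as [H1 H2];
      rewrite !Rabs_mult, (Rabs_right (omega (k n))) by (apply Rle_ge, Rlt_le, Po);
      rewrite (Rmult_comm (Rabs (omega (i n))) (omega _)), <- Rmult_assoc, Rmult_comm;
      (apply Rmult_le_compat_r; [apply Rabs_pos|assumption]).
  - intros Hinf; destruct (FF_decay a) as [C [C0 HC]].
    assert (Hev := comb_eventually_large i j k 0 Hinf).
    split; apply sum_bigO_intro with C; auto; revert Hev; apply filter_imp; intros n Hn;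
      destruct (HC (i n) (j n) (k n) Hn) as [H1 H2];
      unfold Rdiv; rewrite !Rabs_mult, (Rabs_right (/ _))
        by (apply Rle_ge, Rlt_le, Rinv_0_lt_compat, pow_lt; exact Hn);
      rewrite Rmult_comm, (Rmult_comm (Rabs (omega (i n)))), <- Rmult_assoc;
      (apply Rmult_le_compat_r; [apply Rabs_pos|assumption]).
  - intros _; split.
    + destruct RRbar_bound as [C [C0 HC]]; apply bigO_intro with (3 * C); intros n.
      rewrite omega_0, !Rabs_mult, (Rabs_right 3), (Rabs_right (omega _)), (Rabs_right (/ _));
        try (apply Rle_ge, Rlt_le; auto using Rinv_0_lt_compat); [|lra].
      rewrite Rmult_assoc; apply Rmult_le_compat_l; [lra|].
      apply Rle_trans with (1 := HC _ _ _); apply Rmult_le_compat_l; auto.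
      rewrite <- (Rmult_1_l (/ omega (i n))) at 1.
      apply Rmult_le_compat_r; [apply Rlt_le; auto using Rinv_0_lt_compat|].
      generalize (omega_pos (j n)); lra.
    + destruct RR_bound as [C HC]; apply bigO_intro with (3 * C); intros n.
      unfold Rdiv.
      rewrite omega_0, !Rabs_mult, (Rabs_right 3), (Rabs_right (omega _)), (Rabs_right (/ _));
        try (apply Rle_ge, Rlt_le; auto using Rinv_0_lt_compat); [|lra].
      rewrite <- Rmult_assoc.
      apply Rmult_le_compat_r; [apply Rlt_le; auto using Rinv_0_lt_compat|].
      assert (H1 := HC (i n) (j n) (k n)).
      generalize (omega_pos (j n)) (Rabs_pos (RR 0 (k n) (j n) (i n))); nra.
  - intros Hinf; assert (Hev := comb_eventually_large i j k (INR 8) Hinf).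
    split; apply sum_bigO_intro with 0; try lra; revert Hev; apply filter_imp; intros n Hn;
      apply comb_large_nat in Hn.
    + rewrite RRbar_zero by exact Hn; rewrite Rmult_0_r, Rabs_R0; lra.
    + rewrite RR_zero by lia; unfold Rdiv; rewrite Rmult_0_r, Rmult_0_l, Rabs_R0; lra.
Qed.
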